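(* Let $N\ge1$. The abelian category of finitely generated $\mathbb Z$-graded $F_N$-modules is equivalent to the abelian category of finite-dimensional $\mathbb Z$-graded modules over the exterior algebra $Z(\mathfrak g_N)$, via the mutually inverse functors $$M\mapsto\Omega(M),\qquad M_0\mapsto \mathrm{Ind}_{Z_N\oplus\mathfrak g_{N,>0}}^{\mathfrak g_N}(M_0)=U(\mathfrak g_N)\otimes_{U(Z_N\oplus\mathfrak g_{N,>0})}M_0 .$$
   Context: $F_N$ is the free field algebra strongly generated by two odd fields $X^\pm(z)=\sum_{n\in\frac{N+1}{2}+\mathbb Z}X^\pm_nz^{-n-\frac{N+1}{2}}$ of conformal weight $\frac{N+1}{2}$ with only nontrivial OPE $X^+(z)X^-(w)\sim (z-w)^{-N-1}$. $\mathfrak g_N=\mathrm{Span}\{X^\pm_n: n\in\frac{N+1}{2}+\mathbb Z\}\oplus\mathbb C1$ is the associated Lie superalgebra of modes: the $X^\pm_n$ are odd, $1$ is even central (acting as the identity on all modules considered), $[X^+_n,X^-_m]=\binom{n+\frac{N-1}{2}}{N}\delta_{n+m,0}$, and all other brackets vanish. Put $\mathfrak g_{N,>0}=\mathrm{Span}\{X^\pm_n:n>\frac{N-1}{2}\}$, $\mathfrak g_{N,<0}=\mathrm{Span}\{X^\pm_n:n<-\frac{N-1}{2}\}$, $Z_N=\mathrm{Span}\{X^\pm_n:|n|\le\frac{N-1}{2}\}\oplus\mathbb C1$, so $\mathfrak g_N=\mathfrak g_{N,<0}\oplus Z_N\oplus\mathfrak g_{N,>0}$. $Z(\mathfrak g_N)$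 is the center of $U(\mathfrak g_N)$ (with $1\in\mathfrak g_N$ identified with the unit); it is the exterior algebra on the $2N$ generators $X^\pm_i$, $i=-\frac{N-1}{2},-\frac{N-1}{2}+1,\dots,\frac{N-1}{2}$. The $\mathbb Z$-grading on $F_N$, $\mathfrak g_N$ and $Z(\mathfrak g_N)$ is given by $\deg X^\pm_n=\pm1$, $\deg 1=0$; graded modules carry compatible $\mathbb Z$-gradings and morphisms preserve them. For an $F_N$-module $M$, $\Omega(M)=\{m\in M:\mathfrak g_{N,>0}m=0\}$, a $Z(\mathfrak g_N)$-module. In the induced module, $\mathfrak g_{N,>0}$ acts by zero on $M_0$. *)

(* Defs.v *)
From HB Require Import structures.
From mathcomp Require Import all_boot all_order all_algebra.
From mathcomp Require Import boolp reals.
From mathcomp Require Import complex.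

Set Implicit Arguments.
Unset Strict Implicit.
Unset Printing Implicit Defensive.

Import Order.TTheory GRing.Theory Num.Theory.
Local Open Scope ring_scope.

Record category := Category {
  Ob :> Type;
  Hom : Ob -> Ob -> Type;
  idm : forall A, Hom A A;
  compm : forall A B C, Hom B C -> Hom A B -> Hom A C;
  compm1 : forall A B (f : Hom A B), compm f (idm A) = f;
  comp1m : forall A B (f : Hom A B), compm (idm B) f = f;
  compmA : forall A B C D (h : Hom C D) (g : Hom B C) (f : Hom A B),
    compm h (compm g f) = compm (compm h g) f }.

Arguments idm {c} A.
Notation "g \c f" := (compm g f) (at level 40, left associativity).

Record functor (C D : category) := Functor {
  fob :> C -> D;
  fmap : forall A B, Hom A B -> Hom (fob A) (fob B);
  fmap1 : forall A, fmap (idm A) = idm (fob A);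
  fmapM : forall A B E (g : Hom B E) (f : Hom A B),
    fmap (g \c f) = fmap g \c fmap f }.

Definition functor_id (C : category) : functor C C :=
  {| fob := fun A => A; fmap := fun A B f => f;
     fmap1 := fun A => erefl; fmapM := fun A B E g f => erefl |}.

Program Definition functor_comp (C D E : category)
    (G : functor D E) (F : functor C D) : functor C E :=
  {| fob := fun A => G (F A); fmap := fun A B f => fmap G (fmap F f) |}.
Next Obligation. by rewrite !fmap1. Qed.
Next Obligation. by rewrite !fmapM. Qed.

Section CategoryNotions.
Variable C : category.

Definition is_iso (A B : C) (f : Hom A B) : Prop :=
  exists g : Hom B A, g \c f = idm A /\ f \c g = idm B.

Definition is_zero_object (Z : C) : Prop :=
  forall A : C, (exists! f : Hom A Z, True) /\ (exists! f : Hom Z A, True).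

Definition is_zero_morphism (A B : C) (f : Hom A B) : Prop :=
  exists (Z : C) (g : Hom A Z) (h : Hom Z B), is_zero_object Z /\ f = h \c g.

Definition is_product (A B P : C) (p : Hom P A) (q : Hom P B) : Prop :=
  forall (X : C) (f : Hom X A) (g : Hom X B),
    exists! h : Hom X P, p \c h = f /\ q \c h = g.

Definition is_coproduct (A B S : C) (i : Hom A S) (j : Hom B S) : Prop :=
  forall (X : C) (f : Hom A X) (g : Hom B X),
    exists! h : Hom S X, h \c i = f /\ h \c j = g.

Definition is_kernel (A B K : C) (f : Hom A B) (k : Hom K A) : Prop :=
  is_zero_morphism (f \c k) /\
  forall (X : C) (g : Hom X A), is_zero_morphism (f \c g) ->
    exists! h : Hom X K, k \c h = g.

Definition is_cokernel (A B Q : C) (f : Hom A B) (q : Hom B Q) : Prop :=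
  is_zero_morphism (q \c f) /\
  forall (X : C) (g : Hom B X), is_zero_morphism (g \c f) ->
    exists! h : Hom Q X, h \c q = g.

Definition is_mono (A B : C) (f : Hom A B) : Prop :=
  forall (X : C) (g h : Hom X A), f \c g = f \c h -> g = h.

Definition is_epi (A B : C) (f : Hom A B) : Prop :=
  forall (X : C) (g h : Hom B X), g \c f = h \c f -> g = h.

(* Freyd's definition; the additive structure on the Hom-sets is determined by
   the category, so it is not part of the data. *)
Record is_abelian : Prop := IsAbelian {
  ab_zero : exists Z : C, is_zero_object Z;
  ab_prod : forall A B : C,
    exists (P : C) (p : Hom P A) (q : Hom P B), is_product p q;
  ab_coprod : forall A B : C,
    exists (S : C) (i : Hom A S) (j : Hom B S), is_coproduct i j;
  ab_ker : forall (A B : C) (f : Hom A B),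
    exists (K : C) (k : Hom K A), is_kernel f k;
  ab_coker : forall (A B : C) (f : Hom A B),
    exists (Q : C) (q : Hom B Q), is_cokernel f q;
  ab_mono : forall (A B : C) (f : Hom A B), is_mono f ->
    exists (X : C) (g : Hom B X), is_kernel g f;
  ab_epi : forall (A B : C) (f : Hom A B), is_epi f ->
    exists (X : C) (g : Hom X A), is_cokernel g f }.

End CategoryNotions.

Definition naturally_isomorphic (C D : category) (F G : functor C D) : Prop :=
  exists eta : forall A : C, Hom (F A) (G A),
    (forall A, is_iso (eta A)) /\
    (forall (A B : C) (f : Hom A B), eta B \c fmap F f = fmap G f \c eta A).

Definition mutually_inverse (C D : category)
    (F : functor C D) (G : functor D C) : Prop :=
  naturally_isomorphic (functor_comp G F) (functor_id C) /\
  naturally_isomorphic (functor_comp F G) (functor_id D).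

(* [gr i m] says that m is homogeneous of degree i; 0 has every degree. *)
Record is_grading (I : eqType) (M : zmodType) (gr : I -> M -> Prop) : Prop :=
  IsGrading {
  gr0 : forall i, gr i 0;
  grB : forall i x y, gr i x -> gr i y -> gr i (x - y);
  gr_span : forall m, exists (s : seq I) (f : I -> M),
    (forall i, gr i (f i)) /\ m = \sum_(i <- s) f i;
  gr_direct : forall (s : seq I) (f : I -> M), uniq s ->
    (forall i, gr i (f i)) -> \sum_(i <- s) f i = 0 ->
    forall i, i \in s -> f i = 0 }.

Definition is_vgrading (K : fieldType) (I : eqType) (M : lmodType K)
    (gr : I -> M -> Prop) : Prop :=
  is_grading gr /\ forall i (c : K) m, gr i m -> gr i (c *: m).

Section Vertex.
Variable K : fieldType.

Definition zbinom (p : int) (i : nat) : K :=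
  (\prod_(j < i) (p - j%:Z))%:~R / (i`!)%:R.

(* The Borcherds identity for the products u_(n)v of V acting on M by u_(n)m,
   where u(z) = \sum_n u_(n) z^(-n-1):
     \sum_i binom(p,i) (u_(r+i)v)_(p+q-i) m =
     \sum_i (-1)^i binom(r,i) (u_(p+r-i) v_(q+i) m
                               - (-1)^(r+|u||v|) v_(q+r-i) u_(p+i) m).
   By truncation both sums over i >= 0 are finite, so the identity says that
   their partial sums eventually agree. *)
Definition borcherds_identity (V M : lmodType K) (par : bool -> V -> Prop)
    (prod : int -> V -> V -> V) (act : int -> V -> M -> M) : Prop :=
  forall (a b : bool) (u v : V) (m : M) (p q r : int), par a u -> par b v ->
  exists L : nat, forall l : nat, (L <= l)%N ->
    \sum_(i < l) zbinom p i *: act (p + q - i%:Z) (prod (r + i%:Z) u v) m =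
    \sum_(i < l) ((-1) ^+ i * zbinom r i) *:
      (act (p + r - i%:Z) u (act (q + i%:Z) v m)
       - ((-1) ^ r * (-1) ^+ (a && b)) *:
           act (q + r - i%:Z) v (act (p + i%:Z) u m)).

Definition truncated (V M : lmodType K) (act : int -> V -> M -> M) : Prop :=
  forall u m, exists n0 : int, forall n, n0 <= n -> act n u m = 0.

Record vertexSuperalgebra := VertexSuperalgebra {
  va_space :> lmodType K;
  va_par : bool -> va_space -> Prop;
  va_prod : int -> va_space -> va_space -> va_space;
  vac : va_space;
  va_parP : is_vgrading va_par;
  va_par_vac : va_par false vac;
  va_par_prod : forall a b n u v, va_par a u -> va_par b v ->
    va_par (a (+) b) (va_prod n u v);
  va_lin_l : forall n v, linear (fun u => va_prod n u v);
  va_lin_r : forall n u, linear (va_prod n u);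
  va_trunc : truncated va_prod;
  va_vac_l : forall n v, va_prod n vac v = if n == -1 then v else 0;
  va_create : forall v, va_prod (-1) v vac = v;
  va_create0 : forall (n : nat) v, va_prod n%:Z v vac = 0;
  va_borcherds : borcherds_identity va_par va_prod va_prod }.

Record is_vertex_module (V : vertexSuperalgebra) (M : lmodType K)
    (act : int -> V -> M -> M) : Prop := IsVertexModule {
  vm_lin_l : forall n m, linear (fun u => act n u m);
  vm_lin_r : forall n u, linear (act n u);
  vm_trunc : truncated act;
  vm_vac : forall n m, act n (vac V) m = if n == -1 then m else 0;
  vm_borcherds : borcherds_identity (@va_par V) (@va_prod V) act }.

(* A pair (s, k) stands for the mode X^s_n of the Lie
   superalgebra g_N with n = k - (N-1)/2, where [true] is +.  Then
   X^s(z) = \sum_n X^s_n z^(-n-(N+1)/2) = \sum_k X^s_(k) z^(-k-1), the index k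
   runs over all integers, and the conditions n > (N-1)/2, n < -(N-1)/2 and
   |n| <= (N-1)/2 become k >= N, k < 0 and 0 <= k < N. *)
Definition mode : Type := (bool * int)%type.

Definition charge (s : bool) : int := if s then 1 else -1.

(* These properties determine F_N up to isomorphism: a vertex superalgebra with
   nonzero vacuum that is strongly generated by X^+, X^- with this OPE is the
   exterior algebra on the modes X^s_(k), k < 0, and its two gradings are forced.
   The OPE X^-(z)X^+(w) follows from [ff_ope] by skew-symmetry. *)
Record freeFieldAlgebra (N : nat) := FreeFieldAlgebra {
  ff_va :> vertexSuperalgebra;
  ffX : bool -> ff_va;
  ff_nonzero : vac ff_va <> 0;
  ffX_odd : forall s, va_par true (ffX s);
  (* Strong generation: F_N is spanned by the monomials in the X^s_(-n-1),
     n >= 0, applied to the vacuum. *)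
  ff_strong : forall P : ff_va -> Prop,
    (forall (c : K) u v, P u -> P v -> P (c *: u + v)) ->
    P (vac ff_va) ->
    (forall s (n : nat) v, P v -> P (va_prod (- n.+1%:Z) (ffX s) v)) ->
    forall v, P v;
  (* The OPE X^+(z)X^-(w) ~ (z-w)^(-N-1). *)
  ff_ope : forall n : nat, va_prod n%:Z (ffX true) (ffX false) =
    if n == N then vac ff_va else 0;
  ff_ope0 : forall s (n : nat), va_prod n%:Z (ffX s) (ffX s) = 0;
  (* [ff_wt h v] says that v has conformal weight h/2. *)
  ff_wt : int -> ff_va -> Prop;
  ff_wtP : is_vgrading ff_wt;
  ff_wt_vac : ff_wt 0 (vac ff_va);
  ff_wtX : forall s, ff_wt N.+1%:Z (ffX s);
  ff_wt_prod : forall h h' n u v, ff_wt h u -> ff_wt h' v ->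
    ff_wt (h + h' - 2 * (n + 1)) (va_prod n u v);
  ff_gr : int -> ff_va -> Prop;
  ff_grP : is_vgrading ff_gr;
  ff_gr_vac : ff_gr 0 (vac ff_va);
  ff_grX : forall s, ff_gr (charge s) (ffX s);
  ff_gr_prod : forall a b n u v, ff_gr a u -> ff_gr b v ->
    ff_gr (a + b) (va_prod n u v) }.

Section ModulesOfF.
Variables (N : nat) (F : freeFieldAlgebra N).

Record fgModule := FgModule {
  fg_space :> lmodType K;
  fg_act : int -> F -> fg_space -> fg_space;
  fg_module : is_vertex_module fg_act;
  fg_gr : int -> fg_space -> Prop;
  fg_grP : is_vgrading fg_gr;
  fg_gr_act : forall a i n u m, ff_gr a u -> fg_gr i m ->
    fg_gr (i + a) (fg_act n u m);
  fg_finite : exists s : seq fg_space, forall P : fg_space -> Prop,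
    (forall (c : K) x y, P x -> P y -> P (c *: x + y)) ->
    (forall n u x, P x -> P (fg_act n u x)) ->
    (forall x, x \in s -> P x) -> forall x, P x }.

Record fgHom (M M' : fgModule) := FgHom {
  fgh :> M -> M';
  fgh_linear : linear fgh;
  fgh_act : forall n u m, fgh (fg_act n u m) = fg_act n u (fgh m);
  fgh_gr : forall i m, fg_gr i m -> fg_gr i (fgh m) }.

Lemma fgHom_eq (M M' : fgModule) (f g : fgHom M M') : f =1 g -> f = g.
Proof.
case: f => f f1 f2 f3; case: g => g g1 g2 g3 /= /funext E.
by case: _ / E in g1 g2 g3 *; congr FgHom; apply: Prop_irrelevance.
Qed.

Program Definition fgHom_id (M : fgModule) : fgHom M M := @FgHom M M id _ _ _.
Next Obligation. by []. Qed.

Program Definition fgHom_comp (M1 M2 M3 : fgModule)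
    (g : fgHom M2 M3) (f : fgHom M1 M2) : fgHom M1 M3 :=
  @FgHom M1 M3 (g \o f) _ _ _.
Next Obligation. by move=> a x y; rewrite /= !fgh_linear. Qed.
Next Obligation. by rewrite !fgh_act. Qed.
Next Obligation. by do 2 apply: fgh_gr. Qed.

Program Definition fgCat : category :=
  @Category fgModule fgHom fgHom_id fgHom_comp _ _ _.
Next Obligation. exact: fgHom_eq. Qed.
Next Obligation. exact: fgHom_eq. Qed.
Next Obligation. exact: fgHom_eq. Qed.

Definition mode_act (M : fgModule) (x : mode) : M -> M :=
  fg_act x.2 (ffX F x.1).

Definition Omega (M : fgModule) (m : M) : Prop :=
  forall x : mode, N%:Z <= x.2 -> mode_act x m = 0.

End ModulesOfF.
End Vertex.

(* [enveloping b] is U(L), with the central element 1 of L identified with the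
   unit, for the Lie superalgebra L = Span I + K1 with odd basis I, brackets
   [x, y] = b x y 1 and 1 even and central: the K-algebra generated by I with
   relations x y + y x = b x y.  It is built as the quotient of ring terms by
   the congruence generated by the axioms. *)
Section Enveloping.
Variables (K : fieldType) (I : Type) (b : I -> I -> K).

Inductive uterm : Type :=
  | UConst of K | UGen of I | UOpp of uterm
  | UAdd of uterm & uterm | UMul of uterm & uterm.

Inductive ueq : uterm -> uterm -> Prop :=
  | ueq_refl x : ueq x x
  | ueq_sym x y : ueq x y -> ueq y x
  | ueq_trans x y z : ueq x y -> ueq y z -> ueq x z
  | ueq_opp x x' : ueq x x' -> ueq (UOpp x) (UOpp x')
  | ueq_add x x' y y' : ueq x x' -> ueq y y' -> ueq (UAdd x y) (UAdd x' y')
  | ueq_mul x x' y y' : ueq x x' -> ueq y y' -> ueq (UMul x y) (UMul x' y')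
  | ueq_addA x y z : ueq (UAdd x (UAdd y z)) (UAdd (UAdd x y) z)
  | ueq_addC x y : ueq (UAdd x y) (UAdd y x)
  | ueq_add0 x : ueq (UAdd (UConst 0) x) x
  | ueq_addN x : ueq (UAdd (UOpp x) x) (UConst 0)
  | ueq_mulA x y z : ueq (UMul x (UMul y z)) (UMul (UMul x y) z)
  | ueq_mul1 x : ueq (UMul (UConst 1) x) x
  | ueq_mulDl x y z : ueq (UMul (UAdd x y) z) (UAdd (UMul x z) (UMul y z))
  | ueq_mulDr x y z : ueq (UMul x (UAdd y z)) (UAdd (UMul x y) (UMul x z))
  | ueq_constD c d : ueq (UConst (c + d)) (UAdd (UConst c) (UConst d))
  | ueq_constM c d : ueq (UConst (c * d)) (UMul (UConst c) (UConst d))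
  | ueq_central c x : ueq (UMul (UConst c) x) (UMul x (UConst c))
  | ueq_bracket i j : ueq (UAdd (UMul (UGen i) (UGen j)) (UMul (UGen j) (UGen i)))
                          (UConst (b i j)).

HB.instance Definition _ := gen_eqMixin uterm.
HB.instance Definition _ := gen_choiceMixin uterm.

Definition urel : rel uterm := fun x y => `[<ueq x y>].

Lemma urel_refl : reflexive urel.
Proof. by move=> x; apply/asboolP/ueq_refl. Qed.
Lemma urel_sym : symmetric urel.
Proof. by move=> x y; apply/asboolP/asboolP; apply: ueq_sym. Qed.
Lemma urel_trans : transitive urel.
Proof. by move=> y x z /asboolP h /asboolP k; apply/asboolP/(ueq_trans h k). Qed.

Canonical urel_equiv := EquivRel urel urel_refl urel_sym urel_trans.

Definition enveloping : Type := {eq_quot urel}%qT.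

HB.instance Definition _ := Choice.on enveloping.

Definition upi (x : uterm) : enveloping := (\pi_{eq_quot urel} x)%qT.
Definition urepr (x : enveloping) : uterm := repr (x : {eq_quot urel}%qT).

Lemma upiP x y : upi x = upi y <-> ueq x y.
Proof.
split; last by move=> h; apply/eqmodP/asboolP.
by move=> /eqmodP/asboolP.
Qed.

Lemma ureprK x : upi (urepr x) = x. Proof. exact: reprK. Qed.

Lemma urepr_pi x : ueq (urepr (upi x)) x. Proof. by apply/upiP; rewrite ureprK. Qed.

Definition uconst (c : K) : enveloping := upi (UConst c).
Definition ugen (i : I) : enveloping := upi (UGen i).
Definition uopp (x : enveloping) := upi (UOpp (urepr x)).
Definition uadd (x y : enveloping) := upi (UAdd (urepr x) (urepr y)).
Definition umul (x y : enveloping) := upi (UMul (urepr x) (urepr y)).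

Lemma uopp_pi x : uopp (upi x) = upi (UOpp x).
Proof. exact/upiP/ueq_opp/urepr_pi. Qed.
Lemma uadd_pi x y : uadd (upi x) (upi y) = upi (UAdd x y).
Proof. by apply/upiP/ueq_add; apply: urepr_pi. Qed.
Lemma umul_pi x y : umul (upi x) (upi y) = upi (UMul x y).
Proof. by apply/upiP/ueq_mul; apply: urepr_pi. Qed.

Lemma upi_ind (P : enveloping -> Prop) : (forall x, P (upi x)) -> forall x, P x.
Proof. by move=> h x; rewrite -(ureprK x). Qed.

Lemma uaddA : associative uadd.
Proof.
elim/upi_ind=> x; elim/upi_ind=> y; elim/upi_ind=> z.
by rewrite !uadd_pi; apply/upiP/ueq_addA.
Qed.
Lemma uaddC : commutative uadd.
Proof.
by elim/upi_ind=> x; elim/upi_ind=> y; rewrite !uadd_pi; apply/upiP/ueq_addC.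
Qed.
Lemma uadd0 : left_id (uconst 0) uadd.
Proof. by elim/upi_ind=> x; rewrite uadd_pi; apply/upiP/ueq_add0. Qed.
Lemma uaddN : left_inverse (uconst 0) uopp uadd.
Proof. by elim/upi_ind=> x; rewrite uopp_pi uadd_pi; apply/upiP/ueq_addN. Qed.
Lemma umulA : associative umul.
Proof.
elim/upi_ind=> x; elim/upi_ind=> y; elim/upi_ind=> z.
by rewrite !umul_pi; apply/upiP/ueq_mulA.
Qed.
Lemma umul1 : left_id (uconst 1) umul.
Proof. by elim/upi_ind=> x; rewrite umul_pi; apply/upiP/ueq_mul1. Qed.
Lemma umulr1 : right_id (uconst 1) umul.
Proof.
elim/upi_ind=> x; rewrite umul_pi; apply/upiP.
exact: ueq_trans (ueq_sym (ueq_central 1 x)) (ueq_mul1 x).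
Qed.
Lemma umulDl : left_distributive umul uadd.
Proof.
elim/upi_ind=> x; elim/upi_ind=> y; elim/upi_ind=> z.
by rewrite !(uadd_pi, umul_pi); apply/upiP/ueq_mulDl.
Qed.
Lemma umulDr : right_distributive umul uadd.
Proof.
elim/upi_ind=> x; elim/upi_ind=> y; elim/upi_ind=> z.
by rewrite !(uadd_pi, umul_pi); apply/upiP/ueq_mulDr.
Qed.

HB.instance Definition _ := GRing.isPzRing.Build enveloping
  uaddA uaddC uadd0 uaddN umulA umul1 umulr1 umulDl umulDr.

(* The Z-grading of [enveloping b] induced by degrees of the generators;
   constants have degree 0. *)
Inductive udegree (deg : I -> int) : int -> enveloping -> Prop :=
  | udegree0 a : udegree deg a 0
  | udegree_const c : udegree deg 0 (uconst c)
  | udegree_gen i : udegree deg (deg i) (ugen i)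
  | udegreeD a x y : udegree deg a x -> udegree deg a y -> udegree deg a (x + y)
  | udegreeM a a' x y : udegree deg a x -> udegree deg a' y ->
      udegree deg (a + a') (x * y).

End Enveloping.

Section EnvelopingMap.
Variables (K : fieldType) (I J : Type) (b : I -> I -> K) (b' : J -> J -> K).
Variable f : I -> enveloping b'.
Hypothesis f_bracket : forall i j, f i * f j + f j * f i = uconst b' (b i j).

Fixpoint ueval (x : uterm K I) : enveloping b' :=
  match x with
  | UConst c => uconst b' c
  | UGen i => f i
  | UOpp y => - ueval y
  | UAdd y z => ueval y + ueval z
  | UMul y z => ueval y * ueval z
  end.

Lemma ueval_eq x y : ueq b x y -> ueval x = ueval y.
Proof.
elim=> //=.
- by move=> x1 x2 x3 _ -> _ ->.
- by move=> x1 x2 _ ->.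
- by move=> x1 x2 x3 x4 _ -> _ ->.
- by move=> x1 x2 x3 x4 _ -> _ ->.
- by move=> *; rewrite addrA.
- by move=> *; rewrite addrC.
- by move=> *; apply: add0r.
- by move=> *; apply: addNr.
- by move=> *; rewrite mulrA.
- by move=> *; apply: mul1r.
- by move=> *; rewrite mulrDl.
- by move=> *; rewrite mulrDr.
- by move=> c d; rewrite [RHS]uadd_pi; apply/upiP/ueq_constD.
- by move=> c d; rewrite [RHS]umul_pi; apply/upiP/ueq_constM.
- move=> c x'; elim/upi_ind: (ueval x') => z.
  by rewrite [LHS]umul_pi [RHS]umul_pi; apply/upiP/ueq_central.
Qed.

Definition umap (x : enveloping b) : enveloping b' := ueval (urepr x).

Lemma umap_pi x : umap (upi b x) = ueval x.
Proof. exact/ueval_eq/urepr_pi. Qed.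

Lemma umapB : zmod_morphism umap.
Proof.
elim/upi_ind=> x; elim/upi_ind=> y.
have -> : upi b x - upi b y = upi b (UAdd x (UOpp y)).
  by rewrite -uadd_pi -uopp_pi.
by rewrite !umap_pi.
Qed.

Lemma umapM : monoid_morphism umap.
Proof.
split; first exact: umap_pi.
elim/upi_ind=> x; elim/upi_ind=> y.
have -> : upi b x * upi b y = upi b (UMul x y) by rewrite -umul_pi.
by rewrite !umap_pi.
Qed.

Definition umap_additive := GRing.isZmodMorphism.Build _ _ umap umapB.
Definition umap_multiplicative := GRing.isMonoidMorphism.Build _ _ umap umapM.

Definition umap_rmorphism : {rmorphism enveloping b -> enveloping b'} :=
  HB.pack umap umap_additive umap_multiplicative.

End EnvelopingMap.

Section RestrictScalars.
Variables (A B : pzRingType) (phi : {rmorphism B -> A}) (M : lmodType A).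

Definition restrict_scalars : Type := let _ := phi in M.

HB.instance Definition _ := GRing.Zmodule.on restrict_scalars.

Definition restrict_scale (x : B) (m : restrict_scalars) : restrict_scalars :=
  phi x *: (m : M).

Lemma restrict_scaleA x y m :
  restrict_scale x (restrict_scale y m) = restrict_scale (x * y) m.
Proof. by rewrite /restrict_scale scalerA rmorphM. Qed.
Lemma restrict_scale1 : left_id 1 restrict_scale.
Proof. by move=> m; rewrite /restrict_scale rmorph1 scale1r. Qed.
Lemma restrict_scaleDr : right_distributive restrict_scale +%R.
Proof. by move=> x m n; rewrite /restrict_scale scalerDr. Qed.
Lemma restrict_scaleDl m : {morph restrict_scale^~ m : x y / x + y}.
Proof. by move=> x y; rewrite /restrict_scale rmorphD scalerDl. Qed.

HB.instance Definition _ := GRing.Zmodule_isLmodule.Build B restrict_scalars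
  restrict_scaleA restrict_scale1 restrict_scaleDr restrict_scaleDl.

End RestrictScalars.

(* The tensor product A (x)_B M, where A is a right B-module through phi. *)
Section ExtendScalars.
Variables (A B : pzRingType) (phi : {rmorphism B -> A}) (M : lmodType B).

Inductive tterm : Type :=
  | TPure of A & M | TZero | TOpp of tterm | TAdd of tterm & tterm.

Inductive teq : tterm -> tterm -> Prop :=
  | teq_refl x : teq x x
  | teq_sym x y : teq x y -> teq y x
  | teq_trans x y z : teq x y -> teq y z -> teq x z
  | teq_opp x x' : teq x x' -> teq (TOpp x) (TOpp x')
  | teq_add x x' y y' : teq x x' -> teq y y' -> teq (TAdd x y) (TAdd x' y')
  | teq_addA x y z : teq (TAdd x (TAdd y z)) (TAdd (TAdd x y) z)
  | teq_addC x y : teq (TAdd x y) (TAdd y x)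
  | teq_add0 x : teq (TAdd TZero x) x
  | teq_addN x : teq (TAdd (TOpp x) x) TZero
  | teq_pureDl a a' m : teq (TPure (a + a') m) (TAdd (TPure a m) (TPure a' m))
  | teq_pureDr a m m' : teq (TPure a (m + m')) (TAdd (TPure a m) (TPure a m'))
  | teq_balanced a (x : B) m : teq (TPure (a * phi x) m) (TPure a (x *: m)).

HB.instance Definition _ := gen_eqMixin tterm.
HB.instance Definition _ := gen_choiceMixin tterm.

Definition trel : rel tterm := fun x y => `[<teq x y>].

Lemma trel_refl : reflexive trel.
Proof. by move=> x; apply/asboolP/teq_refl. Qed.
Lemma trel_sym : symmetric trel.
Proof. by move=> x y; apply/asboolP/asboolP; apply: teq_sym. Qed.
Lemma trel_trans : transitive trel.
Proof. by move=> y x z /asboolP h /asboolP k; apply/asboolP/(teq_trans h k). Qed.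

Canonical trel_equiv := EquivRel trel trel_refl trel_sym trel_trans.

Definition extend_scalars : Type := {eq_quot trel}%qT.

HB.instance Definition _ := Choice.on extend_scalars.

Definition tpi (x : tterm) : extend_scalars := (\pi_{eq_quot trel} x)%qT.
Definition trepr (x : extend_scalars) : tterm := repr (x : {eq_quot trel}%qT).

Lemma tpiP x y : tpi x = tpi y <-> teq x y.
Proof.
split; last by move=> h; apply/eqmodP/asboolP.
by move=> /eqmodP/asboolP.
Qed.

Lemma treprK x : tpi (trepr x) = x. Proof. exact: reprK. Qed.

Lemma trepr_pi x : teq (trepr (tpi x)) x. Proof. by apply/tpiP; rewrite treprK. Qed.

Definition topp (x : extend_scalars) := tpi (TOpp (trepr x)).
Definition tadd (x y : extend_scalars) := tpi (TAdd (trepr x) (trepr y)).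

Lemma topp_pi x : topp (tpi x) = tpi (TOpp x).
Proof. exact/tpiP/teq_opp/trepr_pi. Qed.
Lemma tadd_pi x y : tadd (tpi x) (tpi y) = tpi (TAdd x y).
Proof. by apply/tpiP/teq_add; apply: trepr_pi. Qed.

Lemma tpi_ind (P : extend_scalars -> Prop) :
  (forall x, P (tpi x)) -> forall x, P x.
Proof. by move=> h x; rewrite -(treprK x). Qed.

Lemma taddA : associative tadd.
Proof.
elim/tpi_ind=> x; elim/tpi_ind=> y; elim/tpi_ind=> z.
by rewrite !tadd_pi; apply/tpiP/teq_addA.
Qed.
Lemma taddC : commutative tadd.
Proof.
by elim/tpi_ind=> x; elim/tpi_ind=> y; rewrite !tadd_pi; apply/tpiP/teq_addC.
Qed.
Lemma tadd0 : left_id (tpi TZero) tadd.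
Proof. by elim/tpi_ind=> x; rewrite tadd_pi; apply/tpiP/teq_add0. Qed.
Lemma taddN : left_inverse (tpi TZero) topp tadd.
Proof. by elim/tpi_ind=> x; rewrite topp_pi tadd_pi; apply/tpiP/teq_addN. Qed.

HB.instance Definition _ := GRing.isZmodule.Build extend_scalars
  taddA taddC tadd0 taddN.

Fixpoint tscale_term (a : A) (x : tterm) : tterm :=
  match x with
  | TPure c m => TPure (a * c) m
  | TZero => TZero
  | TOpp y => TOpp (tscale_term a y)
  | TAdd y z => TAdd (tscale_term a y) (tscale_term a z)
  end.

Lemma tscale_eq a x y : teq x y -> teq (tscale_term a x) (tscale_term a y).
Proof.
elim=> /=; try by [constructor].
- by move=> x1 x2 x3 _ h _ k; apply: teq_trans h k.
- by move=> *; rewrite mulrDr; constructor.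
- by move=> *; rewrite mulrA; constructor.
Qed.

Definition tscale (a : A) (x : extend_scalars) : extend_scalars :=
  tpi (tscale_term a (trepr x)).

Lemma tscale_pi a x : tscale a (tpi x) = tpi (tscale_term a x).
Proof. exact/tpiP/tscale_eq/trepr_pi. Qed.

Lemma tpiD x y : tpi (TAdd x y) = tpi x + tpi y. Proof. by rewrite -tadd_pi. Qed.
Lemma tpiN x : tpi (TOpp x) = - tpi x. Proof. by rewrite -topp_pi. Qed.
Lemma tpi0 : tpi TZero = 0. Proof. by []. Qed.

Lemma tscaleA a c x : tscale a (tscale c x) = tscale (a * c) x.
Proof.
elim/tpi_ind: x => x; rewrite !tscale_pi; congr tpi.
by elim: x => //= [? ?|? ->|? -> ? ->] //; rewrite mulrA.
Qed.
Lemma tscale1 : left_id 1 tscale.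
Proof.
elim/tpi_ind=> x; rewrite !tscale_pi; congr tpi.
by elim: x => //= [? ?|? ->|? -> ? ->] //; rewrite mul1r.
Qed.
Lemma tscaleDr : right_distributive tscale +%R.
Proof.
move=> a; elim/tpi_ind=> x; elim/tpi_ind=> y.
by rewrite -tpiD !tscale_pi -tpiD.
Qed.
Lemma tscaleDl x : {morph tscale^~ x : a c / a + c}.
Proof.
move=> a c; elim/tpi_ind: x => x; rewrite !tscale_pi.
elim: x => [d m||x IH|x IHx y IHy] /=; rewrite ?tpiD ?tpiN ?tpi0.
- by rewrite mulrDl -tpiD; apply/tpiP; constructor.
- by rewrite addr0.
- by rewrite IH opprD.
- by rewrite IHx IHy addrACA.
Qed.

HB.instance Definition _ := GRing.Zmodule_isLmodule.Build A extend_scalars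
  tscaleA tscale1 tscaleDr tscaleDl.

Definition tensor (a : A) (m : M) : extend_scalars := tpi (TPure a m).

End ExtendScalars.

Section FreeFieldModes.
Variables (K : fieldType) (N : nat).

(* [X^+_(k), X^-_(l)] = binom(k, N) when k + l = N - 1; in the original indices
   this is [X^+_n, X^-_m] = binom(n + (N-1)/2, N) when n + m = 0. *)
Definition bracket (x y : mode) : K :=
  match x, y with
  | (true, k), (false, l) => if k + l == N%:Z - 1 then zbinom K k N else 0
  | (false, l), (true, k) => if k + l == N%:Z - 1 then zbinom K k N else 0
  | _, _ => 0
  end.

Definition modeP := {x : mode | 0 <= x.2}.
Definition modeZ := {x : mode | 0 <= x.2 < N%:Z}.

(* U(g_N), U(Z_N + g_{N,>0}) and Z(g_N), with the unit identified. *)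
Definition Ug := enveloping bracket.
Definition Up := enveloping (fun x y : modeP => bracket (val x) (val y)).
(* The exterior algebra on the X^s_(k), 0 <= k < N: the anticommutators of the
   generators vanish, hence so do their squares in characteristic 0. *)
Definition Zg := enveloping (fun _ _ : modeZ => 0 : K).

HB.instance Definition _ := GRing.PzRing.on Ug.
HB.instance Definition _ := GRing.PzRing.on Up.
HB.instance Definition _ := GRing.PzRing.on Zg.

Definition Zconst (c : K) : Zg := uconst _ c.
Definition Zgen (x : modeZ) : Zg := ugen _ x.
Definition Zdegree : int -> Zg -> Prop := udegree (fun x => charge (val x).1).
Definition Uconst (c : K) : Ug := uconst _ c.
Definition Ugen (x : mode) : Ug := ugen _ x.
Definition Udegree : int -> Ug -> Prop := udegree (fun x => charge x.1).

Definition Up_incl_gen (x : modeP) : Ug := Ugen (val x).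

Lemma Up_incl_bracket (x y : modeP) :
  Up_incl_gen x * Up_incl_gen y + Up_incl_gen y * Up_incl_gen x =
  uconst _ (bracket (val x) (val y)).
Proof.
rewrite [X in X + _](umul_pi bracket) [X in _ + X](umul_pi bracket).
by rewrite [LHS](uadd_pi bracket); apply/upiP/ueq_bracket.
Qed.

Definition Up_incl : {rmorphism Up -> Ug} := umap_rmorphism Up_incl_bracket.

(* The projection U(Z_N + g_{N,>0}) -> Z(g_N) killing g_{N,>0}. *)
Definition Up_proj_gen (x : modeP) : Zg :=
  if insub (val x) is Some z then Zgen z else 0.

Lemma zbinom_small (k : int) : 0 <= k < N%:Z -> zbinom K k N = 0.
Proof.
case: k => k //; rewrite /zbinom ltz_nat /= => kN.
by rewrite (bigD1 (Ordinal kN)) //= subrr mul0r mul0r.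
Qed.

Lemma bracketP (x y : modeP) : bracket (val x) (val y) = 0.
Proof.
case: x y => [[[] k] /= k0] [[[] l] /= l0] //=; case: eqP => // E;
  apply: zbinom_small; rewrite ?k0 ?l0 /=.
- by rewrite -(ltrD2r l) E ltrD2l (lt_le_trans _ l0).
- by rewrite -(ltrD2r k) E ltrD2l (lt_le_trans _ k0).
Qed.

Lemma Up_proj_bracket (x y : modeP) :
  Up_proj_gen x * Up_proj_gen y + Up_proj_gen y * Up_proj_gen x =
  uconst _ (bracket (val x) (val y)).
Proof.
rewrite bracketP /Up_proj_gen.
case: insub => [u|]; last by rewrite mul0r mulr0 addr0.
case: insub => [v|]; last by rewrite mul0r mulr0 addr0.
rewrite [X in X + _]umul_pi [X in _ + X]umul_pi.
by rewrite [LHS]uadd_pi; apply/upiP/(@ueq_bracket K modeZ (fun _ _ => 0)).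
Qed.

Definition Up_proj : {rmorphism Up -> Zg} := umap_rmorphism Up_proj_bracket.

(* U(g_N) (x)_{U(Z_N + g_{N,>0})} M_0, with g_{N,>0} acting by zero on M_0. *)
Definition induced (M0 : lmodType Zg) : lmodType Ug :=
  extend_scalars Up_incl (restrict_scalars Up_proj M0).

Definition itensor (M0 : lmodType Zg) (u : Ug) (m : M0) : induced M0 :=
  @tensor Ug Up Up_incl (restrict_scalars Up_proj M0) u m.

(* Finite-dimensional Z-graded Z(g_N)-modules; K acts through [Zconst]. *)
Record fdModule := FdModule {
  fd_space :> lmodType Zg;
  fd_gr : int -> fd_space -> Prop;
  fd_grP : is_grading fd_gr;
  fd_gr_act : forall a i (u : Zg) m, Zdegree a u -> fd_gr i m ->
    fd_gr (i + a) (u *: m);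
  fd_finite : exists s : seq fd_space, forall m, exists c : nat -> K,
    m = \sum_(i < size s) Zconst (c i) *: s`_i }.

Record fdHom (M M' : fdModule) := FdHom {
  fdh :> M -> M';
  fdh_linear : linear fdh;
  fdh_gr : forall i m, fd_gr i m -> fd_gr i (fdh m) }.

Lemma fdHom_eq (M M' : fdModule) (f g : fdHom M M') : f =1 g -> f = g.
Proof.
case: f => f f1 f2; case: g => g g1 g2 /= /funext E.
by case: _ / E in g1 g2 *; congr FdHom; apply: Prop_irrelevance.
Qed.

Program Definition fdHom_id (M : fdModule) : fdHom M M := @FdHom M M id _ _.
Next Obligation. by []. Qed.

Program Definition fdHom_comp (M1 M2 M3 : fdModule)
    (g : fdHom M2 M3) (f : fdHom M1 M2) : fdHom M1 M3 :=
  @FdHom M1 M3 (g \o f) _ _.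
Next Obligation. by move=> a x y; rewrite /= !fdh_linear. Qed.
Next Obligation. by do 2 apply: fdh_gr. Qed.

Program Definition fdCat : category :=
  @Category fdModule fdHom fdHom_id fdHom_comp _ _ _.
Next Obligation. exact: fdHom_eq. Qed.
Next Obligation. exact: fdHom_eq. Qed.
Next Obligation. exact: fdHom_eq. Qed.

Definition induced_gr (M0 : fdModule) (i : int) (t : induced M0) : Prop :=
  exists s : seq (int * Ug * M0),
    (forall a u m, (a, u, m) \in s -> Udegree a u /\ fd_gr (i - a) m) /\
    t = \sum_(w <- s) itensor w.1.2 w.2.

Variable F : freeFieldAlgebra K N.

(* [W] is the functor M |-> Omega(M), f |-> f restricted to Omega(M): there are
   isomorphisms iota M from W M onto Omega(M), natural in M, for the subspace
   grading and the action of Z(g_N) through the modes. *)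
Definition is_Omega_functor (W : functor (fgCat F) (fdCat)) : Prop :=
  exists iota : forall M : fgModule F, (W M : fdModule) -> M,
    [/\ forall M, injective (iota M),
        forall M m, Omega m <-> exists w, iota M w = m,
        forall M w w', iota M (w + w') = iota M w + iota M w',
        forall M c w, iota M (Zconst c *: w) = c *: iota M w &
        [/\ forall M x w, iota M (Zgen x *: w) = mode_act (val x) (iota M w),
            forall M i w, fd_gr i w <-> fg_gr i (iota M w) &
            forall (M M' : fgModule F) (f : fgHom M M') w,
              iota M' ((fmap W (f : @Hom (fgCat F) M M') : fdHom _ _) w) =
              f (iota M w)]].

(* [T] is the functor M0 |-> Ind(M0), f |-> id (x) f: there are isomorphisms
   theta M0 from the induced module onto T M0, natural in M0, for the tensor
   product grading and the action of g_N through the modes. *)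
Definition is_Ind_functor (T : functor (fdCat) (fgCat F)) : Prop :=
  exists theta : forall M0 : fdModule, induced M0 -> (T M0 : fgModule F),
    [/\ forall M0, bijective (theta M0),
        forall M0 t t', theta M0 (t + t') = theta M0 t + theta M0 t',
        forall M0 c t, theta M0 (Uconst c *: t) = c *: theta M0 t,
        forall M0 x t, theta M0 (Ugen x *: t) = mode_act x (theta M0 t) &
        [/\ forall M0 i t, induced_gr i t <-> fg_gr i (theta M0 t) &
            forall (M0 M0' : fdModule) (f : fdHom M0 M0') u m,
              (fmap T (f : @Hom fdCat M0 M0') : fgHom _ _)
                (theta M0 (itensor u m)) =
              theta M0' (itensor u (f m))]].

End FreeFieldModes.

(* Main.v *)
(* For k >= N the modes a = X^s_(k) and b = X^{-s}_(N-1-k) / [a, b] satisfy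
   a b + b a = 1, distinct pairs anticommute, and the zero modes X^s_(k) with
   0 <= k < N anticommute with everything.  Every vector of a module in which
   X^s_(k) m = 0 for large k is annihilated by all but finitely many a, and
   m = a b m + b a m shows by induction that the creation operators b generate
   the module from Omega.  Applying the commuting idempotents a b, which fix Omega
   and kill b, gives Omega(Ind M0) = M0; moreover a map out of such a module is
   injective as soon as it is injective on Omega.  Hence M = Ind(Omega(M)), and
   Omega(M) is finite-dimensional because the zero modes generate a
   finite-dimensional algebra.

   It remains to see that Ind(M0) is an F_N-module although the zero modes act
   nontrivially.  F_N (x) M0, on which F_N acts through the first factor, is a
   module with vanishing zero modes.  If xi is an odd endomorphism of a module with
   xi^2 = 0, then Li's Delta-operator yields another module structure
     u |-> Y(u, z) + xi Y(G(z) u, z),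
     G(z) = \sum_p f^(N+p)(z) / (N+p)! X^{-s}_(N+p),  f^(N)(z) = N! z^(-k-1),
   which shifts X^s_(k) by a multiple of xi and fixes the other modes.  (The lower
   derivatives of f, possibly logarithmic, are not needed since X_(p), p < N, kills
   F_N.)  One such twist per zero mode turns F_N (x) M0 into Ind(M0).

   Abelianness is checked for Z(g_N)-modules and transferred along the equivalence. *)
From HB Require Import structures.
From mathcomp Require Import all_boot all_order all_algebra.
From mathcomp Require Import boolp reals.
From mathcomp Require Import complex.
From mathcomp Require Import zify ring.
Require Import Defs.

Set Implicit Arguments.
Unset Strict Implicit.
Unset Printing Implicit Defensive.

Import Order.TTheory GRing.Theory Num.Theory.
Local Open Scope ring_scope.

(** * Generalized binomial coefficients and finite sums *)

(** By strong generation and the associativity formula, subspaces stable under the modes of [X^+]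
    and [X^-] are submodules, and linear maps commuting with these modes are morphisms
    ([act_closed], [act_morph]). Questions about F_N-modules thus become questions about smooth
    U(g_N)-modules. The obstacle is the way back: turning an arbitrary smooth module into a vertex
    module would call for a reconstruction theorem. It is avoided by exhibiting a vertex module
    structure for Ind(M0) alone, which suffices because every object turns out to be of this form.
    Since [xi] squares to 0, the Borcherds identity of a twist is the old identity plus one identity
    linear in [xi]. The explicit model also shows what the presentation of Ind(M0) as a quotient of
    terms hides: that M0 embeds into it and that its homogeneous parts are read off from an honest
    grading. Kernels and cokernels are built on the finite-dimensional side because finiteness of
    subobjects is linear algebra there, while among finitely generated F_N-modules it would be a
    Noetherian property. *)

Section Binomials.
Variable K : fieldType.
Hypothesis charK : [pchar K] =i pred0.

Lemma natS_neq0 n : n.+1%:R != 0 :> K.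
Proof. by rewrite (iffLR (pcharf0P K) charK). Qed.

Lemma fact_neq0 n : (n`!)%:R != 0 :> K.
Proof. by rewrite (iffLR (pcharf0P K) charK) -lt0n fact_gt0. Qed.

Lemma zbinom0 (p : int) : zbinom K p 0 = 1.
Proof. by rewrite /zbinom big_ord0 fact0 divr1. Qed.

Lemma zbinom_zero (i : nat) : zbinom K 0 i = (i == 0%N)%:R.
Proof.
case: i => [|i]; first by rewrite zbinom0.
by rewrite /zbinom big_ord_recl subrr !mul0r.
Qed.

Lemma zbinomS (p : int) i :
  i.+1%:R * zbinom K p i.+1 = (p - i%:Z)%:~R * zbinom K p i.
Proof.
rewrite /zbinom big_ord_recr /= factS natrM invfM rmorphM /=.
by field; rewrite fact_neq0 nat1r natS_neq0.
Qed.

(** Induction on [n] after multiplication by [n + 1]: in each term this factor splits as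
    [i + (n + 1 - i)], and [zbinomS] lowers the first or the second binomial accordingly. *)
Lemma zbinom_vandermonde (p q : int) n :
  zbinom K (p + q) n = \sum_(i < n.+1) zbinom K p i * zbinom K q (n - i).
Proof.
elim: n => [|n IHn]; first by rewrite big_ord1 !zbinom0 mulr1.
apply: (mulfI (natS_neq0 n)); rewrite zbinomS {}IHn !mulr_sumr.
have -> : \sum_(i < n.+2) n.+1%:R * (zbinom K p i * zbinom K q (n.+1 - i)) =
   \sum_(i < n.+2) (i%:R * zbinom K p i) * zbinom K q (n.+1 - i) +
   \sum_(i < n.+2) zbinom K p i * ((n.+1 - i)%:R * zbinom K q (n.+1 - i)).
  rewrite -big_split /=; apply: eq_bigr => i _.
  by rewrite natrB ?(ltn_ord i) // ; first ring; rewrite -ltnS.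
rewrite [X in _ = X + _]big_ord_recl !mul0r add0r [X in _ = _ + X]big_ord_recr /= subnn.
rewrite mul0r mulr0 addr0 -big_split /=; apply: eq_bigr => i _.
rewrite /bump /= add1n subSS subSn; last by rewrite -ltnS.
rewrite !zbinomS; have in_ : (i <= n)%N by rewrite -ltnS.
by rewrite -subzn // !rmorphB /= !rmorphD /=; ring.
Qed.

Lemma zbinom_fact (n i : nat) :
  zbinom K (n + i)%:Z i = ((n + i)`!)%:R / ((n`!)%:R * (i`!)%:R).
Proof.
elim: i n => [|i IHi] n.
  by rewrite zbinom0 addn0 fact0 mulr1 divff ?fact_neq0.
apply: (mulfI (natS_neq0 i)); rewrite zbinomS.
have -> : (n + i.+1)%N = (n.+1 + i)%N by rewrite addnS.
rewrite IHi PoszD addrK !factS !natrM -pmulrn.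
by field; rewrite !fact_neq0 !nat1r !natS_neq0.
Qed.

Lemma zbinom_nat_small (n i : nat) : (n < i)%N -> zbinom K n%:Z i = 0.
Proof.
by move=> h; rewrite /zbinom (bigD1 (Ordinal h)) //= subrr mul0r mul0r.
Qed.

Lemma zbinom_neg_neq0 (n i : nat) : zbinom K (- n.+1%:Z) i != 0.
Proof.
elim: i => [|i IHi]; first by rewrite zbinom0 oner_neq0.
suff: (i.+1%:R * zbinom K (- n.+1%:Z) i.+1) != 0 by rewrite mulf_eq0 => /norP[].
rewrite zbinomS mulf_neq0 // -opprD -PoszD rmorphN oppr_eq0 addSn.
exact: natS_neq0.
Qed.

Lemma zbinom_nat_neq0 (n i : nat) : (i <= n)%N -> zbinom K n%:Z i != 0.
Proof.
move=> h; rewrite -(subnK h) zbinom_fact mulf_neq0 ?fact_neq0 //.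
by rewrite invr_eq0 mulf_neq0 ?fact_neq0.
Qed.

End Binomials.

Section Sums.
Variable M : zmodType.

Lemma sum_vanish (L l : nat) (f : nat -> M) :
  (forall i, (L <= i)%N -> f i = 0) -> (L <= l)%N ->
  \sum_(i < l) f i = \sum_(i < L) f i.
Proof.
move=> f0 Ll; rewrite -(subnKC Ll) big_split_ord /= [X in _ + X]big1 ?addr0 //.
by move=> i _; rewrite f0 ?leq_addr.
Qed.

Lemma sum_triangle n (a : nat -> nat -> M) :
  \sum_(i < n) \sum_(j < n - i) a i j = \sum_(t < n) \sum_(i < t.+1) a i (t - i)%N.
Proof.
elim: n => [|n IHn]; first by rewrite !big_ord0.
rewrite big_ord_recr [RHS]big_ord_recr /= -IHn subSnn big_ord1.
rewrite [\sum_(i < n.+1) _]big_ord_recr /= subnn addrA -big_split /=.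
congr (_ + _); apply: eq_bigr => i _.
by rewrite subSn 1?ltnW // big_ord_recr.
Qed.

(** Brings sums truncated at unrelated bounds into antidiagonal form, the shape in which
    Vandermonde's identity applies. *)
Lemma sum_box n A B (a : nat -> nat -> M) : (n <= A)%N -> (n <= B)%N ->
  (forall i j, (n <= i + j)%N -> a i j = 0) ->
  \sum_(i < A) \sum_(j < B) a i j = \sum_(t < n) \sum_(i < t.+1) a i (t - i)%N.
Proof.
move=> nA nB a0; rewrite -sum_triangle (@sum_vanish n A (fun i => \sum_(j < B) a i j)) //; last first.
  by move=> i ni; apply: big1 => j _; rewrite a0 // (leq_trans ni) ?leq_addr.
apply: eq_bigr => i _.
apply: (sum_vanish (f := a i)); last by rewrite (leq_trans _ nB) ?leq_subr.
by move=> j; rewrite leq_subLR => /a0.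
Qed.

End Sums.

(** Truncation bounds depend on the vectors involved; as only finitely many occur at a time, one
    bound can serve them all. *)
Lemma uniform_bound (P : nat -> nat -> Prop) :
  (forall p, exists n, forall i, (n <= i)%N -> P p i) ->
  forall L, exists n, forall p i, (p < L)%N -> (n <= i)%N -> P p i.
Proof.
move=> h; elim=> [|L [n IHn]]; first by exists 0%N.
have [m hm] := h L; exists (maxn n m) => p i.
rewrite ltnS leq_eqVlt geq_max => /predU1P[-> | pL] /andP[ni mi]; first exact: hm.
exact: IHn.
Qed.

Lemma int_bound (P : int -> Prop) (n0 c : int) :
  (forall n, n0 <= n -> P n) -> exists L : nat, forall i : nat, (L <= i)%N -> P (c + i%:Z).
Proof. by move=> h; exists `|n0 - c|%N => i hi; apply: h; lia. Qed.
(** * Gradings and linear spans *)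

Section FiniteSupport.
Variables (I : eqType) (M : zmodType).

Lemma sum_support (s t : seq I) (f : I -> M) : uniq s -> uniq t ->
  (forall i, i \notin s -> f i = 0) -> (forall i, i \notin t -> f i = 0) ->
  \sum_(i <- s) f i = \sum_(i <- t) f i.
Proof.
have sub (u v : seq I) : (forall i, i \notin v -> f i = 0) ->
    \sum_(i <- u) f i = \sum_(i <- u | i \in v) f i.
  move=> h; rewrite (bigID (mem v)) /= [X in _ + X]big1 ?addr0 // => i; exact: h.
move=> us ut fs ft; rewrite (sub s t) // (sub t s) //.
rewrite -big_filter -[RHS]big_filter; apply: perm_big; apply: uniq_perm.
- exact: filter_uniq.
- exact: filter_uniq.
by move=> i; rewrite !mem_filter andbC.
Qed.

Variable gr : I -> M -> Prop.

(** The family in [gr_span] may be nonzero off its list, and the list may repeat indices. Here the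
    support lies in a duplicate-free list, which makes [f] unique ([decomposes_uniq]) and hence a
    component function. *)
Definition decomposes (f : I -> M) (m : M) : Prop :=
  (forall i, gr i (f i)) /\
  exists s, [/\ uniq s, forall i, i \notin s -> f i = 0 & m = \sum_(i <- s) f i].

Lemma decomposes_on f m s : decomposes f m -> uniq s ->
  (forall i, i \notin s -> f i = 0) -> m = \sum_(i <- s) f i.
Proof. by case=> _ [t [ut ft ->]] us fs; apply: sum_support. Qed.

Lemma decomposes0 : (forall i, gr i 0) -> decomposes (fun=> 0) 0.
Proof. by move=> h; split=> //; exists [::]; rewrite big_nil. Qed.

Lemma decomposesD f g x y :
  (forall i u v, gr i u -> gr i v -> gr i (u + v)) ->
  decomposes f x -> decomposes g y -> decomposes (f \+ g) (x + y).
Proof.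
move=> grD df dg; have [fgr [s [us fs _]]] := df; have [ggr [t [ut gt _]]] := dg.
split=> [i|]; first exact: grD.
exists (undup (s ++ t)); rewrite undup_uniq.
have fs' i : i \notin undup (s ++ t) -> f i = 0.
  by rewrite mem_undup mem_cat negb_or => /andP[/fs].
have gt' i : i \notin undup (s ++ t) -> g i = 0.
  by rewrite mem_undup mem_cat negb_or => /andP[_ /gt].
split=> //; first by move=> i h; rewrite /= fs' ?gt' ?addr0.
by rewrite big_split /= -(decomposes_on df) -?(decomposes_on dg) ?undup_uniq.
Qed.

Lemma decomposes_hom i m : (forall i, gr i 0) -> gr i m ->
  decomposes (fun j => if j == i then m else 0) m.
Proof.
move=> gr0 him; split=> [j|]; first by case: eqP => [->|].
exists [:: i]; split=> //; last by rewrite big_seq1 eqxx.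
by move=> j; rewrite inE => /negbTE ->.
Qed.

Hypothesis grP : is_grading gr.

Lemma grN i x : gr i x -> gr i (- x).
Proof. by move=> h; rewrite -sub0r; apply: (grB grP) => //; apply: gr0. Qed.

Lemma grD i x y : gr i x -> gr i y -> gr i (x + y).
Proof. by move=> hx hy; rewrite -[y]opprK; apply: (grB grP) => //; apply: grN. Qed.

Lemma gr_sum i J (r : seq J) (P : pred J) (f : J -> M) :
  (forall j, P j -> gr i (f j)) -> gr i (\sum_(j <- r | P j) f j).
Proof.
by move=> h; elim/big_ind: _ => //; [exact: gr0 | move=> *; apply: grD].
Qed.

Lemma decomposes_uniq f g m : decomposes f m -> decomposes g m -> f =1 g.
Proof.
move=> df dg i; have [fgr [s [us fs _]]] := df; have [ggr [t [ut gt _]]] := dg.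
pose u := undup (s ++ t).
have fs' j : j \notin u -> f j = 0.
  by rewrite mem_undup mem_cat negb_or => /andP[/fs].
have gt' j : j \notin u -> g j = 0.
  by rewrite mem_undup mem_cat negb_or => /andP[_ /gt].
have [iu|iu] := boolP (i \in u); last by rewrite fs' ?gt'.
apply/eqP; rewrite -subr_eq0; apply/eqP.
apply: (gr_direct grP (s := u) (f := fun j => f j - g j)) => //.
- exact: undup_uniq.
- by move=> j; apply: (grB grP).
by rewrite sumrB -(decomposes_on df) -?(decomposes_on dg) ?undup_uniq ?subrr.
Qed.

Lemma decomposes_ex m : exists f, decomposes f m.
Proof.
have [s [f [fgr ->]]] := gr_span grP m.
elim: s => [|i s [g IH]].
  by exists (fun=> 0); rewrite big_nil; apply: decomposes0; apply: gr0.
rewrite big_cons; exists ((fun j => if j == i then f i else 0) \+ g).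
apply: decomposesD => //; first exact: grD.
by apply: decomposes_hom => //; apply: gr0.
Qed.

Definition gr_comp m : I -> M := sval (cid (decomposes_ex m)).

Lemma gr_compP m : decomposes (gr_comp m) m.
Proof. exact: (svalP (cid (decomposes_ex m))). Qed.

Lemma gr_comp_gr m i : gr i (gr_comp m i).
Proof. by have [h _] := gr_compP m. Qed.

Lemma gr_compE f m : decomposes f m -> gr_comp m =1 f.
Proof. by move=> h; apply: decomposes_uniq h; apply: gr_compP. Qed.

Lemma gr_comp_hom i m : gr i m -> gr_comp m i = m.
Proof.
by move=> h; rewrite (gr_compE (decomposes_hom (gr0 grP) h)) eqxx.
Qed.

Lemma gr_compD x y i : gr_comp (x + y) i = gr_comp x i + gr_comp y i.
Proof. by rewrite (gr_compE (decomposesD grD (gr_compP x) (gr_compP y))). Qed.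

Lemma gr_ind (P : M -> Prop) : P 0 -> (forall x y, P x -> P y -> P (x + y)) ->
  forall m, (forall i, P (gr_comp m i)) -> P m.
Proof.
move=> P0 PD m h; have [_ [s [_ _ ->]]] := gr_compP m.
by elim/big_ind: _.
Qed.

End FiniteSupport.

Section GradedMaps.
Variables (I J : eqType) (M M' : zmodType) (gr : I -> M -> Prop) (gr' : J -> M' -> Prop).
Variables (f : M -> M') (h : I -> J) (h' : J -> I).
Hypotheses (fD : forall x y, f (x + y) = f x + f y) (f0 : f 0 = 0).
Hypotheses (hK : cancel h h') (h'K : cancel h' h).
Hypothesis f_gr : forall i m, gr i m -> gr' (h i) (f m).

Lemma decomposes_map c m : decomposes gr c m ->
  decomposes gr' (fun j => f (c (h' j))) (f m).
Proof.
case=> cgr [s [us cs ->]]; split=> [j|]; first by rewrite -{1}(h'K j); apply: f_gr.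
exists (map h s); split.
- by rewrite map_inj_uniq //; apply: can_inj hK.
- move=> j hj; rewrite cs ?f0 //; apply: contra hj => hj.
  by rewrite -(h'K j) map_f.
rewrite big_map; under [RHS]eq_bigr do rewrite hK.
by elim: s {us cs} => [|i s IH]; rewrite ?big_nil // !big_cons fD IH.
Qed.

Hypotheses (grP : is_grading gr) (gr'P : is_grading gr').

(** The reindexing [h] covers maps that move degrees: a mode shifts the charge, and multiplication
    by [X] flips the parity. *)
Lemma gr_comp_map m j : gr_comp gr'P (f m) j = f (gr_comp grP m (h' j)).
Proof. by rewrite (gr_compE gr'P (decomposes_map (gr_compP grP m))). Qed.

End GradedMaps.

(** The components of [m] are sent to those of [f m]; if [f m] has degree [i], it is the image of
    the [i]-th component, and injectivity applies. For the source only existence of decompositions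
    enters, which is what [induced_decomposes] provides for the induced module. *)
Lemma gr_reflect (I : eqType) (M M' : zmodType) (gr : I -> M -> Prop)
    (gr' : I -> M' -> Prop) (f : M -> M') :
  (forall x y, f (x + y) = f x + f y) -> f 0 = 0 -> injective f ->
  (forall i m, gr i m -> gr' i (f m)) ->
  is_grading gr' -> (forall i, gr i 0) -> (forall m, exists c, decomposes gr c m) ->
  forall i m, gr' i (f m) -> gr i m.
Proof.
move=> fD f0 fI fgr gr'P g0 dec i m him; have [c cm] := dec m.
have := decomposes_map fD f0 (h := id) (h' := id) (fun _ => erefl) (fun _ => erefl) fgr cm.
move/(gr_compE gr'P)/(_ i); rewrite gr_comp_hom // => /fI ->.
by case: cm.
Qed.

(** * Linear spans, bases and coordinates *)

Section Span.
Variables (K : fieldType) (M : lmodType K).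
Implicit Types (s t : seq M) (P : M -> Prop).

Fixpoint kspan s (m : M) : Prop :=
  if s is x :: s' then exists c : K, kspan s' (m - c *: x) else m = 0.

Lemma kspan_lin s a x y : kspan s x -> kspan s y -> kspan s (a *: x + y).
Proof.
elim: s x y => [|z s IH] x y /=; first by move=> -> ->; rewrite scaler0 addr0.
move=> [c hc] [d hd]; exists (a * c + d).
have -> : a *: x + y - (a * c + d) *: z = a *: (x - c *: z) + (y - d *: z).
  by rewrite scalerDl scalerBr scalerA opprD addrACA.
exact: IH.
Qed.

Lemma kspan0 s : kspan s 0.
Proof. by elim: s => //= z s IH; exists 0; rewrite scale0r subr0. Qed.

Lemma kspanZ s a x : kspan s x -> kspan s (a *: x).
Proof. by move=> h; rewrite -[_ *: _]addr0; apply: kspan_lin => //; apply: kspan0. Qed.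

Lemma kspanD s x y : kspan s x -> kspan s y -> kspan s (x + y).
Proof. by move=> h k; rewrite -[x]scale1r; apply: kspan_lin. Qed.

Lemma kspan_cons z s x : kspan s x -> kspan (z :: s) x.
Proof. by move=> h /=; exists 0; rewrite scale0r subr0. Qed.

Lemma kspan_mem s x : x \in s -> kspan s x.
Proof.
elim: s => // z s IH; rewrite inE => /predU1P[->|/IH]; last exact: kspan_cons.
by exists 1; rewrite scale1r subrr; apply: kspan0.
Qed.

Lemma kspan_min s P x : P 0 -> (forall a y z, P y -> P z -> P (a *: y + z)) ->
  (forall y, y \in s -> P y) -> kspan s x -> P x.
Proof.
move=> P0 Plin; elim: s x => [|z s IH] x Ps /=; first by move=> ->.
move=> [c hc]; rewrite -(subrK (c *: z) x) addrC; apply: Plin.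
  by apply: Ps; rewrite inE eqxx.
by apply: IH hc => y ys; apply: Ps; rewrite inE ys orbT.
Qed.

Lemma kspan_sub s t x : (forall y, y \in s -> kspan t y) -> kspan s x -> kspan t x.
Proof. by move=> h; apply: kspan_min h; [exact: kspan0 | exact: kspan_lin]. Qed.

Lemma kspan_subset s t x : {subset s <= t} -> kspan s x -> kspan t x.
Proof. by move=> h; apply: kspan_sub => y /h; apply: kspan_mem. Qed.

Lemma kspanE s m : kspan s m <-> exists c : nat -> K, m = \sum_(i < size s) c i *: s`_i.
Proof.
elim: s m => [|z s IH] m /=.
  by split=> [->|[c]]; [exists (fun=> 0)|]; rewrite big_ord0.
split=> [[a /IH[c hc]]|[c ->]].
  exists (fun i => if i is i'.+1 then c i' else a).
  by rewrite big_ord_recl /= -hc addrC subrK.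
exists (c 0%N); apply/IH; exists (fun i => c i.+1).
by rewrite big_ord_recl /= addrC addKr.
Qed.

(** Induction on [s], with [P] cut down to the span of the tail. If this loses some [p], then [p]
    has a nonzero coefficient [c] at the head, and subtracting multiples of [p] moves all of [P]
    back into the span of the tail. *)
Lemma kspan_subspace s P : P 0 -> (forall a y z, P y -> P z -> P (a *: y + z)) ->
  (forall x, P x -> kspan s x) ->
  exists t, (forall x, x \in t -> P x) /\ forall x, P x -> kspan t x.
Proof.
elim: s P => [|z s IH] P P0 Plin sub; first by exists [::].
pose Q x := P x /\ kspan s x.
have [||x []|t [tQ spanQ]] := IH Q; [by split=> //; apply: kspan0 | | by [] |].
  by move=> a x y [px qx] [py qy]; split; [exact: Plin | exact: kspan_lin].
have [all_s|] := pselect (forall x, P x -> kspan s x).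
  exists t; split=> [x /tQ[]//|x px]; apply: spanQ; split=> //; exact: all_s.
move/existsNP=> [p /not_implyP[Pp nsp]].
have [c hc] := sub p Pp.
have c0 : c != 0 by apply: contra_not_neq nsp => E; move: hc; rewrite E scale0r subr0.
exists (p :: t); split=> [x|x Px].
  by rewrite inE => /predU1P[->|/tQ[]].
have [d hd] := sub x Px; exists (d / c); apply: spanQ; split.
  by rewrite addrC -scaleNr; apply: Plin.
have -> : x - (d / c) *: p = (- (d / c)) *: (p - c *: z) + (x - d *: z).
  rewrite scalerBr scalerA !scaleNr mulNr divfK // scaleNr opprK.
  by rewrite addrACA [d *: z + _]addrC addNr addr0 addrC.
exact: kspan_lin.
Qed.

Fixpoint kfree s : Prop := if s is x :: s' then ~ kspan s' x /\ kfree s' else True.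

Lemma kspan_basis s : exists t,
  [/\ {subset t <= s}, kfree t & forall x, kspan s x -> kspan t x].
Proof.
elim: s => [|z s [t [ts ft st]]]; first by exists [::].
have [zt|zt] := pselect (kspan t z).
  exists t; split=> // [x /ts xs|x]; first by rewrite inE xs orbT.
  by move=> [c /st h]; rewrite -(subrK (c *: z) x); apply: kspanD => //; apply: kspanZ.
exists (z :: t); split=> // [x|x [c /st h]]; last by exists c.
by rewrite !inE => /orP[->//|/ts->]; rewrite orbT.
Qed.

Lemma kfree_eq0 t (c : nat -> K) : kfree t -> \sum_(i < size t) c i *: t`_i = 0 ->
  forall i, (i < size t)%N -> c i = 0.
Proof.
elim: t c => //= z t IH c [nz ft]; rewrite big_ord_recl /= => E.
have c0 : c 0%N = 0.
  apply: contra_notP nz => /eqP c0.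
  have -> : z = (- (c 0%N)^-1) *: \sum_(i < size t) c i.+1 *: t`_i.
    apply: (scalerI c0); rewrite scalerA mulrN divff // scaleN1r.
    by apply/eqP; rewrite -addr_eq0 E.
  by apply: kspanZ; apply/kspanE; exists (fun i => c i.+1).
case=> [//|i]; rewrite ltnS => it; apply: (IH (fun i => c i.+1)) => //.
by move: E; rewrite c0 scale0r add0r.
Qed.

Lemma kspan_coords s : (forall m, kspan s m) ->
  exists (d : nat) (e : 'I_d -> M) (x : 'I_d -> M -> K),
    [/\ forall i, e i \in s, forall m, m = \sum_i x i m *: e i &
        forall c i, x i (\sum_j c j *: e j) = c i].
Proof.
move=> ss; have [t [ts ft st]] := kspan_basis s.
have h m : {c : nat -> K | m = \sum_(i < size t) c i *: t`_i}.
  by apply/cid/kspanE/st/ss.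
exists (size t), (fun i => t`_i), (fun i m => sval (h m) i); split.
- by move=> i; apply: ts; apply: mem_nth.
- by move=> m; apply: (svalP (h m)).
move=> c i; case: (h _) => c' /= E; apply/eqP; rewrite -subr_eq0; apply/eqP.
(* [kfree_eq0] takes coefficients indexed by [nat], so [c] is extended by 0 beyond [size t]. *)
pose k j := c' j - (if insub j is Some j' then c j' else 0).
have := @kfree_eq0 t k ft; rewrite /k.
have -> : \sum_(i0 < size t) (c' i0 - (if insub (i0 : nat) is Some j' then c j' else 0)) *: t`_i0 = 0.
  under eq_bigr do rewrite valK scalerBl.
  by rewrite sumrB -E subrr.
by move=> /(_ erefl i (ltn_ord i)); rewrite valK.
Qed.

End Span.
(** * Enveloping algebras and induced modules *)

Section EnvelopingRing.
Variables (K : fieldType) (I : Type) (b : I -> I -> K).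
Local Notation U := (enveloping b).

Lemma upiD x y : upi b (UAdd x y) = upi b x + upi b y.
Proof. by rewrite -uadd_pi. Qed.
Lemma upiM x y : upi b (UMul x y) = upi b x * upi b y.
Proof. by rewrite -umul_pi. Qed.
Lemma upiN x : upi b (UOpp x) = - upi b x.
Proof. by rewrite -uopp_pi. Qed.

Lemma env_ind (P : U -> Prop) : (forall c, P (uconst b c)) -> (forall i, P (ugen b i)) ->
  (forall x, P x -> P (- x)) -> (forall x y, P x -> P y -> P (x + y)) ->
  (forall x y, P x -> P y -> P (x * y)) -> forall x, P x.
Proof.
move=> Pc Pg Po Pa Pm; elim/upi_ind=> x; elim: x => [c|i|x IH|x hx y hy|x hx y hy].
- exact: Pc.
- exact: Pg.
- by rewrite upiN; apply: Po.
- by rewrite upiD; apply: Pa.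
- by rewrite upiM; apply: Pm.
Qed.

Lemma uconst_is_zmod_morphism : zmod_morphism (uconst b).
Proof.
move=> c d; apply/eqP; rewrite eq_sym subr_eq; apply/eqP.
by rewrite -[RHS]upiD -{1}(subrK d c); apply/upiP/ueq_constD.
Qed.

Lemma uconst_is_monoid_morphism : monoid_morphism (uconst b).
Proof. by split=> // c d; rewrite -upiM; apply/upiP/ueq_constM. Qed.

HB.instance Definition _ := GRing.isZmodMorphism.Build K U (uconst b)
  uconst_is_zmod_morphism.
HB.instance Definition _ := GRing.isMonoidMorphism.Build K U (uconst b)
  uconst_is_monoid_morphism.

Lemma uconst_comm c (x : U) : uconst b c * x = x * uconst b c.
Proof. by elim/upi_ind: x => x; rewrite -!upiM; apply/upiP/ueq_central. Qed.

Lemma ugen_bracket i j :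
  ugen b i * ugen b j + ugen b j * ugen b i = uconst b (b i j).
Proof. by rewrite -!upiM -upiD; apply/upiP/ueq_bracket. Qed.

Lemma ugen_sq i : [pchar K] =i pred0 -> b i i = 0 -> ugen b i * ugen b i = 0.
Proof.
move=> charK bii; set x := ugen b i * _.
have h : x + x = 0 by rewrite ugen_bracket bii rmorph0.
rewrite -[x]mul1r -(rmorph1 (uconst b)) -(mulVf (natS_neq0 charK 1)) rmorphM -mulrA.
by rewrite rmorph_nat mulr_natl [x *+ 2]mulr2n h mulr0.
Qed.

Lemma env_scale_comm (M M' : lmodType U) (f : M -> M') :
  (forall x y, f (x + y) = f x + f y) ->
  (forall c m, f (uconst b c *: m) = uconst b c *: f m) ->
  (forall i m, f (ugen b i *: m) = ugen b i *: f m) ->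
  forall u m, f (u *: m) = u *: f m.
Proof.
move=> fD fc fg.
have f0 : f 0 = 0 by apply: (addIr (f 0)); rewrite -fD !add0r.
have fN x : f (- x) = - f x by apply: (addIr (f x)); rewrite -fD !addNr.
elim/env_ind=> [c|i|x IH|x y hx hy|x y hx hy] m //.
- by rewrite !scaleNr fN IH.
- by rewrite !scalerDl fD hx hy.
- by rewrite -!scalerA hx hy.
Qed.

Section EnvelopingModule.
Variables (V : lmodType K) (X : I -> V -> V).
Hypothesis X_lin : forall i, linear (X i).
Hypothesis X_bracket : forall i j v, X i (X j v) + X j (X i v) = b i j *: v.

Fixpoint uact (t : uterm K I) (v : V) : V :=
  match t with
  | UConst c => c *: v
  | UGen i => X i v
  | UOpp x => - uact x v
  | UAdd x y => uact x v + uact y v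
  | UMul x y => uact x (uact y v)
  end.

Lemma uact_lin t : linear (uact t).
Proof.
elim: t => [c|i|x IH|x hx y hy|x hx y hy] a u v /=.
- by rewrite scalerDr !scalerA mulrC.
- exact: X_lin.
- by rewrite IH opprD scalerN.
- by rewrite hx hy scalerDr addrACA.
- by rewrite hy hx.
Qed.

Lemma uact0 t : uact t 0 = 0.
Proof. by have /(_ (-1) 0 0) := uact_lin t; rewrite !scaler0 addr0 scaleN1r addNr. Qed.

Lemma uact_eq x y : ueq b x y -> uact x =1 uact y.
Proof.
elim=> //= {x y}.
- by move=> x y _ h v; rewrite h.
- by move=> x y z _ h _ k v; rewrite h.
- by move=> x x' _ h v; rewrite h.
- by move=> x x' y y' _ h _ k v; rewrite h k.
- by move=> x x' y y' _ h _ k v; rewrite k h.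
- by move=> x y z v; rewrite addrA.
- by move=> x y v; rewrite addrC.
- by move=> x v; rewrite scale0r add0r.
- by move=> x v; rewrite scale0r addNr.
- by move=> x v; rewrite scale1r.
- by move=> x y z v; have := uact_lin x 1 (uact y v) (uact z v); rewrite !scale1r.
- by move=> c d v; rewrite scalerDl.
- by move=> c d v; rewrite scalerA.
- by move=> c x v; rewrite -[c *: uact x v]addr0 -{1}(uact0 x) -uact_lin addr0.
Qed.

(** The [let] bindings make the type mention both hypotheses, so that the module structure attached
    to it can depend on them. *)
Definition env_module : Type := let _ := X_lin in let _ := X_bracket in V.

HB.instance Definition _ := GRing.Zmodule.on env_module.

Definition env_scale (u : U) (v : env_module) : env_module := uact (urepr u) (v : V).

Lemma env_scale_pi t v : env_scale (upi b t) v = uact t v.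
Proof. exact/uact_eq/urepr_pi. Qed.

Lemma env_scaleA x y v : env_scale x (env_scale y v) = env_scale (x * y) v.
Proof. by elim/upi_ind: x => x; elim/upi_ind: y => y; rewrite -upiM !env_scale_pi. Qed.
Lemma env_scale1 : left_id 1 env_scale.
Proof. by move=> v; rewrite [LHS]env_scale_pi /= scale1r. Qed.
Lemma env_scaleDr : right_distributive env_scale +%R.
Proof.
elim/upi_ind=> x v w; rewrite !env_scale_pi.
by have := uact_lin x 1 v w; rewrite !scale1r.
Qed.
Lemma env_scaleDl v : {morph env_scale^~ v : x y / x + y}.
Proof. by elim/upi_ind=> x; elim/upi_ind=> y; rewrite -upiD !env_scale_pi. Qed.

HB.instance Definition _ := GRing.Zmodule_isLmodule.Build U env_module
  env_scaleA env_scale1 env_scaleDr env_scaleDl.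

Lemma env_module_gen i (v : env_module) : ugen b i *: v = X i v.
Proof. exact: env_scale_pi. Qed.

Lemma env_module_const c (v : env_module) : uconst b c *: v = c *: (v : V).
Proof. exact: env_scale_pi. Qed.

End EnvelopingModule.

End EnvelopingRing.

(** * The induced module and its universal property *)

Section Induction.
Variables (K : fieldType) (N : nat).
Local Notation Ug := (Ug K N).
Local Notation Zg := (Zg K N).

Lemma Ugen_bracket x y :
  Ugen K N x * Ugen K N y + Ugen K N y * Ugen K N x = Uconst N (bracket K N x y).
Proof. exact: ugen_bracket. Qed.

Lemma Zgen_anticomm x y : Zgen K x * Zgen K y = - (Zgen K y * Zgen K x :> Zg).
Proof.
apply/eqP; rewrite -addr_eq0 [_ + _](ugen_bracket (fun _ _ => 0 : K)).
by rewrite [uconst _ _]rmorph0.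
Qed.

Lemma Ug_scale_comm (M M' : lmodType Ug) (f : M -> M') :
  (forall x y, f (x + y) = f x + f y) ->
  (forall c m, f (Uconst N c *: m) = Uconst N c *: f m) ->
  (forall x m, f (Ugen K N x *: m) = Ugen K N x *: f m) ->
  forall u m, f (u *: m) = u *: f m.
Proof. exact: env_scale_comm. Qed.

Lemma Zg_scale_comm (M M' : lmodType Zg) (f : M -> M') :
  (forall x y, f (x + y) = f x + f y) ->
  (forall c m, f (Zconst N c *: m) = Zconst N c *: f m) ->
  (forall x m, f (Zgen K x *: m) = Zgen K x *: f m) ->
  forall u m, f (u *: m) = u *: f m.
Proof. exact: env_scale_comm. Qed.

Lemma Up_incl_const c : Up_incl K N (uconst _ c) = Uconst N c.
Proof. exact: (umap_pi (@Up_incl_bracket K N) (UConst _ c)). Qed.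

Lemma Up_incl_genE x : Up_incl K N (ugen _ x) = Ugen K N (val x).
Proof. exact: (umap_pi (@Up_incl_bracket K N) (UGen _ x)). Qed.

Lemma Up_proj_const c : Up_proj K N (uconst _ c) = Zconst N c.
Proof. exact: (umap_pi (@Up_proj_bracket K N) (UConst _ c)). Qed.

Lemma Up_proj_genE x : Up_proj K N (ugen _ x) = Up_proj_gen K N x.
Proof. exact: (umap_pi (@Up_proj_bracket K N) (UGen _ x)). Qed.

Section Tensor.
Variable M0 : lmodType Zg.

Lemma itensorDl u v (m : M0) : itensor (u + v) m = itensor u m + itensor v m.
Proof. by rewrite -tpiD; apply/tpiP/teq_pureDl. Qed.

Lemma itensorDr u (m m' : M0) : itensor u (m + m') = itensor u m + itensor u m'.
Proof. by rewrite -tpiD; apply/tpiP/teq_pureDr. Qed.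

Lemma itensorN u (m : M0) : itensor (- u) m = - itensor u m.
Proof.
have E0 : itensor 0 m = 0 by apply: (addIr (itensor 0 m)); rewrite -itensorDl !add0r.
by apply/eqP; rewrite -addr_eq0 -itensorDl addNr E0.
Qed.

Lemma itensor_balanced u (x : Up K N) (m : M0) :
  itensor (u * Up_incl K N x) m = itensor u (Up_proj K N x *: m).
Proof. exact/tpiP/teq_balanced. Qed.

Lemma itensorZ u v (m : M0) : u *: itensor v m = itensor (u * v) m.
Proof. exact: tscale_pi. Qed.

Lemma itensor_scale1 u (m : M0) : itensor u m = u *: itensor 1 m.
Proof. by rewrite itensorZ mulr1. Qed.

Lemma induced_ind (P : induced M0 -> Prop) : P 0 ->
  (forall x y, P x -> P y -> P (x + y)) -> (forall u m, P (itensor u m)) ->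
  forall t, P t.
Proof.
(* Opposites are a constructor of tensor terms; carrying [P] for [t] and [- t] together absorbs
   them, because [itensorN] moves the sign into the first factor. *)
move=> P0 PD Pt t; suff: P t /\ P (- t) by case.
elim/tpi_ind: t => t; elim: t => [u m||x [hx hx']|x [hx hx'] y [hy hy']].
- split; first exact: Pt.
  by rewrite -/(itensor u m) -itensorN.
- by rewrite tpi0 oppr0.
- by rewrite tpiN opprK.
- by rewrite tpiD opprD; split; apply: PD.
Qed.

Lemma itensor_const c (m : M0) : itensor 1 (Zconst N c *: m) = Uconst N c *: itensor 1 m.
Proof.
by rewrite -Up_proj_const -itensor_balanced mul1r [LHS]itensor_scale1 Up_incl_const.
Qed.

Lemma itensor_gen (x : modeZ N) (m : M0) :
  itensor 1 (Zgen K x *: m) = Ugen K N (val x) *: itensor 1 m.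
Proof.
have x0 : 0 <= (val x).2 by case/andP: (valP x).
pose y : Up K N := ugen _ (exist _ (val x) x0 : modeP).
have -> : Zgen K x = Up_proj K N y by rewrite Up_proj_genE /Up_proj_gen /= valK.
by rewrite -itensor_balanced mul1r [LHS]itensor_scale1 Up_incl_genE.
Qed.

Lemma itensor_pos (x : mode) (m : M0) : N%:Z <= x.2 -> Ugen K N x *: itensor 1 m = 0.
Proof.
move=> hx; have x0 : 0 <= x.2 by apply: le_trans hx.
pose y : Up K N := ugen _ (exist _ x x0 : modeP).
have -> : Ugen K N x = Up_incl K N y by rewrite Up_incl_genE.
rewrite -itensor_scale1 -[Up_incl _ _ _]mul1r itensor_balanced.
have -> : Up_proj K N y = 0.
  by rewrite Up_proj_genE /Up_proj_gen /= insubN // negb_and -leNgt hx orbT.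
by rewrite scale0r; apply: (addIr (itensor 1 0)); rewrite -itensorDr !add0r.
Qed.

Section Extension.
Variables (V : lmodType Ug) (f : M0 -> V).
Hypothesis fD : forall x y, f (x + y) = f x + f y.
Hypothesis f_const : forall c m, f (Zconst N c *: m) = Uconst N c *: f m.
Hypothesis f_gen : forall (x : modeZ N) m, f (Zgen K x *: m) = Ugen K N (val x) *: f m.
Hypothesis f_pos : forall (x : mode) m, N%:Z <= x.2 -> Ugen K N x *: f m = 0.

Fixpoint teval (t : tterm Ug (restrict_scalars (Up_proj K N) M0)) : V :=
  match t with
  | TPure a m => a *: f m
  | TZero => 0
  | TOpp x => - teval x
  | TAdd x y => teval x + teval y
  end.

(** An instance of [env_scale_comm] over [Up]: the source is an [Up]-module through [Up_proj], the
    target through [Up_incl]. *)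
Lemma f_balanced (x : Up K N) (m : M0) : f (Up_proj K N x *: m) = Up_incl K N x *: f m.
Proof.
apply: (@env_scale_comm _ _ _ (restrict_scalars (Up_proj K N) M0)
          (restrict_scalars (Up_incl K N) V) f) => // [c m'|i m'].
  have -> : uconst _ c *: m' = Zconst N c *: (m' : M0) :> M0.
    by rewrite -Up_proj_const.
  by rewrite f_const -Up_incl_const.
have -> : ugen _ i *: (f m' : restrict_scalars (Up_incl K N) V) = Ugen K N (val i) *: f m' :> V.
  by rewrite -Up_incl_genE.
have -> : ugen _ i *: m' = Up_proj_gen K N i *: (m' : M0) :> M0.
  by rewrite -Up_proj_genE.
rewrite /Up_proj_gen; case: insubP => [z _ zi|]; first by rewrite f_gen zi.
rewrite negb_and (valP i) /= -leNgt => hi.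
rewrite f_pos // scale0r; apply: (addIr (f 0)); by rewrite -fD !add0r.
Qed.

Lemma teval_eq x y : teq (Up_incl K N) x y -> teval x = teval y.
Proof.
elim=> //= {x y}.
- by move=> x y z _ -> _ ->.
- by move=> x y _ ->.
- by move=> x y z w _ -> _ ->.
- by move=> x y z; rewrite addrA.
- by move=> x y; rewrite addrC.
- by move=> x; rewrite add0r.
- by move=> x; rewrite addNr.
- by move=> a a' m; rewrite scalerDl.
- by move=> a m m'; rewrite fD scalerDr.
- by move=> a x m; rewrite -scalerA -f_balanced.
Qed.

(** Frobenius reciprocity: a map from [M0] into the vectors killed by the positive modes, compatible
    with the zero modes, extends to the induced module. *)
Definition ind_ext (t : induced M0) : V := teval (trepr t).

Lemma ind_ext_pi t : ind_ext (tpi _ t) = teval t.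
Proof. exact/teval_eq/trepr_pi. Qed.

Lemma ind_extD x y : ind_ext (x + y) = ind_ext x + ind_ext y.
Proof. by elim/tpi_ind: x => x; elim/tpi_ind: y => y; rewrite -tpiD !ind_ext_pi. Qed.

Lemma ind_ext_tensor u m : ind_ext (itensor u m) = u *: f m.
Proof. exact: ind_ext_pi. Qed.

Lemma ind_ext0 : ind_ext 0 = 0.
Proof. by apply: (addIr (ind_ext 0)); rewrite -ind_extD !add0r. Qed.

Lemma ind_extZ u t : ind_ext (u *: t) = u *: ind_ext t.
Proof.
elim/induced_ind: t => [|x y hx hy|v m].
- by rewrite scaler0 ind_ext0 scaler0.
- by rewrite scalerDr !ind_extD hx hy scalerDr.
- by rewrite itensorZ !ind_ext_tensor scalerA.
Qed.

End Extension.

End Tensor.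

Lemma induced_ext (M0 : lmodType Zg) (V : zmodType) (f g : induced M0 -> V) :
  (forall x y, f (x + y) = f x + f y) -> (forall x y, g (x + y) = g x + g y) ->
  (forall u m, f (itensor u m) = g (itensor u m)) -> f =1 g.
Proof.
move=> fD gD fg; elim/induced_ind=> [|x y hx hy|] //; last by rewrite fD gD hx hy.
have f0 : f 0 = 0 by apply: (addIr (f 0)); rewrite -fD !add0r.
by rewrite f0; apply: (addIr (g 0)); rewrite -gD !add0r.
Qed.

End Induction.

(** * Clifford relations and singular vectors *)

Section Clifford.
Variables (K : fieldType) (N : nat).
Hypothesis charK : [pchar K] =i pred0.
Local Notation Ug := (Ug K N).
Local Notation U := (Ugen K N).
Local Notation br := (bracket K N).

(** The only mode whose bracket with [x] can be nonzero. *)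
Definition partner (x : mode) : mode := (~~ x.1, N%:Z - 1 - x.2).

Lemma bracketC x y : br x y = br y x.
Proof. by case: x y => [[] k] [[] l]. Qed.

Lemma bracket_same s k l : br (s, k) (s, l) = 0.
Proof. by case: s. Qed.

Lemma bracket_zero (x y : mode) : 0 <= x.2 < N%:Z -> br x y = 0.
Proof.
case: x y => [[] k] [[] l] //= h; case: eqP => // E; apply: zbinom_small => //.
by move: h; lia.
Qed.

Lemma bracket_pos (x y : mode) : 0 <= x.2 -> 0 <= y.2 -> br x y = 0.
Proof.
move=> hx hy; have [xN|Nx] := ltP x.2 N%:Z; first by rewrite bracket_zero ?hx.
have [yN|Ny] := ltP y.2 N%:Z; first by rewrite bracketC bracket_zero ?hy.
by case: x y {hx hy} Nx Ny => [[] k] [[] l] //= h1 h2; case: eqP => //; lia.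
Qed.

(** For charge + the bracket is binom(k, N) with [N <= k]; for charge - it is binom(N-1-k, N) with a
    negative upper entry. Neither product has a zero factor in characteristic 0. *)
Lemma bracket_partner_neq0 (x : mode) : N%:Z <= x.2 -> br x (partner x) != 0.
Proof.
case: x => [[] k] //= h.
  rewrite ifT; last by apply/eqP; lia.
  by case: k h => k // h; apply: zbinom_nat_neq0.
rewrite ifT; last by apply/eqP; lia.
have -> : N%:Z - 1 - k = - (`|k - N%:Z|%N).+1%:Z by lia.
exact: zbinom_neg_neq0.
Qed.

Lemma bracket_partner (x y : mode) : x != y -> br x (partner y) = 0.
Proof.
by case: x y => [[] k] [[] l] //= /eqP h; case: eqP => // E; case: h; congr pair; lia.
Qed.

Definition ann (x : mode) : Ug := U x.
Definition cre (x : mode) : Ug := Uconst N (br x (partner x))^-1 * U (partner x).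

Lemma Uconst0 : Uconst N 0 = 0 :> Ug. Proof. exact: rmorph0. Qed.
Lemma Uconst1 : Uconst N 1 = 1 :> Ug. Proof. exact: rmorph1. Qed.
Lemma UconstM c d : Uconst N (c * d) = Uconst N c * Uconst N d :> Ug.
Proof. exact: rmorphM. Qed.
Lemma Uconst_comm c (u : Ug) : Uconst N c * u = u * Uconst N c.
Proof. exact: uconst_comm. Qed.

Lemma U_anticomm x y : br x y = 0 -> U x * U y = - (U y * U x).
Proof. by move=> h; apply/eqP; rewrite -addr_eq0 Ugen_bracket h Uconst0. Qed.

Lemma U_sq x : U x * U x = 0.
Proof. by apply: (ugen_sq charK); case: x => s k; apply: bracket_same. Qed.

Lemma ann_cre (x : mode) : N%:Z <= x.2 -> ann x * cre x + cre x * ann x = 1.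
Proof.
move=> h; rewrite /ann /cre mulrA -Uconst_comm -!mulrA -mulrDr Ugen_bracket.
by rewrite -UconstM mulVf ?Uconst1 // bracket_partner_neq0.
Qed.

Lemma cre_sq x : cre x * cre x = 0.
Proof.
rewrite /cre -mulrA [U _ * (_ * _)]mulrA -Uconst_comm -[_ * U _ * U _]mulrA.
by rewrite U_sq !mulr0.
Qed.

Lemma cre_anticomm x y : br y (partner x) = 0 -> U y * cre x = - (cre x * U y).
Proof.
by move=> h; rewrite /cre mulrA -Uconst_comm -!mulrA U_anticomm // mulrN.
Qed.

Lemma cre_cre (x y : mode) : N%:Z <= x.2 -> N%:Z <= y.2 -> cre x * cre y = - (cre y * cre x).
Proof.
move=> hx hy; rewrite [cre x]/cre -mulrA cre_anticomm; last first.
  by case: x y hx hy => [[] k] [[] l] //= hx hy; case: eqP => //; lia.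
by rewrite mulrN [cre y * (_ * _)]mulrA -(Uconst_comm _ (cre y)) -[in RHS]mulrA.
Qed.

Lemma ann_ann (x y : mode) : N%:Z <= x.2 -> N%:Z <= y.2 -> ann x * ann y = - (ann y * ann x).
Proof. by move=> hx hy; apply/U_anticomm/bracket_pos; lia. Qed.

Section Module.
Variable M : lmodType Ug.

Definition smooth : Prop :=
  forall s (m : M), exists n0 : int, forall n, n0 <= n -> U (s, n) *: m = 0.

Definition singular (m : M) : Prop := forall x : mode, N%:Z <= x.2 -> U x *: m = 0.

(** The list [J] contains every annihilation mode that may act nontrivially on [m]; it is the
    induction measure of the Clifford arguments, each step of which removes one mode. *)
Definition killed_off (J : seq mode) (m : M) : Prop :=
  forall x : mode, N%:Z <= x.2 -> x \notin J -> U x *: m = 0.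

Lemma smooth_killed_off m : smooth -> exists J : seq mode,
  (forall x : mode, x \in J -> N%:Z <= x.2) /\ killed_off J m.
Proof.
move=> sm; have [a ha] := sm true m; have [b hb] := sm false m.
pose L := (`|a|%N + `|b|%N)%N.
exists [seq (s, N%:Z + i%:Z) | s <- [:: true; false], i <- iota 0 L]; split.
  by move=> x /allpairsPdep[s [i [_ _ ->]]] /=; lia.
move=> [s k] hk /negP h; rewrite /= in hk; have [kL|kL] := ltP k (N%:Z + L%:Z).
  exfalso; apply: h; apply/allpairsPdep; exists s, `|k - N%:Z|%N => /=.
  by split; [case: s | rewrite mem_iota; lia | congr pair; lia].
by case: s {h}; [apply: ha | apply: hb]; lia.
Qed.

Lemma killed_off_ann (x : mode) J m : N%:Z <= x.2 -> killed_off (x :: J) m ->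
  killed_off J (ann x *: m).
Proof.
move=> hx h y hy yJ; have [->|yx] := eqVneq y x; first by rewrite scalerA U_sq scale0r.
by rewrite scalerA ann_ann // scaleNr -scalerA h ?scaler0 ?oppr0 // inE negb_or yx.
Qed.

Lemma killed_off_annK x J m : ann x *: m = 0 -> killed_off (x :: J) m -> killed_off J m.
Proof.
move=> h0 h y hy yJ; have [->//|yx] := eqVneq y x.
by apply: h => //; rewrite inE negb_or yx.
Qed.

Lemma ann_creE (x : mode) (m : M) : N%:Z <= x.2 ->
  m = ann x *: (cre x *: m) + cre x *: (ann x *: m).
Proof. by move=> h; rewrite !scalerA -scalerDl ann_cre // scale1r. Qed.

(** A mode [y] outside [J] and different from [x] anticommutes with both factors of the idempotent,
    and [x] itself squares to 0; so the idempotent removes [x] from the list. *)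
Lemma killed_off_proj (x : mode) J m : N%:Z <= x.2 -> killed_off (x :: J) m ->
  killed_off J (ann x *: (cre x *: m)).
Proof.
move=> hx h y hy yJ; have [->|yx] := eqVneq y x; first by rewrite scalerA U_sq scale0r.
have E : U y *: (cre x *: m) = 0.
  rewrite scalerA cre_anticomm ?bracket_partner // scaleNr -scalerA h ?scaler0 ?oppr0 //.
  by rewrite inE negb_or yx.
by rewrite scalerA [U y * _]ann_ann // scaleNr -scalerA E scaler0 oppr0.
Qed.

(** This is [U(g_{N,<0})] applied to [W]. Only creation modes are constructors; stability under the
    other modes is a matter of reordering ([neg_span_Ugen]). *)
Inductive neg_span (W : M -> Prop) : M -> Prop :=
  | neg_span_base m : W m -> neg_span W m
  | neg_spanD x y : neg_span W x -> neg_span W y -> neg_span W (x + y)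
  | neg_span_const c x : neg_span W x -> neg_span W (Uconst N c *: x)
  | neg_span_gen (x : mode) m : x.2 < 0 -> neg_span W m -> neg_span W (U x *: m).

Lemma smooth_neg_span : smooth -> forall m, neg_span singular m.
Proof.
move=> sm m; have [J [hJ]] := smooth_killed_off m sm.
elim: J m hJ => [|x J IH] m hJ h; first by apply: neg_span_base => y hy; apply: h.
have hx : N%:Z <= x.2 by apply: hJ; rewrite inE eqxx.
have {}IH m' : killed_off J m' -> neg_span singular m'.
  by apply: IH => y yJ; apply: hJ; rewrite inE yJ orbT.
rewrite (ann_creE m hx); apply: neg_spanD; first exact/IH/killed_off_proj.
rewrite /cre -scalerA; apply/neg_span_const/neg_span_gen; first by rewrite /=; lia.
exact/IH/killed_off_ann.
Qed.

Section Generated.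
Variable W : M -> Prop.
Hypothesis W0 : W 0.
Hypothesis WD : forall x y, W x -> W y -> W (x + y).
Hypothesis Wconst : forall c x, W x -> W (Uconst N c *: x).
Hypothesis Wsing : forall m, W m -> singular m.
Hypothesis Wzero : forall (x : mode) m, 0 <= x.2 < N%:Z -> W m -> W (U x *: m).

(** Reordering as in the PBW theorem: a nonnegative mode moves right past the creation modes, each
    exchange costing only a scalar multiple of a shorter product, until it meets [W], which it kills
    or preserves. *)
Lemma neg_span_Ugen x m : neg_span W m -> neg_span W (U x *: m).
Proof.
have [x0|x0] := ltP x.2 0; first exact: neg_span_gen.
elim=> {m} [m Wm|m n _ hm _ hn|c m _ hm|y m y0 hm IH].
- have [xN|Nx] := ltP x.2 N%:Z; first by apply/neg_span_base/Wzero; rewrite ?x0.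
  by rewrite Wsing //; apply: neg_span_base.
- by rewrite scalerDr; apply: neg_spanD.
- by rewrite scalerA -Uconst_comm -scalerA; apply: neg_span_const.
have -> : U x *: (U y *: m) = Uconst N (br x y) *: m + Uconst N (-1) *: (U y *: (U x *: m)).
  rewrite !scalerA -scalerDl -Ugen_bracket; congr (_ *: _).
  have -> : Uconst N (-1) = -1 :> Ug by rewrite [LHS](rmorphN1 (uconst _)).
  by rewrite -mulrA mulN1r addrK.
apply: neg_spanD; first exact: neg_span_const.
exact/neg_span_const/neg_span_gen.
Qed.

Lemma neg_spanZ u m : neg_span W m -> neg_span W (u *: m).
Proof.
elim/env_ind: u m => [c|i|x IH|x y hx hy|x y hx hy] m Wm.
- exact: neg_span_const.
- exact: neg_span_Ugen.
- rewrite scaleNr -scalerN; apply: IH.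
  have -> : - m = Uconst N (-1) *: m by rewrite [X in X *: _](rmorphN1 (uconst _)) scaleN1r.
  exact: neg_span_const.
- by rewrite scalerDl; apply: neg_spanD; [apply: hx | apply: hy].
- by rewrite -scalerA; apply/hx/hy.
Qed.

(** Duplicates in [J] are excluded so that, in [singular_neg_span], the idempotent of a mode kills
    exactly its own summand and can be moved past the creation operators of all the others. *)
Lemma neg_span_form m : neg_span W m -> exists w (J : seq mode) (f : mode -> M),
  [/\ W w, forall x : mode, x \in J -> N%:Z <= x.2, uniq J & m = w + \sum_(x <- J) cre x *: f x].
Proof.
elim=> {m} [m Wm|m n _ [w [J [f [Ww hJ uJ ->]]]] _ [w' [J' [f' [Ww' hJ' uJ' ->]]]]|c m _|y m y0 hm _].
- by exists m, [::], (fun=> 0); rewrite big_nil addr0.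
- exists (w + w'), (undup (J ++ J')),
    (fun x => (if x \in J then f x else 0) + (if x \in J' then f' x else 0)).
  split; [exact: WD | | exact: undup_uniq |].
    by move=> x; rewrite mem_undup mem_cat => /orP[/hJ|/hJ'].
  rewrite addrACA; congr (_ + _); under [RHS]eq_bigr do rewrite scalerDr.
  (* Each sum is rewritten over the merged list, with value 0 at the modes absent from its own list;
     this keeps the merged list duplicate-free. *)
  have aux (L L' : seq mode) (g : mode -> M) : uniq L -> uniq L' -> {subset L <= L'} ->
      \sum_(x <- L) cre x *: g x = \sum_(x <- L') cre x *: (if x \in L then g x else 0).
    move=> uL uL' sub.
    transitivity (\sum_(x <- L) cre x *: (if x \in L then g x else 0)).
      by apply: eq_big_seq => x xL; rewrite xL.
    apply: (@sum_support _ _ _ _ (fun x => cre x *: (if x \in L then g x else 0))) => // x hx.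
      by rewrite (negbTE hx) scaler0.
    by rewrite ifN ?scaler0 //; apply: contra hx => /sub.
  rewrite big_split /=; congr (_ + _); apply: aux; rewrite ?undup_uniq // => x xJ;
    by rewrite mem_undup mem_cat xJ ?orbT.
- move=> [w [J [f [Ww hJ uJ ->]]]]; exists (Uconst N c *: w), J, (fun x => Uconst N c *: f x).
  split=> //; first exact: Wconst.
  rewrite scalerDr scaler_sumr; congr (_ + _); apply: eq_bigr => x _.
  by rewrite !scalerA Uconst_comm.
(* [partner] is an involution, so the negative mode [y] is a nonzero multiple of [cre x] for
   [x = partner y]. *)
pose x : mode := partner y; have hx : N%:Z <= x.2 by rewrite /x /=; lia.
have xK : partner x = y by rewrite /x /partner /= negbK; case: y {y0 x hx} => s k /=; congr pair; lia.
exists 0, [:: x], (fun=> Uconst N (br x (partner x)) *: m); split=> //.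
  by move=> z; rewrite inE => /eqP ->.
rewrite add0r big_seq1 scalerA /cre -mulrA -Uconst_comm mulrA -UconstM.
by rewrite mulVf ?bracket_partner_neq0 // Uconst1 mul1r xK.
Qed.

(* The idempotents [ann x * cre x] fix the singular vectors, commute with
   [cre y] for y <> x, and annihilate [cre x]. *)
Lemma singular_neg_span m : neg_span W m -> singular m -> W m.
Proof.
move=> /neg_span_form[w [J [f [Ww hJ uJ E]]]] sm; suff -> : m = w by [].
elim: J f hJ uJ E => [|x J IH] f hJ uJ E; first by rewrite E big_nil addr0.
have hx : N%:Z <= x.2 by apply: hJ; rewrite inE eqxx.
have fixE n : singular n -> ann x *: (cre x *: n) = n.
  by move=> sn; rewrite [RHS](ann_creE n hx) [ann x *: n]sn // scaler0 addr0.
move: uJ => /= /andP[xJ uJ].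
apply: (IH (fun y => ann x *: (cre x *: f y))) => // [y yJ|].
  by apply: hJ; rewrite inE yJ orbT.
rewrite -[LHS]fixE // E !scalerDr (fixE w); last exact: Wsing.
rewrite big_cons scalerDr [cre x *: (_ *: _)]scalerA cre_sq scale0r scalerDr scaler0 add0r.
congr (_ + _); rewrite !scaler_sumr !big_seq; apply: eq_bigr => y yJ.
have hy : N%:Z <= y.2 by apply: hJ; rewrite inE yJ orbT.
have xy : x != y by apply: contraNneq xJ => ->.
rewrite !scalerA; congr (_ *: _); rewrite -mulrA cre_cre // mulrN mulrA.
by rewrite cre_anticomm ?bracket_partner // mulNr opprK mulrA.
Qed.

End Generated.

Lemma smooth_inj (M' : lmodType Ug) (f : M -> M') : smooth ->
  (forall x y, f (x + y) = f x + f y) -> (forall u x, f (u *: x) = u *: f x) ->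
  (forall x, singular x -> f x = 0 -> x = 0) -> injective f.
Proof.
move=> sm fD fZ finj.
have f0 : f 0 = 0 by rewrite -[0](scale0r (0 : M)) fZ scale0r.
suff ker m : f m = 0 -> m = 0.
  move=> x y E; apply/eqP; rewrite -subr_eq0; apply/eqP/ker.
  by rewrite -scaleN1r fD fZ E scaleN1r subrr.
have [J [hJ]] := smooth_killed_off m sm.
elim: J m hJ => [|x J IH] m hJ h fm; first by apply: finj => // y hy; apply: h.
have hx : N%:Z <= x.2 by apply: hJ; rewrite inE eqxx.
have {}IH m' : killed_off J m' -> f m' = 0 -> m' = 0.
  by apply: IH => y yJ; apply: hJ; rewrite inE yJ orbT.
apply: (IH) => //; apply: killed_off_annK (h).
by apply: IH; [exact: killed_off_ann | rewrite fZ fm scaler0].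
Qed.

End Module.

(** * Singular vectors and smoothness of the induced module *)

Section InducedModule.
Variable M0 : lmodType (Zg K N).

Definition pure (t : induced M0) : Prop := exists m, t = itensor 1 m.

Lemma pure0 : pure 0.
Proof. by exists 0; apply: (addIr (itensor 1 0)); rewrite -itensorDr !add0r. Qed.

Lemma pureD x y : pure x -> pure y -> pure (x + y).
Proof. by move=> [m ->] [m' ->]; exists (m + m'); rewrite itensorDr. Qed.

Lemma pure_const c x : pure x -> pure (Uconst N c *: x).
Proof. by move=> [m ->]; exists (Zconst N c *: m); rewrite itensor_const. Qed.

Lemma pure_singular x : pure x -> singular x.
Proof. by move=> [m ->] y hy; apply: itensor_pos. Qed.

Lemma pure_zero (x : mode) t : 0 <= x.2 < N%:Z -> pure t -> pure (U x *: t).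
Proof.
move=> hx [m ->]; pose z : modeZ N := exist _ x hx.
by exists (Zgen K z *: m); rewrite itensor_gen.
Qed.

Lemma neg_span_pure t : neg_span pure t.
Proof.
elim/induced_ind: t => [|x y hx hy|u m].
- exact/neg_span_base/pure0.
- exact: neg_spanD.
rewrite itensor_scale1; apply: neg_spanZ; [exact: pure0 | exact: pure_singular | exact: pure_zero |].
by apply: neg_span_base; exists m.
Qed.

Lemma singular_pure t : singular t -> pure t.
Proof.
apply: singular_neg_span; [exact: pure0 | exact: pureD | exact: pure_const | exact: pure_singular |].
exact: neg_span_pure.
Qed.

Lemma induced_smooth : smooth (induced M0).
Proof.
move=> s t; elim: (neg_span_pure t) => {t} [_ [m ->]|x y _ [a ha] _ [b hb]|c m _ [a ha]|y m _ _ [a ha]].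
- by exists N%:Z => n hn; rewrite itensor_pos.
- exists (Order.max a b) => n; rewrite ge_max => /andP[an bn].
  by rewrite scalerDr ha ?hb ?addr0.
- by exists a => n hn; rewrite scalerA -Uconst_comm -scalerA ha ?scaler0.
(* From [N - y.2] on, [n + y.2] exceeds [N - 1], so the bracket with [y] vanishes. *)
exists (Order.max a (N%:Z - y.2)) => n; rewrite ge_max => /andP[an hn].
rewrite scalerA U_anticomm ?scaleNr -?scalerA ?ha ?scaler0 ?oppr0 //.
by case: s y hn {m ha} => [] [[] k] //= h; case: eqP => //; lia.
Qed.

End InducedModule.

End Clifford.
(** * Modules over the free field algebra *)

Section VertexModules.
Variables (K : fieldType) (V : vertexSuperalgebra K).

Lemma va_self_module : is_vertex_module (@va_prod K V).
Proof.
split; [exact: va_lin_l | exact: va_lin_r | exact: va_trunc | exact: va_vac_l |].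
exact: va_borcherds.
Qed.

Variables (M : lmodType K) (act : int -> V -> M -> M).
Hypothesis vm : is_vertex_module act.

Lemma actDl n u v m : act n (u + v) m = act n u m + act n v m.
Proof. by have := vm_lin_l vm n m 1 u v; rewrite !scale1r. Qed.
Lemma act0l n m : act n 0 m = 0.
Proof. by apply: (addIr (act n 0 m)); rewrite -actDl !add0r. Qed.
Lemma actZl n c u m : act n (c *: u) m = c *: act n u m.
Proof. by rewrite -[c *: u]addr0 (vm_lin_l vm) act0l addr0. Qed.
Lemma act_suml n J (r : seq J) (f : J -> V) m :
  act n (\sum_(j <- r) f j) m = \sum_(j <- r) act n (f j) m.
Proof. by elim: r => [|j r IH]; rewrite ?big_nil ?act0l // !big_cons actDl IH. Qed.
Lemma actDr n u x y : act n u (x + y) = act n u x + act n u y.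
Proof. by have := vm_lin_r vm n u 1 x y; rewrite !scale1r. Qed.
Lemma act0r n u : act n u 0 = 0.
Proof. by apply: (addIr (act n u 0)); rewrite -actDr !add0r. Qed.
Lemma actZr n c u x : act n u (c *: x) = c *: act n u x.
Proof. by rewrite -[c *: x]addr0 (vm_lin_r vm) act0r addr0. Qed.
Lemma act_sumr n J (r : seq J) (f : J -> M) u :
  act n u (\sum_(j <- r) f j) = \sum_(j <- r) act n u (f j).
Proof. by elim: r => [|j r IH]; rewrite ?big_nil ?act0r // !big_cons actDr IH. Qed.

(** The Borcherds identity at [r = 0], where [binom(0, i)] leaves only [i = 0] on the right; the
    bound is at least 1 so that this term is present. *)
Lemma vm_commutator a b u v m p q : va_par a u -> va_par b v ->
  exists L : nat, forall l : nat, (L <= l)%N ->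
  act p u (act q v m) - (-1) ^+ (a && b) *: act q v (act p u m) =
  \sum_(i < l) zbinom K p i *: act (p + q - i%:Z) (va_prod i%:Z u v) m.
Proof.
move=> pu pv; have [L h] := vm_borcherds vm m p q 0 pu pv.
exists (maxn 1 L) => l; rewrite geq_max => /andP[l1 Ll].
have := h l Ll; under eq_bigr do rewrite add0r; move=> ->.
case: l l1 {Ll} => // l _; rewrite big_ord_recl big1 => [|i _].
  by rewrite zbinom0 expr0 !mul1r scale1r !subr0 !addr0.
by rewrite zbinom_zero mulr0 scale0r.
Qed.

(** The Borcherds identity at [p = 0]. It expresses the modes of a product by those of its factors,
    which drives the inductions over strong generation. *)
Lemma vm_assoc a b u v m q r : va_par a u -> va_par b v ->
  exists L : nat, forall l : nat, (L <= l)%N ->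
  act q (va_prod r u v) m =
    \sum_(i < l) ((-1) ^+ i * zbinom K r i) *:
      (act (r - i%:Z) u (act (q + i%:Z) v m)
       - ((-1) ^ r * (-1) ^+ (a && b)) *: act (q + r - i%:Z) v (act i%:Z u m)).
Proof.
move=> pu pv; have [L h] := vm_borcherds vm m 0 q r pu pv.
exists (maxn 1 L) => l; rewrite geq_max => /andP[l1 Ll].
have := h l Ll; under [in RHS]eq_bigr do rewrite !add0r; move=> <-.
case: l l1 {Ll} => // l _; rewrite big_ord_recl big1 => [|i _].
  by rewrite zbinom0 scale1r !(add0r, addr0, subr0).
by rewrite zbinom_zero scale0r.
Qed.

End VertexModules.

(** * Strong generation and the modes of the generating fields *)

Section FreeField.
Variables (K : fieldType) (N : nat) (F : freeFieldAlgebra K N).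
Local Notation X := (ffX F).
Local Notation prod := (@va_prod K F).
Local Notation par := (@va_par K F).
Local Notation selfF := (va_self_module F).

Lemma par_prodX a s n v : par a v -> par (~~ a) (prod n (X s) v).
Proof. by move=> h; have := va_par_prod n (ffX_odd F s) h; case: a {h}. Qed.

(** [ff_strong] runs through vectors without a parity, while the Borcherds identity asks for
    homogeneous ones; the induction therefore carries the statement for both parity components of a
    vector at once. *)
Lemma ff_strong_par (Q : bool -> F -> Prop) :
  (forall a, Q a 0) ->
  (forall a c u v, par a u -> par a v -> Q a u -> Q a v -> Q a (c *: u + v)) ->
  Q false (vac F) ->
  (forall a s (n : nat) v, par a v -> Q a v -> Q (~~ a) (prod (- n.+1%:Z) (X s) v)) ->
  forall a u, par a u -> Q a u.
Proof.
move=> Q0 Qlin Qvac QX a u pu.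
have [parP parZ] := va_parP F.
pose comp := gr_comp parP.
suff: forall v b, Q b (comp v b) by move=> /(_ u a); rewrite /comp gr_comp_hom.
move=> {u pu}; apply: (@ff_strong _ _ F) => [c u v hu hv b|b|s n v hv b].
- have dec : decomposes par (fun j => c *: comp u j + comp v j) (c *: u + v).
    apply: (@decomposesD _ _ par (fun j => c *: comp u j) (comp v)).
    + exact: grD parP.
    2: exact: gr_compP.
    have := gr_compP parP u; rewrite -/comp => -[cgr [t [ut ct E]]].
    split=> [j|]; first exact: parZ.
    exists t; split=> // [i it|]; first by rewrite ct ?scaler0.
    by rewrite {1}E scaler_sumr.
  by rewrite /comp (gr_compE parP dec); apply: Qlin => //; apply: gr_comp_gr.
- rewrite /comp (gr_compE parP (decomposes_hom (gr0 parP) (va_par_vac F))).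
  by case: b.
- rewrite /comp (@gr_comp_map _ _ _ _ par par (prod (- n.+1%:Z) (X s)) negb negb) //.
  + by rewrite -{1}[b]negbK; apply: QX => //; apply: gr_comp_gr.
  + by move=> x y; apply: (actDr selfF).
  + exact: (act0r selfF).
  + exact: negbK.
  + exact: negbK.
  + by move=> *; apply: par_prodX.
Qed.

Section Modules.
Variables (M : lmodType K) (act : int -> F -> M -> M).
Hypothesis vm : is_vertex_module act.

Lemma mode_bracket (s t : bool) p q m :
  act p (X s) (act q (X t) m) + act q (X t) (act p (X s) m) =
  bracket K N (s, p) (t, q) *: m.
Proof.
(* Only the OPE of [X^+] with [X^-] is given; the order (-,+) follows by symmetry of the
   anticommutator. *)
wlog st : s t p q / (s, t) <> (false, true).
  move=> h; case: s t => [] []; try by apply: h.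
  by rewrite addrC h // -[LHS]/(bracket K N (true, q) (false, p) *: m).
have [L hL] := vm_commutator vm m p q (ffX_odd F s) (ffX_odd F t).
move: (hL (maxn L N.+1)); rewrite leq_maxl => /(_ isT).
rewrite /= expr1 scaleN1r opprK => ->.
case: s t st {hL} => [] [] //= _.
- rewrite big1 ?scale0r // => i _.
  by rewrite ff_ope0 act0l ?scaler0.
(* [maxn L N.+1] makes the sum reach the index [N], the only one at which this OPE contributes. *)
- have NL : (N < maxn L N.+1)%N by rewrite leq_max ltnSn orbT.
  rewrite (bigD1 (Ordinal NL)) //= ff_ope eqxx big1 ?addr0 => [|i].
    rewrite (vm_vac vm); have -> : (p + q - N%:Z == -1) = (p + q == N%:Z - 1).
      by apply/eqP/eqP => h; lia.
    by case: eqP; rewrite ?scaler0 ?scale0r.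
  rewrite -val_eqE /= => /negbTE iN.
  by rewrite ff_ope iN act0l ?scaler0.
- rewrite big1 ?scale0r // => i _.
  by rewrite ff_ope0 act0l ?scaler0.
Qed.

(** By [vm_assoc] each mode of [X_(-n-1) v], applied to a vector, is a finite combination of
    products of one mode of [X] and one of [v]; induction over strong generation then reaches every
    [u]. *)
Lemma act_closed (P : M -> Prop) :
  (forall c x y, P x -> P y -> P (c *: x + y)) ->
  (forall s n m, P m -> P (act n (X s) m)) ->
  forall n u m, P m -> P (act n u m).
Proof.
move=> Plin PX n u m Pm.
have P0 : P 0 by rewrite -(addNr m) -scaleN1r; apply: Plin.
have PD x y : P x -> P y -> P (x + y) by move=> hx hy; rewrite -[x]scale1r; apply: Plin.
have PZ c x : P x -> P (c *: x) by move=> hx; rewrite -[_ *: _]addr0; apply: Plin.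
have hom : forall a v, par a v -> forall n m, P m -> P (act n v m).
  apply: (@ff_strong_par (fun _ v => forall n m, P m -> P (act n v m)))
    => [a k x _|a c v w _ _ hv hw k x Px|k x Px|a s k v pv hv j x Px].
  - by rewrite act0l.
  - by rewrite (vm_lin_l vm); apply: Plin; [apply: hv | apply: hw].
  - by rewrite (vm_vac vm); case: eqP.
  have [L /(_ L (leqnn _)) ->] := vm_assoc vm x j (- k.+1%:Z) (ffX_odd F s) pv.
  apply: big_ind => // i _; apply: (PZ); apply: (PD); first exact/PX/hv.
  by rewrite -scaleNr; apply/PZ/hv/PX.
have [parP _] := va_parP F.
have [_ [s [_ _ ->]]] := gr_compP parP u.
rewrite (act_suml vm); apply: big_ind => // i _.
by apply: (hom i) => //; apply: gr_comp_gr.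
Qed.

Variables (M' : lmodType K) (act' : int -> F -> M' -> M').
Hypothesis vm' : is_vertex_module act'.

(** The induction of [act_closed], run in both modules with a common truncation. It lets maps of
    modules over the enveloping algebra serve as morphisms of F-modules. *)
Lemma act_morph (f : M -> M') : linear f ->
  (forall s n m, f (act n (X s) m) = act' n (X s) (f m)) ->
  forall n u m, f (act n u m) = act' n u (f m).
Proof.
move=> flin fX n u m.
have fD x y : f (x + y) = f x + f y by have := flin 1 x y; rewrite !scale1r.
have f0 : f 0 = 0 by apply: (addIr (f 0)); rewrite -fD !add0r.
have fZ c x : f (c *: x) = c *: f x by rewrite -[c *: x]addr0 flin f0 addr0.
have hom : forall a v, par a v -> forall n m, f (act n v m) = act' n v (f m).
  apply: (@ff_strong_par (fun _ v => forall n m, f (act n v m) = act' n v (f m)))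
    => [a k x|a c v w _ _ hv hw k x|k x|a s k v pv hv j x].
  - by rewrite !act0l.
  - by rewrite (vm_lin_l vm) (vm_lin_l vm') flin hv hw.
  - by rewrite (vm_vac vm) (vm_vac vm'); case: eqP.
  have [L hL] := vm_assoc vm x j (- k.+1%:Z) (ffX_odd F s) pv.
  have [L' hL'] := vm_assoc vm' (f x) j (- k.+1%:Z) (ffX_odd F s) pv.
  rewrite (hL _ (leq_maxl L L')) (hL' _ (leq_maxr L L')).
  rewrite (big_morph f fD f0); apply: eq_bigr => i _.
  by rewrite fZ fD -scaleNr fZ fX !hv fX scaleNr.
have [parP _] := va_parP F.
have [_ [s [_ _ ->]]] := gr_compP parP u.
rewrite (act_suml vm) (act_suml vm').
elim: s => [|i s IH]; rewrite ?big_nil // !big_cons fD IH (hom i) //.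
exact: gr_comp_gr.
Qed.

End Modules.

Lemma prodX_vac s (n : nat) t : prod n%:Z (X s) (X t) = bracket K N (s, n%:Z) (t, -1) *: vac F.
Proof.
have := mode_bracket selfF s t n%:Z (-1) (vac F).
by rewrite va_create va_create0 (act0r selfF) addr0.
Qed.

(** These modes kill the vacuum and anticommute with the creation modes that generate [F] from
    it. *)
Lemma prodX_small s (k : nat) v : (k < N)%N -> prod k%:Z (X s) v = 0.
Proof.
move=> kN; move: v; apply: (@ff_strong _ _ F) => [c u v hu hv||t n v hv].
- by rewrite (va_lin_r k%:Z (X s)) hu hv scaler0 addr0.
- exact: va_create0.
have := mode_bracket selfF s t k%:Z (- n.+1%:Z) v.
rewrite hv (act0r selfF) addr0 => ->.
have -> : bracket K N (s, k%:Z) (t, - n.+1%:Z) = 0.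
  by case: s t {hv} => [] [] //=; case: eqP => //; lia.
by rewrite scale0r.
Qed.

(** The parity involution. It supplies the sign with which an odd endomorphism passes an odd field,
    since [M0] carries no parity of its own. *)
Definition sigma (u : F) : F :=
  gr_comp (va_parP F).1 u false - gr_comp (va_parP F).1 u true.

Lemma sigma_par a u : par a u -> sigma u = (-1) ^+ a *: u.
Proof.
move=> pu; rewrite /sigma !(gr_compE _ (decomposes_hom (gr0 (va_parP F).1) pu)).
by case: a {pu}; rewrite ?scale1r ?scaleN1r ?subr0 ?sub0r.
Qed.

Lemma sigmaD u v : sigma (u + v) = sigma u + sigma v.
Proof. by rewrite /sigma !gr_compD opprD addrACA. Qed.

Lemma sigma0 : sigma 0 = 0.
Proof. by apply: (addIr (sigma 0)); rewrite -sigmaD !add0r. Qed.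

Lemma par_ind (P : F -> Prop) : (forall a u, par a u -> P u) ->
  (forall u v, P u -> P v -> P (u + v)) -> forall u, P u.
Proof.
move=> Pp PD u; apply: (gr_ind (grP := (va_parP F).1)) => //.
  by apply: (Pp false); apply: gr0; case: (va_parP F).
by move=> a; apply: (Pp a); apply: gr_comp_gr.
Qed.

Lemma sigmaZ c u : sigma (c *: u) = c *: sigma u.
Proof.
elim/par_ind: u => [a u pu|u v hu hv]; last by rewrite scalerDr !sigmaD hu hv -scalerDr.
have pcu : par a (c *: u) by case: (va_parP F) => _; apply.
by rewrite (sigma_par pcu) (sigma_par pu) !scalerA mulrC.
Qed.

Lemma sigma_vac : sigma (vac F) = vac F.
Proof. by rewrite (sigma_par (va_par_vac F)) scale1r. Qed.

Lemma sigma_prod a n u v : par a u -> sigma (prod n u v) = (-1) ^+ a *: prod n u (sigma v).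
Proof.
move=> pu; elim/par_ind: v => [b v pv|v w hv hw].
  rewrite (sigma_par pv) (sigma_par (va_par_prod n pu pv)) (actZr selfF) scalerA.
  by rewrite -signr_addb.
by rewrite (actDr selfF) !sigmaD hv hw (actDr selfF) scalerDr.
Qed.

(** Parity and charge are separate data on [F]; they are compatible because both are determined on
    monomials in the generators. By strong generation [sigma] commutes with the charge
    projections. *)
Lemma sigma_gr i u : ff_gr i u -> ff_gr i (sigma u).
Proof.
have [grP grZ] := ff_grP F; pose comp := gr_comp grP.
suff h : forall u i, comp (sigma u) i = sigma (comp u i).
  move=> hu; have <- : comp (sigma u) i = sigma u
    by rewrite h /comp gr_comp_hom.
  exact: gr_comp_gr.
move=> {i u}; apply: (@ff_strong _ _ F) => [c u v hu hv i|i|s n v hv i].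
- have compZ w : comp (c *: w) i = c *: comp w i.
    apply: (@gr_comp_map _ _ _ _ _ _ (fun x => c *: x) id id) => //.
    + by move=> x y; rewrite scalerDr.
    + by rewrite scaler0.
    + by move=> *; apply: grZ.
  rewrite sigmaD sigmaZ [comp (_ + sigma v) i]gr_compD [comp (_ + v) i]gr_compD.
  by rewrite -!/(comp _ i) !compZ hu hv sigmaD sigmaZ.
- rewrite sigma_vac /comp (gr_compE grP (decomposes_hom (gr0 grP) (ff_gr_vac F))).
  by case: eqP; rewrite ?sigma_vac ?sigma0.
have compX w : comp (prod (- n.+1%:Z) (X s) w) i =
    prod (- n.+1%:Z) (X s) (comp w (i - charge s)).
  apply: (@gr_comp_map _ _ _ _ _ _ (prod (- n.+1%:Z) (X s))
           (fun i => i + charge s) (fun i => i - charge s)) => //.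
  + by move=> x y; apply: (actDr selfF).
  + exact: (act0r selfF).
  + by move=> x; rewrite addrK.
  + by move=> x; rewrite subrK.
  + by move=> j x hx; rewrite addrC; apply: ff_gr_prod => //; apply: ff_grX.
have sX w : sigma (prod (- n.+1%:Z) (X s) w) = - prod (- n.+1%:Z) (X s) (sigma w).
  by rewrite (sigma_prod _ _ (ffX_odd F s)) expr1 scaleN1r.
rewrite compX !sX -hv -compX; apply: (@gr_comp_map _ _ _ _ _ _ -%R id id) => //.
- by move=> x y; rewrite opprD.
- by rewrite oppr0.
- by move=> *; apply: grN.
Qed.

End FreeField.
(** * Twisting a module by an odd endomorphism *)

Section Twist.
Variables (K : fieldType) (N : nat) (F : freeFieldAlgebra K N).
Hypothesis charK : [pchar K] =i pred0.
Local Notation X := (ffX F).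
Local Notation prod := (@va_prod K F).
Local Notation par := (@va_par K F).
Local Notation selfF := (va_self_module F).
Variables (s : bool) (k : int).

(* [f^(N+p) / (N+p)!] is [twist_coef p z^(-k-1-p)] for an N-fold
   antiderivative f of [N! z^(-k-1)]. *)
Definition twist_coef (p : nat) : K :=
  (N`!)%:R * (\prod_(j < p) (- k - 1 - j%:Z))%:~R / ((N + p)`!)%:R.

Definition lowering (p : nat) (u : F) : F := prod (N + p)%N%:Z (X (~~ s)) u.

Lemma twist_coef0 : twist_coef 0 = 1.
Proof. by rewrite /twist_coef big_ord0 addn0 mulr1 divff // fact_neq0. Qed.

(** Both sides are the coefficient of the [j]-th divided derivative of [f^(N+q)(z) / (N+q)!],
    computed from [f^(N+q+j)] on the left and from the power [z^(-k-1-q)] on the right. *)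
Lemma twist_coefM q j : twist_coef (q + j) * zbinom K (N + (q + j))%N%:Z (N + q) =
  twist_coef q * zbinom K (- k - 1 - q%:Z) j.
Proof.
have -> : (N + (q + j) = j + (N + q))%N by lia.
rewrite zbinom_fact // /twist_coef /zbinom big_split_ord /= rmorphM /=.
have -> : (N + (q + j) = j + (N + q))%N by lia.
have -> : \prod_(i < j) (- k - 1 - (q + i)%N%:Z) = \prod_(i < j) (- k - 1 - q%:Z - i%:Z).
  by apply: eq_bigr => i _; rewrite PoszD opprD addrA.
by field; rewrite !fact_neq0.
Qed.

Lemma lowering_par a p u : par a u -> par (~~ a) (lowering p u).
Proof. exact: par_prodX. Qed.

Lemma lowering0 p : lowering p 0 = 0.
Proof. exact: (act0r selfF). Qed.

Lemma lowering_lin p : linear (lowering p).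
Proof. exact: va_lin_r. Qed.

Lemma lowering_bound u : exists L : nat, forall p, (L <= p)%N -> lowering p u = 0.
Proof.
have [n0 h] := va_trunc (X (~~ s)) u.
by have [L hL] := int_bound N%:Z h; exists L => p /hL; rewrite -PoszD.
Qed.

(** A chosen truncation that turns [twist_term] into a finite sum; [twist_termE] replaces it by any
    other valid bound. *)
Definition lowering_rank u : nat := sval (cid (lowering_bound u)).

Lemma lowering_rankP u p : (lowering_rank u <= p)%N -> lowering p u = 0.
Proof. exact: (svalP (cid (lowering_bound u))). Qed.

(** The commutator formula for [X_(N+p)] and [u_(n)]: terms of index below [N] vanish by
    [prodX_small], those above [N + p] because their binomial does. *)
Lemma lowering_prod a p n u v : par a u ->
  lowering p (prod n u v) = (-1) ^+ a *: prod n u (lowering p v) +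
    \sum_(q < p.+1) zbinom K (N + p)%N%:Z (N + q) *:
      prod (n + (p - q)%N%:Z) (lowering q u) v.
Proof.
move=> pu; elim/par_ind: v => [b v pv|v w hv hw]; last first.
  have lD x y : lowering p (x + y) = lowering p x + lowering p y := actDr selfF _ _ _ _.
  rewrite (actDr selfF) lD hv hw lD (actDr selfF) scalerDr addrACA; congr (_ + _).
  by rewrite -big_split /=; apply: eq_bigr => i _; rewrite (actDr selfF) scalerDr.
have [L hL] := vm_commutator selfF v (N + p)%N%:Z n (ffX_odd F (~~ s)) pu.
have := hL (maxn L (N + p.+1)) (leq_maxl _ _).
rewrite andTb -!/(lowering p _) => /eqP; rewrite subr_eq addrC => /eqP ->; congr (_ + _).
pose f i := zbinom K (N + p)%N%:Z i *:
  prod ((N + p)%N%:Z + n - i%:Z) (prod i%:Z (X (~~ s)) u) v.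
rewrite (@sum_vanish _ (N + p.+1) _ f) ?leq_maxr //; last first.
  by move=> i Ni; rewrite /f zbinom_nat_small ?scale0r //; lia.
rewrite big_split_ord /= big1 ?add0r => [|i _]; last first.
  by rewrite /f prodX_small ?(act0l selfF) ?scaler0.
apply: eq_bigr => q _; rewrite /f; congr (_ *: prod _ _ _).
by have := ltn_ord q; lia.
Qed.

Section TwistedModule.
Variables (M : lmodType K) (act : int -> F -> M -> M) (xi : M -> M).
Hypothesis vm : is_vertex_module act.
Hypothesis xi_lin : linear xi.
Hypothesis xi_act : forall a n u m, par a u -> xi (act n u m) = (-1) ^+ a *: act n u (xi m).
Hypothesis xi_sq : forall m, xi (xi m) = 0.

(** The coefficient of [z^(-n-1)] in [Y(G(z) u, z)]. *)
Definition twist_term (n : int) (u : F) (m : M) : M :=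
  \sum_(p < lowering_rank u) twist_coef p *: act (n - k - 1 - p%:Z) (lowering p u) m.

Definition twist (n : int) (u : F) (m : M) : M := act n u m + xi (twist_term n u m).

Lemma xiD x y : xi (x + y) = xi x + xi y.
Proof. by have := xi_lin 1 x y; rewrite !scale1r. Qed.
Lemma xi0 : xi 0 = 0.
Proof. by apply: (addIr (xi 0)); rewrite -xiD !add0r. Qed.
Lemma xiZ c x : xi (c *: x) = c *: xi x.
Proof. by rewrite -[c *: x]addr0 xi_lin xi0 addr0. Qed.
Lemma xiN x : xi (- x) = - xi x.
Proof. by rewrite -scaleN1r xiZ scaleN1r. Qed.
Lemma xi_sum n (f : 'I_n -> M) : xi (\sum_(i < n) f i) = \sum_(i < n) xi (f i).
Proof.
elim: n f => [|n IH] f; first by rewrite !big_ord0 xi0.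
by rewrite !big_ord_recl xiD IH.
Qed.

Lemma twist_termE l n u m : (forall p, (l <= p)%N -> lowering p u = 0) ->
  twist_term n u m = \sum_(p < l) twist_coef p *: act (n - k - 1 - p%:Z) (lowering p u) m.
Proof.
move=> h; pose f p := twist_coef p *: act (n - k - 1 - p%:Z) (lowering p u) m.
have fz L : (forall p, (L <= p)%N -> lowering p u = 0) -> forall p, (L <= p)%N -> f p = 0.
  by move=> hL p /hL E; rewrite /f E act0l ?scaler0.
rewrite -(@sum_vanish _ l (maxn l (lowering_rank u)) f) ?leq_maxl //; last exact: fz.
rewrite (@sum_vanish _ (lowering_rank u) _ f) ?leq_maxr //.
by apply: fz => p; apply: lowering_rankP.
Qed.

Lemma twist_term_linr n u : linear (twist_term n u).
Proof.
move=> c x y; rewrite /twist_term scaler_sumr -big_split /=; apply: eq_bigr => p _.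
by rewrite (vm_lin_r vm) scalerDr !scalerA mulrC.
Qed.

Lemma twist_term_linl n m : linear (fun u => twist_term n u m).
Proof.
move=> c u v; pose L := maxn (lowering_rank u) (lowering_rank v).
have hu p : (L <= p)%N -> lowering p u = 0.
  by rewrite geq_max => /andP[/lowering_rankP].
have hv p : (L <= p)%N -> lowering p v = 0.
  by rewrite geq_max => /andP[_ /lowering_rankP].
have huv p : (L <= p)%N -> lowering p (c *: u + v) = 0.
  by move=> h; rewrite lowering_lin hu // hv // scaler0 addr0.
rewrite (twist_termE _ _ hu) (twist_termE _ _ hv) (twist_termE _ _ huv).
rewrite scaler_sumr -big_split /=; apply: eq_bigr => p _.
by rewrite lowering_lin (vm_lin_l vm) scalerDr !scalerA mulrC.
Qed.

Lemma twist_term_xi a n u m : par a u ->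
  xi (twist_term n u m) = (-1) ^+ (~~ a) *: twist_term n u (xi m).
Proof.
move=> pu; rewrite /twist_term xi_sum scaler_sumr; apply: eq_bigr => p _.
by rewrite xiZ (xi_act _ _ (lowering_par p pu)) !scalerA mulrC.
Qed.

(** The product of the two [xi]-terms disappears because [xi] can be moved next to the other [xi].
    The sign [(-1) ^+ a] is the cost of pulling [xi] to the left of [act n u]. *)
Lemma twist_comp a b n n' u v m : par a u -> par b v ->
  twist n u (twist n' v m) = act n u (act n' v m) +
    xi ((-1) ^+ a *: act n u (twist_term n' v m) + twist_term n u (act n' v m)).
Proof.
move=> pu pv; rewrite /twist (actDr vm) -addrA; congr (_ + _).
rewrite xiD xiZ (xi_act _ _ pu) scalerA -signr_addb addbb scale1r; congr (_ + _).
have := twist_term_linr n u 1 (act n' v m) (xi (twist_term n' v m)); rewrite !scale1r => ->.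
rewrite xiD (twist_term_xi n (xi _) pu) xi_sq.
have -> : twist_term n u 0 = 0.
  by rewrite /twist_term big1 // => p _; rewrite act0r ?scaler0.
by rewrite scaler0 addr0.
Qed.

(* The coefficient of [xi] in the Borcherds identity for [twist].  The right-hand
   side is a combination over q of the Borcherds identities for
   (X_(N+q) u, v) and (u, X_(N+q) v); the left-hand sides are compared by moving
   X_(N+p) past u_(n) in F and applying Vandermonde's identity. *)
Lemma twist_borcherds_first a b u v m P Q R : par a u -> par b v ->
  exists L : nat, forall l : nat, (L <= l)%N ->
  \sum_(i < l) zbinom K P i *: twist_term (P + Q - i%:Z) (prod (R + i%:Z) u v) m =
  \sum_(i < l) ((-1) ^+ i * zbinom K R i) *:
    (((-1) ^+ a *: act (P + R - i%:Z) u (twist_term (Q + i%:Z) v m)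
       + twist_term (P + R - i%:Z) u (act (Q + i%:Z) v m))
     - ((-1) ^ R * (-1) ^+ (a && b)) *:
       ((-1) ^+ b *: act (Q + R - i%:Z) v (twist_term (P + i%:Z) u m)
       + twist_term (Q + R - i%:Z) v (act (P + i%:Z) u m))).
Proof.
move=> pu pv.
(* Beyond [n2] both lowerings vanish; [n0] and [n1'] cut off products in [F], [n3] the lowerings of
   such products, and [L1], [L2] serve the Borcherds identities for the finitely many [q < n2]. *)
pose n2 := maxn (lowering_rank u) (lowering_rank v).
have lu p : (n2 <= p)%N -> lowering p u = 0.
  by rewrite geq_max => /andP[/lowering_rankP].
have lv p : (n2 <= p)%N -> lowering p v = 0.
  by rewrite geq_max => /andP[_ /lowering_rankP].
have trunc_bound w x : exists n : nat, forall i : nat, (n <= i)%N -> prod (R + i%:Z) w x = 0.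
  by have [n0 h] := va_trunc w x; apply: (int_bound R h).
have [n0 hn0] := trunc_bound u v.
have [n1' hn1] := uniform_bound (fun q => trunc_bound (lowering q u) v) n2.
have [n3 hn3] : exists n, forall i p, (i < n0)%N -> (n <= p)%N ->
    lowering p (prod (R + i%:Z) u v) = 0.
  exact: (uniform_bound (fun i => lowering_bound (prod (R + i%:Z) u v)) n0).
have [L1 hL1] := uniform_bound
  (fun q => vm_borcherds vm m (P - k - 1 - q%:Z) Q R (lowering_par q pu) pv) n2.
have [L2 hL2] := uniform_bound
  (fun q => vm_borcherds vm m P (Q - k - 1 - q%:Z) R pu (lowering_par q pv)) n2.
exists (n0 + n1' + n2 + n3 + L1 + L2)%N => l hl.
have sgn : ((-1) ^+ a * (-1) ^+ a = 1 :> K) by rewrite -signr_addb addbb.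
(* The summand that [lowering_prod] produces for [p = q + j], with its coefficient rewritten by
   [twist_coefM]. *)
pose T i j q := (zbinom K P i * (twist_coef q * zbinom K (- k - 1 - q%:Z) j)) *:
  act (P + Q - (i + j)%N%:Z - k - 1 - q%:Z) (prod (R + (i + j)%N%:Z) (lowering q u) v) m.
have lhsE : \sum_(i < l) zbinom K P i *: twist_term (P + Q - i%:Z) (prod (R + i%:Z) u v) m =
    (-1) ^+ a *: (\sum_(q < n2) twist_coef q *: \sum_(i < l) zbinom K P i *:
       act (P + (Q - k - 1 - q%:Z) - i%:Z) (prod (R + i%:Z) u (lowering q v)) m)
    + \sum_(q < n2) twist_coef q *: \sum_(i < l) zbinom K (P - k - 1 - q%:Z) i *:
       act (P - k - 1 - q%:Z + Q - i%:Z) (prod (R + i%:Z) (lowering q u) v) m.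
  transitivity (\sum_(i < l) (\sum_(p < l) ((-1) ^+ a * (zbinom K P i * twist_coef p)) *:
       act (P + (Q - k - 1 - p%:Z) - i%:Z) (prod (R + i%:Z) u (lowering p v)) m
     + \sum_(p < l) \sum_(q < p.+1) T i (p - q)%N q)).
    apply: eq_bigr => i _; rewrite (@twist_termE l); last first.
      have [il p pl|il p pl] := ltnP i n0; first by apply: (hn3 i) => //; lia.
      by rewrite hn0 // lowering0.
    rewrite scaler_sumr -big_split /=; apply: eq_bigr => p _.
    rewrite (lowering_prod _ _ _ pu) (actDl vm) scalerDr scalerDr.
    congr (_ + _).
      by rewrite (actZl vm) !scalerA; congr (_ *: act _ _ _); [ring | lia].
    rewrite (act_suml vm) !scaler_sumr; apply: eq_bigr => q _.
    have qp : (q <= p)%N by rewrite -ltnS.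
    rewrite (actZl vm) !scalerA /T -twist_coefM subnKC // mulrA.
    by congr (_ *: act _ (prod _ _ _) _); lia.
  rewrite big_split /=; congr (_ + _).
    rewrite scaler_sumr exchange_big /=.
    rewrite (@sum_vanish _ n2 _ (fun p => \sum_(i < l) ((-1) ^+ a * (zbinom K P i * twist_coef p)) *:
      act (P + (Q - k - 1 - p%:Z) - i%:Z) (prod (R + i%:Z) u (lowering p v)) m)); last by lia.
      apply: eq_bigr => q _; rewrite !scaler_sumr; apply: eq_bigr => i _.
      by rewrite !scalerA; congr (_ *: _); ring.
    by move=> p hp; apply: big1 => i _; rewrite lv // (act0r selfF) (act0l vm) scaler0.
  (* The sum over [q <= p < l] becomes a sum over [q] and [j = p - q]. *)
  transitivity (\sum_(q < l) \sum_(i < l) \sum_(j < l - q) T i j q).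
    rewrite [RHS]exchange_big /=; apply: eq_bigr => i _.
    exact: (esym (sum_triangle l (fun q j => T i j q))).
  rewrite (@sum_vanish _ n2 _ (fun q => \sum_(i < l) \sum_(j < l - q) T i j q)); last by lia.
    apply: eq_bigr => q _; rewrite scaler_sumr.
    (* For fixed [q] the vector depends only on [t = i + j], so the binomials can be summed along
       [i + j = t]: a Vandermonde convolution with upper entries [P] and [- k - 1 - q]. *)
    rewrite (@sum_box _ n1' l (l - q) (fun i j => T i j q)); first last.
    - by move=> i j h; rewrite /T hn1 // (act0l vm) scaler0.
    - by have := ltn_ord q; lia.
    - by lia.
    rewrite -(@sum_vanish _ n1' l (fun t => \sum_(i < t.+1) T i (t - i)%N q)); first last.
    - by lia.
    - move=> t ht; apply: big1 => i _; have it : (i <= t)%N by rewrite -ltnS.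
      by rewrite /T subnKC // hn1 // (act0l vm) scaler0.
    apply: eq_bigr => t _.
    have -> : P - k - 1 - q%:Z = P + (- k - 1 - q%:Z) by ring.
    rewrite (zbinom_vandermonde charK) scalerA mulr_sumr scaler_suml.
    apply: eq_bigr => i _; have it : (i <= t)%N by rewrite -ltnS.
    rewrite /T subnKC //; congr (_ *: act _ _ _); first by ring.
    by ring.
  move=> q hq; apply: big1 => i _; apply: big1 => j _.
  by rewrite /T lu // (act0l selfF) (act0l vm) scaler0.
rewrite {}lhsE.
have -> : \sum_(q < n2) twist_coef q *: \sum_(i < l) zbinom K P i *:
       act (P + (Q - k - 1 - q%:Z) - i%:Z) (prod (R + i%:Z) u (lowering q v)) m =
   \sum_(i < l) ((-1) ^+ i * zbinom K R i) *: (act (P + R - i%:Z) u (twist_term (Q + i%:Z) v m)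
      - ((-1) ^ R * (-1) ^+ (a && ~~ b)) *: twist_term (Q + R - i%:Z) v (act (P + i%:Z) u m)).
  have Ll : (L2 <= l)%N by lia.
  under eq_bigr => q _ do rewrite (hL2 q l (ltn_ord q) Ll) scaler_sumr.
  rewrite exchange_big; apply: eq_bigr => i _ /=.
  rewrite !(twist_termE _ _ lv) (act_sumr vm) !scaler_sumr -sumrB scaler_sumr.
  apply: eq_bigr => q _; rewrite (actZr vm) !scalerBr !scalerA.
  congr (_ - _).
    by congr (_ *: act _ _ (act _ _ _)); [ring | ring].
  by congr (_ *: act _ _ _); ring.
have -> : \sum_(q < n2) twist_coef q *: \sum_(i < l) zbinom K (P - k - 1 - q%:Z) i *:
       act (P - k - 1 - q%:Z + Q - i%:Z) (prod (R + i%:Z) (lowering q u) v) m =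
   \sum_(i < l) ((-1) ^+ i * zbinom K R i) *: (twist_term (P + R - i%:Z) u (act (Q + i%:Z) v m)
      - ((-1) ^ R * (-1) ^+ (~~ a && b)) *: act (Q + R - i%:Z) v (twist_term (P + i%:Z) u m)).
  have Ll : (L1 <= l)%N by lia.
  under eq_bigr => q _ do rewrite (hL1 q l (ltn_ord q) Ll) scaler_sumr.
  rewrite exchange_big; apply: eq_bigr => i _ /=.
  rewrite !(twist_termE _ _ lu) (act_sumr vm) !scaler_sumr -sumrB scaler_sumr.
  apply: eq_bigr => q _; rewrite (actZr vm) !scalerBr !scalerA.
  congr (_ - _).
    by congr (_ *: act _ _ _); ring.
  by congr (_ *: act _ _ (act _ _ _)); ring.
rewrite scaler_sumr -big_split /=; apply: eq_bigr => i _.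
have swap x y (z : M) : x *: (y *: z) = y *: (x *: z) by rewrite !scalerA mulrC.
rewrite swap -scalerDr; congr (_ *: _).
rewrite scalerBr scalerDr addrACA -opprD; congr (_ - _).
(* Modulo 2 the exponents agree: [a + a (1 - b) = a b] and [(1 - a) b = a b + b]. *)
rewrite addrC !scalerA; congr (_ *: _ + _ *: _).
  by case: (a); case: (b); rewrite /= ?expr0 ?expr1; ring.
by case: (a); case: (b); rewrite /= ?expr0 ?expr1; ring.
Qed.

Lemma twist_module : is_vertex_module twist.
Proof.
split.
- move=> n m c u v; rewrite /twist (vm_lin_l vm) (twist_term_linl n m c u v) xi_lin.
  by rewrite scalerDr addrACA.
- move=> n u c x y; rewrite /twist (vm_lin_r vm) (twist_term_linr n u c x y) xi_lin.
  by rewrite scalerDr addrACA.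
- move=> u m; have [n0 hn0] := vm_trunc vm u m.
  have [n1 hn1] : exists n1 : nat, forall p i, (p < lowering_rank u)%N -> (n1 <= i)%N ->
      act (i%:Z - k - 1 - p%:Z) (lowering p u) m = 0.
    apply: uniform_bound => p; have [a ha] := vm_trunc vm (lowering p u) m.
    have [L hL] := int_bound (- k - 1 - p%:Z) ha; exists L => i /hL <-.
    by congr act; ring.
  exists (Order.max n0 n1%:Z) => n; rewrite ge_max => /andP[h0 h1].
  rewrite /twist hn0 // /twist_term big1 ?xi0 ?addr0 // => p _.
  have -> : n = `|n|%N%:Z by lia.
  by rewrite hn1 ?scaler0 //; lia.
- move=> n m; rewrite /twist (vm_vac vm) (@twist_termE 0) ?big_ord0 ?xi0 ?addr0 //.
  by move=> p _; rewrite /lowering va_create0.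
move=> a b u v m P Q R pu pv.
have [L hL] := vm_borcherds vm m P Q R pu pv.
have [L' hL'] := twist_borcherds_first m P Q R pu pv.
exists (maxn L L') => l; rewrite geq_max => /andP[/hL h /hL' h'].
(* The identity separates into the one for [act] and the image under [xi] of
   [twist_borcherds_first]. *)
have -> : \sum_(i < l) zbinom K P i *: twist (P + Q - i%:Z) (prod (R + i%:Z) u v) m =
    \sum_(i < l) zbinom K P i *: act (P + Q - i%:Z) (prod (R + i%:Z) u v) m +
    xi (\sum_(i < l) zbinom K P i *: twist_term (P + Q - i%:Z) (prod (R + i%:Z) u v) m).
  by rewrite xi_sum -big_split /=; apply: eq_bigr => i _; rewrite /twist scalerDr xiZ.
rewrite h h' xi_sum -big_split /=; apply: eq_bigr => i _.
rewrite (twist_comp _ _ _ pu pv) (twist_comp _ _ _ pv pu) xiZ -scalerDr; congr (_ *: _).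
by rewrite [xi (_ - _)]xiD xiN [xi (_ *: (_ + _))]xiZ scalerDr opprD addrACA.
Qed.

(** [lowering p (X t)] is a multiple of the vacuum, nonzero only for [p = 0] and [t = s], and the
    vacuum acts nontrivially only through its mode -1, that is for [n = k]. *)
Lemma twist_mode n t m : twist n (X t) m = act n (X t) m +
  (if (t, n) == (s, k) then bracket K N (~~ s, N%:Z) (s, -1) *: xi m else 0).
Proof.
have low p : lowering p (X t) = bracket K N (~~ s, (N + p)%N%:Z) (t, -1) *: vac F.
  exact: prodX_vac.
have low0 p : (1 <= p)%N -> lowering p (X t) = 0.
  move=> p1; rewrite low; suff -> : bracket K N (~~ s, (N + p)%N%:Z) (t, -1) = 0.
    by rewrite scale0r.
  by case: s t {low} => [] [] //=; case: eqP => //; lia.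
rewrite /twist; congr (_ + _); rewrite (twist_termE _ _ low0) big_ord1.
rewrite twist_coef0 scale1r low addn0 (actZl vm) xiZ (vm_vac vm) subr0.
have -> : (n - k - 1 == -1) = (n == k) by apply/eqP/eqP; lia.
rewrite xpair_eqE; case: (n =P k) => _; rewrite ?andbT ?andbF ?xi0 ?scaler0 //.
have [->//|ts] := eqVneq t s.
suff -> : bracket K N (~~ s, N%:Z) (t, -1) = 0 by rewrite scale0r.
by case: s t ts {low low0} => [] [].
Qed.

(** Endomorphisms anticommuting with [xi] still supercommute with the twisted action; this is what
    permits a further twist. *)
Lemma twist_supercomm (eta : M -> M) : linear eta ->
  (forall a n u m, par a u -> eta (act n u m) = (-1) ^+ a *: act n u (eta m)) ->
  (forall m, eta (xi m) = - xi (eta m)) ->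
  forall a n u m, par a u -> eta (twist n u m) = (-1) ^+ a *: twist n u (eta m).
Proof.
move=> eta_lin eta_act anti a n u m pu.
have etaD x y : eta (x + y) = eta x + eta y by have := eta_lin 1 x y; rewrite !scale1r.
have eta0 : eta 0 = 0 by apply: (addIr (eta 0)); rewrite -etaD !add0r.
have etaZ c x : eta (c *: x) = c *: eta x by rewrite -[c *: x]addr0 eta_lin eta0 addr0.
rewrite /twist etaD (eta_act _ _ _ _ pu) scalerDr anti -xiZ -scaleN1r -xiZ; congr (_ + xi _).
rewrite /twist_term (big_morph eta etaD eta0) !scaler_sumr; apply: eq_bigr => p _.
rewrite etaZ (eta_act _ _ _ _ (lowering_par p pu)) !scalerA; congr (_ *: _).
by case: (a); rewrite /= ?expr0 ?expr1; ring.
Qed.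

Lemma twist_gr (gr : int -> M -> Prop) : is_vgrading gr ->
  (forall a i n u m, ff_gr a u -> gr i m -> gr (i + a) (act n u m)) ->
  (forall i m, gr i m -> gr (i + charge s) (xi m)) ->
  forall a i n u m, ff_gr a u -> gr i m -> gr (i + a) (twist n u m).
Proof.
move=> [grP grZ] gr_act gr_xi a i n u m ua mi.
apply: (grD grP); first exact: gr_act.
(* The lowering contributes the charge of [~~ s] and [xi] that of [s], and these cancel. *)
have -> : i + a = i + (a + charge (~~ s)) + charge s.
  by case: (s) => /=; ring.
apply: gr_xi; apply: (gr_sum grP) => p _; apply: grZ; apply: gr_act => //.
by rewrite addrC; apply: ff_gr_prod => //; apply: ff_grX.
Qed.

End TwistedModule.

End Twist.
(** * The Fock module of a graded Z(g_N)-module *)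

Lemma inj_surj_bijective (A B : Type) (f : A -> B) : injective f ->
  (forall b, exists a, f a = b) -> bijective f.
Proof.
move=> fI fS; have [g gK] := choice fS.
by exists g => // a; apply: fI; rewrite gK.
Qed.

Lemma ord_bound d (P : 'I_d -> nat -> Prop) :
  (forall j, exists n, forall i, (n <= i)%N -> P j i) ->
  exists n, forall j i, (n <= i)%N -> P j i.
Proof.
move=> /choice[g hg]; exists (\max_j g j) => j i h; apply: hg.
exact: leq_trans (leq_bigmax j) h.
Qed.

Definition zconst_scalars (K : fieldType) (I : Type) (b : I -> I -> K)
    (M : lmodType (enveloping b)) : lmodType K :=
  restrict_scalars (uconst b : {rmorphism K -> enveloping b}) M.

Section HomogeneousBasis.
Variables (K : fieldType) (M : lmodType K) (I : eqType) (gr : I -> M -> Prop).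
Hypothesis grP : is_grading gr.

Lemma homogeneous_span (s : seq M) : exists t,
  (forall y, y \in t -> exists i, gr i y) /\ forall x, x \in s -> kspan t x.
Proof.
elim: s => [|x s [t [tgr ts]]]; first by exists [::].
have [cgr [u [_ _ E]]] := gr_compP grP x.
exists (map (gr_comp grP x) u ++ t); split=> y.
  rewrite mem_cat => /orP[/mapP[i _ ->]|/tgr //]; first by exists i.
rewrite inE => /predU1P[->|/ts]; last first.
  by apply: kspan_subset => z zt; rewrite mem_cat zt orbT.
rewrite {2}E big_seq; apply: (big_ind (kspan _)); first exact: kspan0.
  by move=> *; apply: kspanD.
by move=> i iu; apply: kspan_mem; rewrite mem_cat map_f.
Qed.

Lemma homogeneous_basis (s : seq M) : (forall m, kspan s m) ->
  exists (d : nat) (e : 'I_d -> M) (deg : 'I_d -> I) (x : 'I_d -> M -> K),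
    [/\ forall i, gr (deg i) (e i), forall m, m = \sum_i x i m *: e i &
        forall c i, x i (\sum_j c j *: e j) = c i].
Proof.
move=> ss; have [t [tgr ts]] := homogeneous_span s.
have tt m : kspan t m by apply: kspan_sub (ss m).
have [d [e [x [et xe xc]]]] := kspan_coords tt.
have [deg hdeg] := choice (fun i => tgr _ (et i)).
by exists d, e, deg, x.
Qed.

End HomogeneousBasis.

Section Power.
Variables (K : fieldType) (N : nat) (F : freeFieldAlgebra K N) (d : nat).
Local Notation X := (ffX F).
Local Notation prod := (@va_prod K F).
Local Notation par := (@va_par K F).
Local Notation selfF := (va_self_module F).
Local Notation Fd := {ffun 'I_d -> F}.

Definition power_act (n : int) (u : F) (f : Fd) : Fd := [ffun j => prod n u (f j)].

Lemma power_module : is_vertex_module power_act.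
Proof.
split.
- by move=> n f c u v; apply/ffunP => j; rewrite !ffunE (vm_lin_l selfF).
- by move=> n u c f g; apply/ffunP => j; rewrite !ffunE (vm_lin_r selfF).
- move=> u f; have [L hL] : exists L, forall j (i : nat), (L <= i)%N -> prod i%:Z u (f j) = 0.
    apply: ord_bound => j; have [n0 h] := va_trunc u (f j).
    by have [L hL] := int_bound 0 h; exists L => i /hL; rewrite add0r.
  by exists L%:Z => -[] n // Ln; apply/ffunP => j; rewrite !ffunE hL.
- move=> n f; apply/ffunP => j; rewrite !ffunE (vm_vac selfF).
  by case: eqP; rewrite ?ffunE.
move=> a b u v f p q r pu pv.
have [L hL] := ord_bound (fun j => va_borcherds (f j) p q r pu pv).
exists L => l /hL h; apply/ffunP => j; rewrite !sum_ffunE.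
under eq_bigr do rewrite !ffunE.
by rewrite h; apply: eq_bigr => i _; rewrite !ffunE.
Qed.

Definition single (j : 'I_d) (u : F) : Fd := [ffun i => if i == j then u else 0].

Lemma singleD j u v : single j (u + v) = single j u + single j v.
Proof. by apply/ffunP => i; rewrite !ffunE; case: eqP; rewrite ?addr0. Qed.

Lemma single0 j : single j 0 = 0.
Proof. by apply/ffunP => i; rewrite !ffunE if_same. Qed.

Lemma single_lin j : linear (single j).
Proof.
by move=> c u v; apply/ffunP => i; rewrite !ffunE; case: eqP; rewrite ?scaler0 ?addr0.
Qed.

Lemma power_act_single n u j v : power_act n u (single j v) = single j (prod n u v).
Proof. by apply/ffunP => i; rewrite !ffunE; case: eqP => // _; rewrite (act0r selfF). Qed.

Lemma single_sum (f : Fd) : f = \sum_j single j (f j).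
Proof.
apply/ffunP => i; rewrite sum_ffunE (bigD1 i) //= ffunE eqxx big1 ?addr0 // => j.
by rewrite eq_sym ffunE => /negbTE ->.
Qed.

Variable deg : 'I_d -> int.

(** The [j]-th copy of [F] stands for [F] tensored with a basis vector of degree [deg j]. *)
Definition power_gr (i : int) (f : Fd) : Prop := forall j, ff_gr (i - deg j) (f j).

Lemma power_grP : is_vgrading power_gr.
Proof.
have [grP grZ] := ff_grP F.
have g0 i : power_gr i 0 by move=> j; rewrite ffunE; apply: gr0.
have gD i f g : power_gr i f -> power_gr i g -> power_gr i (f + g).
  by move=> hf hg j; rewrite ffunE; apply: (grD grP).
split; last by move=> i c f hf j; rewrite ffunE; apply: grZ.
split=> //.
- by move=> i f g hf hg j; rewrite !ffunE; apply: (grB grP).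
- move=> f; have [c [cgr [s [_ _ E]]]] : exists c, decomposes power_gr c f.
    rewrite [f]single_sum; apply: (big_ind (fun f => exists c, decomposes power_gr c f)).
    + by exists (fun=> 0); apply: decomposes0.
    + by move=> x y [c hc] [c' hc']; exists (c \+ c'); apply: decomposesD.
    move=> j _; eexists; apply: (@decomposes_map _ _ _ _ _ power_gr (single j)
      (fun i => i + deg j) (fun i => i - deg j) (singleD j) (single0 j) _ _ _ _ _
      (gr_compP grP (f j))).
    + by move=> i; rewrite addrK.
    + by move=> i; rewrite subrK.
    move=> i u hu k; rewrite ffunE; case: eqP => [->|_]; first by rewrite addrK.
    exact: gr0.
  by exists s, c.
move=> s f us fgr E i si; apply/ffunP => j; rewrite ffunE.
have E' : \sum_(i <- s) f i j = 0.
  by move/ffunP/(_ j): E; rewrite sum_ffunE ffunE.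
have usm : uniq (map (fun i => i - deg j) s).
  by rewrite map_inj_uniq // => x y /addIr.
have := gr_direct grP (s := map (fun i => i - deg j) s)
  (f := fun i => f (i + deg j) j) usm.
rewrite big_map; under eq_bigr do rewrite subrK.
move=> /(_ _ E' (i - deg j)); rewrite subrK; apply; last exact: map_f.
by move=> k; have := fgr (k + deg j) j; rewrite addrK.
Qed.

Lemma power_gr_act a i n u f : ff_gr a u -> power_gr i f -> power_gr (i + a) (power_act n u f).
Proof.
move=> ua hf j; rewrite ffunE; have -> : i + a - deg j = a + (i - deg j) by ring.
exact: ff_gr_prod.
Qed.

End Power.

(** * Twisting once for each zero mode *)

Section IteratedTwist.
Variables (K : fieldType) (N : nat) (F : freeFieldAlgebra K N).
Hypothesis charK : [pchar K] =i pred0.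
Local Notation X := (ffX F).
Variables (M : lmodType K) (act0 : int -> F -> M -> M) (gr : int -> M -> Prop).
Variable xi : mode -> M -> M.
Hypothesis vm0 : is_vertex_module act0.
Hypothesis xi_lin : forall x, linear (xi x).
Hypothesis xi_act : forall x a n u m, va_par a u ->
  xi x (act0 n u m) = (-1) ^+ a *: act0 n u (xi x m).
Hypothesis xi_anti : forall x y m, xi x (xi y m) = - xi y (xi x m).
Hypothesis xi_sq : forall x m, xi x (xi x m) = 0.
Hypothesis grP : is_vgrading gr.
Hypothesis gr_act0 : forall a i n u m, ff_gr a u -> gr i m -> gr (i + a) (act0 n u m).
Hypothesis gr_xi : forall x i m, gr i m -> gr (i + charge x.1) (xi x m).

(** Equal to binom(N, N) = 1 for [s = false] and to binom(-1, N) = (-1)^N for [s = true]. *)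
Definition twist_sign (s : bool) : K := bracket K N (~~ s, N%:Z) (s, -1).

Lemma twist_sign_neq0 s : twist_sign s != 0.
Proof.
case: s; rewrite /twist_sign /= ifT ?(zbinom_neg_neq0 charK 0) ?zbinom_nat_neq0 //.
Qed.

(** The invariant retains every [xi x], including those already used: each anticommutes with the
    others and with itself, so it supercommutes with all intermediate actions. As [l] has no
    duplicates, each mode is shifted once. *)
Lemma iterated_twist (l : seq mode) : uniq l -> exists act : int -> F -> M -> M,
  [/\ is_vertex_module act,
      forall x a n u m, va_par a u -> xi x (act n u m) = (-1) ^+ a *: act n u (xi x m),
      forall a i n u m, ff_gr a u -> gr i m -> gr (i + a) (act n u m) &
      forall n t m, act n (X t) m = act0 n (X t) m +
        (if (t, n) \in l then twist_sign t *: xi (t, n) m else 0)].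
Proof.
elim: l => [|[s k] l IH] /=.
  by exists act0; split=> // n t m; rewrite addr0.
move=> /andP[skl /IH[act [vm xia gra modea]]]; exists (twist s k act (xi (s, k))).
split.
- by apply: twist_module => // *; apply: xia.
- move=> x a n u m pu; by apply: twist_supercomm => // *; apply: xia.
- by move=> *; apply: twist_gr => // *; apply: (@gr_xi (s, k)).
move=> n t m; rewrite (twist_mode charK s k vm) // modea -addrA; congr (_ + _).
rewrite inE; have [[-> ->]|_] := eqVneq (t, n) (s, k); last by rewrite addr0.
by rewrite (negbTE skl) add0r.
Qed.

End IteratedTwist.

(** * F-modules as smooth modules over the enveloping algebra *)

Section ModulesOverUg.
Variables (K : fieldType) (N : nat) (F : freeFieldAlgebra K N).

Lemma mode_act_lin (M : fgModule F) (x : mode) : linear (mode_act (M := M) x).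
Proof. exact: vm_lin_r (fg_module M) _ _. Qed.

Lemma mode_act_bracket (M : fgModule F) (x y : mode) (m : M) :
  mode_act x (mode_act y m) + mode_act y (mode_act x m) = bracket K N x y *: m.
Proof. by case: x y => [s p] [t q]; apply: (mode_bracket (fg_module M)). Qed.

Definition Umod (M : fgModule F) : lmodType (Ug K N) :=
  env_module (@mode_act_lin M) (@mode_act_bracket M).

Lemma Umod_gen (M : fgModule F) x (m : M) : Ugen K N x *: (m : Umod M) = mode_act x m.
Proof. exact: env_module_gen. Qed.

Lemma Umod_const (M : fgModule F) c (m : M) : Uconst N c *: (m : Umod M) = c *: m.
Proof. exact: env_module_const. Qed.

Lemma Umod_smooth (M : fgModule F) : smooth (Umod M).
Proof.
move=> s m; have [n0 h] := vm_trunc (fg_module M) (ffX F s) m.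
by exists n0 => n hn; rewrite Umod_gen /mode_act h.
Qed.

Lemma Umod_singular (M : fgModule F) (m : M) : singular (m : Umod M) <-> Omega m.
Proof. by split=> h x hx; have := h x hx; rewrite Umod_gen. Qed.

Lemma Umod_gr (M : fgModule F) a u i (m : M) : Udegree a u -> fg_gr i m ->
  fg_gr (i + a) (u *: (m : Umod M) : M).
Proof.
have [grP grZ] := fg_grP M.
move=> du; elim: du i m => [b|c|x|b u1 u2 _ h1 _ h2|b b' u1 u2 _ h1 _ h2] i m him.
- by rewrite scale0r; apply: (gr0 grP).
- by rewrite addr0 [_ *: _]Umod_const; apply: grZ.
- by rewrite [_ *: _]Umod_gen; apply: fg_gr_act => //; apply: ff_grX.
- by rewrite scalerDl; apply: (grD grP); [apply: h1 | apply: h2].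
- by rewrite -scalerA [b + b']addrC addrA; apply/h1/h2.
Qed.

End ModulesOverUg.

(** * Homogeneous decompositions in the induced module *)

Section InducedGrading.
Variables (K : fieldType) (N : nat) (M0 : fdModule K N).

Lemma induced_gr0 i : induced_gr i (0 : induced M0).
Proof. by exists [::]; rewrite big_nil. Qed.

Lemma induced_grD i (t t' : induced M0) :
  induced_gr i t -> induced_gr i t' -> induced_gr i (t + t').
Proof.
move=> [s [hs ->]] [s' [hs' ->]]; exists (s ++ s'); rewrite big_cat; split=> // a u m.
by rewrite mem_cat => /orP[/hs|/hs'].
Qed.

Lemma induced_gr_tensor a i u (m : M0) : Udegree a u -> fd_gr (i - a) m ->
  induced_gr i (itensor u m).
Proof.
move=> du dm; exists [:: (a, u, m)]; rewrite big_seq1; split=> // a' u' m'.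
by rewrite inE => /eqP[-> -> ->].
Qed.

Lemma induced_gr_ind (P : int -> induced M0 -> Prop) : (forall i, P i 0) ->
  (forall i t t', P i t -> P i t' -> P i (t + t')) ->
  (forall a i u m, Udegree a u -> fd_gr (i - a) m -> P i (itensor u m)) ->
  forall i t, induced_gr i t -> P i t.
Proof.
move=> P0 PD Pt i t [s [hs ->]]; elim: s hs => [|[[a u] m] s IH] hs.
  by rewrite big_nil.
rewrite big_cons; apply: PD; last first.
  by apply: IH => b v n bvn; apply: hs; rewrite inE bvn orbT.
by have [du dm] := hs a u m (mem_head _ _); apply: Pt dm.
Qed.

Lemma induced_grZ a i u (t : induced M0) : Udegree a u -> induced_gr i t ->
  induced_gr (i + a) (u *: t).
Proof.
move=> du; elim/induced_gr_ind: {t i}_ / => [i|i t t' h h'|b i v m dv dm].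
- by rewrite scaler0; apply: induced_gr0.
- by rewrite scalerDr; apply: induced_grD.
rewrite itensorZ; apply: (induced_gr_tensor (a := a + b)); first exact: udegreeM.
by have -> : i + a - (a + b) = i - b by ring.
Qed.

Lemma induced_decomposes (t : induced M0) :
  exists c, decomposes (@induced_gr K N M0) c t.
Proof.
elim: (neg_span_pure t) => {t} [_ [m ->]|x y _ [c hc] _ [c' hc']|c m _ [f hf]|y m _ _ [f hf]].
- eexists; apply: (@decomposes_map _ _ _ _ _ (@induced_gr K N M0) (fun m => itensor 1 m) id id
    _ _ _ _ _ _ _ (gr_compP (fd_grP M0) m)) => //.
  + by move=> x y; rewrite itensorDr.
  + by apply: (addIr (itensor 1 0)); rewrite -itensorDr !add0r.
  + move=> i n hn; apply: (induced_gr_tensor (a := 0)); last by rewrite subr0.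
    exact: udegree_const.
- by exists (c \+ c'); apply: decomposesD => // *; apply: induced_grD.
- eexists; apply: (@decomposes_map _ _ _ _ _ (@induced_gr K N M0) (fun t => Uconst N c *: t) id id
    _ _ _ _ _ _ _ hf) => //.
  + by move=> x y; rewrite scalerDr.
  + by rewrite scaler0.
  + by move=> i n hn; rewrite -(addr0 i); apply: induced_grZ hn; apply: udegree_const.
eexists; apply: (@decomposes_map _ _ _ _ _ (@induced_gr K N M0) (fun t => Ugen K N y *: t)
  (fun i => i + charge y.1) (fun i => i - charge y.1) _ _ _ _ _ _ _ hf).
- by move=> u v; rewrite scalerDr.
- by rewrite scaler0.
- by move=> i; rewrite addrK.
- by move=> i; rewrite subrK.
- by move=> i n hn; apply: induced_grZ hn; apply: (udegree_gen _ (fun x : mode => charge x.1)).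
Qed.

End InducedGrading.

(** * Realization of the induced module as a twisted tensor product *)

Section Fock.
Variables (K : fieldType) (N : nat) (F : freeFieldAlgebra K N).
Hypothesis charK : [pchar K] =i pred0.
Local Notation X := (ffX F).

(** Extended by 0 to all modes, so that the endomorphisms built from it can be indexed by [mode] as
    [iterated_twist] requires. *)
Definition zero_mode (x : mode) : Zg K N :=
  if (insub x : option (modeZ N)) is Some z then Zgen K z else 0.

Lemma zero_mode_anticomm x y : zero_mode x * zero_mode y = - (zero_mode y * zero_mode x).
Proof.
rewrite /zero_mode; case: insub => [u|]; last by rewrite mul0r mulr0 oppr0.
by case: insub => [v|]; [exact: Zgen_anticomm | rewrite mul0r mulr0 oppr0].
Qed.

Lemma zero_mode_sq x : zero_mode x * zero_mode x = 0.
Proof.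
rewrite /zero_mode; case: insub => [u|]; last by rewrite mul0r.
exact: (ugen_sq (b := fun _ _ : modeZ N => 0 : K) charK).
Qed.

Definition zero_modes : seq mode :=
  [seq (s, i%:Z) | s <- [:: true; false], i <- iota 0 N].

Lemma zero_modesP (x : mode) : (x \in zero_modes) = (0 <= x.2 < N%:Z).
Proof.
apply/allpairsPdep/idP => [[s [i [_ iN ->]]] /=|].
  by move: iN; rewrite mem_iota; lia.
case: x => s [] //= k kN; exists s, k; split=> //; first by case: s.
by rewrite mem_iota.
Qed.

Lemma zero_modes_uniq : uniq zero_modes.
Proof.
apply: allpairs_uniq => //; first exact: iota_uniq.
by move=> [s i] [t j] _ _ /= [-> ->].
Qed.

Variable M0 : fdModule K N.
Local Notation Mk := (zconst_scalars M0).

Lemma fd_kspan : exists s : seq Mk, forall m, kspan s m.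
Proof. by have [s hs] := fd_finite M0; exists s => m; apply/kspanE/hs. Qed.

(** The last clause is the embedding of [M0] into its induced module, visible only in a concrete
    model. Together with [singular_pure] it identifies [M0] with the singular vectors. *)
Lemma fock_module : exists (M : fgModule F) (theta : induced M0 -> M),
  [/\ bijective theta,
      forall t t', theta (t + t') = theta t + theta t',
      forall c t, theta (Uconst N c *: t) = c *: theta t,
      forall x t, theta (Ugen K N x *: t) = mode_act x (theta t) &
      (forall i t, induced_gr i t <-> fg_gr i (theta t)) /\
      forall m : M0, theta (itensor 1 m) = 0 -> m = 0].
Proof.
have [s hs] := fd_kspan.
have grMk : @is_grading _ Mk (@fd_gr K N M0) := fd_grP M0.
have [d [e [deg [co [edeg coE coK]]]]] := homogeneous_basis grMk hs.
have ZcZ c u (m : Mk) : (u : Zg K N) *: ((c *: m : Mk) : M0) = c *: (u *: (m : M0) : Mk) :> Mk.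
  by rewrite -[c *: (_ : Mk)]/(Zconst N c *: _ : M0) scalerA -uconst_comm -scalerA.
have coS d' (c : 'I_d' -> K) (f : 'I_d' -> Mk) i :
    co i (\sum_l c l *: f l) = \sum_l c l * co i (f l).
  rewrite -[RHS](coK (fun i => \sum_l c l * co i (f l)) i); congr (co i _).
  under [RHS]eq_bigr do rewrite scaler_suml.
  rewrite exchange_big; apply: eq_bigr => l _ /=; rewrite {1}[f l]coE scaler_sumr.
  by apply: eq_bigr => j _; rewrite scalerA.
have coD i (m n : Mk) : co i (m + n) = co i m + co i n.
  by have := coS 2 (fun=> 1) (fun l => if l == ord0 then m else n) i;
    rewrite !big_ord_recl !big_ord0 /= !scale1r !mul1r !addr0.
have coZ i c (m : Mk) : co i (c *: m) = c * co i m.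
  by have := coS 1 (fun=> c) (fun=> m) i; rewrite !big_ord1.
have co0 i : co i 0 = 0 by rewrite -[0 in LHS](scale0r (0 : Mk)) coZ mul0r.
pose A (x : mode) i j : K := (twist_sign K N x.1)^-1 * co i (zero_mode x *: (e j : M0)).
have AM x y i l : \sum_j A x i j * A y j l =
   (twist_sign K N x.1)^-1 * (twist_sign K N y.1)^-1 *
   co i (zero_mode x * zero_mode y *: (e l : M0)).
  rewrite -scalerA [zero_mode y *: _](coE (zero_mode y *: (e l : M0) : Mk)).
  have -> : zero_mode x *: (\sum_j co j (zero_mode y *: (e l : M0)) *: e j : M0) =
    \sum_j co j (zero_mode y *: (e l : M0)) *: (zero_mode x *: (e j : M0) : Mk) :> Mk.
    rewrite (big_morph _ (scalerDr (zero_mode x)) (scaler0 _ _)).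
    by apply: eq_bigr => j _; rewrite ZcZ.
  rewrite coS mulr_sumr; apply: eq_bigr => j _; rewrite /A.
  by rewrite mulrACA [co i _ * co j _]mulrC.
(* {ffun 'I_d -> F} stands for the tensor product of F and M0 through the basis
   e, and [xi x] for the parity of F tensored with a multiple of the zero mode x
   of M0; the multiple compensates the factor by which [twist] shifts X^s_(k). *)
pose xi x (f : {ffun 'I_d -> F}) : {ffun 'I_d -> F} :=
  [ffun i => \sum_j A x i j *: sigma (f j)].
have sigma_sum (g : 'I_d -> F) : sigma (\sum_j g j) = \sum_j sigma (g j).
  exact: (big_morph _ (@sigmaD _ _ F) (sigma0 F)).
have xixi x y f i : xi x (xi y f) i = \sum_l (\sum_j A x i j * A y j l) *: sigma (sigma (f l)).
  rewrite ffunE; under eq_bigr do rewrite ffunE sigma_sum scaler_sumr.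
  rewrite exchange_big; apply: eq_bigr => l _ /=; rewrite scaler_suml.
  by apply: eq_bigr => j _; rewrite sigmaZ scalerA.
have coN i (m : Mk) : co i (- m) = - co i m by rewrite -scaleN1r coZ mulN1r.
have xi_anti x y f : xi x (xi y f) = - xi y (xi x f).
  apply/ffunP => i; rewrite [RHS]ffunE !xixi -sumrN; apply: eq_bigr => l _.
  have E : co i (zero_mode x * zero_mode y *: (e l : M0)) =
      - co i (zero_mode y * zero_mode x *: (e l : M0)).
    by rewrite zero_mode_anticomm scaleNr; apply: coN.
  by rewrite -scaleNr !AM E mulrN [_^-1 * _^-1]mulrC.
have xi_sq x f : xi x (xi x f) = 0.
  apply/ffunP => i; rewrite xixi ffunE big1 // => l _.
  by rewrite AM zero_mode_sq scale0r co0 mulr0 scale0r.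
have xi_lin x : linear (xi x).
  move=> c f g; apply/ffunP => i; rewrite !ffunE scaler_sumr -big_split /=.
  apply: eq_bigr => j _; rewrite !ffunE sigmaD sigmaZ scalerDr !scalerA.
  by rewrite [c * _]mulrC.
have xi_act x a n u f : va_par a u ->
    xi x (power_act n u f) = (-1) ^+ a *: power_act n u (xi x f).
  move=> pu; apply/ffunP => i; rewrite !ffunE (act_sumr (va_self_module F)) scaler_sumr.
  apply: eq_bigr => j _; rewrite ffunE (sigma_prod _ _ pu) (actZr (va_self_module F)).
  by rewrite !scalerA mulrC.
have [grP grZ] := ff_grP F.
(* A vector of degree [i] equals its own [i]-th component, and in a homogeneous basis this keeps
   only the [e k] with [deg k = i]. *)
have co_gr i j (m : Mk) : fd_gr i m -> deg j != i -> co j m = 0.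
  move=> mi dji; have mE := coE m.
  have comp_e k l : gr_comp grMk (co k m *: e k) l =
      if l == deg k then co k m *: e k else 0.
    have h : fd_gr (deg k) (co k m *: e k : Mk).
      rewrite -[deg k]addr0; apply: (fd_gr_act (u := Zconst N (co k m)) _ (edeg k)).
      exact: udegree_const.
    by rewrite (gr_compE grMk (decomposes_hom (gr0 grMk) h)).
  have := gr_comp_hom grMk mi.
  have compS l : gr_comp grMk m l =
      \sum_k if l == deg k then co k m *: e k else 0.
    rewrite {1}mE (big_morph (fun n : Mk => gr_comp grMk n l)
      (id1 := 0) (op1 := +%R)); first by apply: eq_bigr => k _; rewrite comp_e.
    - by move=> x y; rewrite (gr_compD grMk).
    - exact: (gr_compE grMk (decomposes0 (gr0 grMk))).
  rewrite compS => /(congr1 (co j)) <-.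
  have -> : \sum_k (if i == deg k then co k m *: e k else 0) =
      \sum_k (if i == deg k then co k m else 0) *: e k :> Mk.
    by apply: eq_bigr => k _; case: eqP; rewrite ?scale0r.
  by rewrite coK eq_sym (negbTE dji).
have xi_gr x i f : power_gr deg i f -> power_gr deg (i + charge x.1) (xi x f).
  move=> hf j; rewrite ffunE; apply: (gr_sum grP) => k _.
  have [E|ne] := eqVneq (deg j) (deg k + charge x.1).
    apply: grZ; apply: sigma_gr; rewrite E.
    by have -> : i + charge x.1 - (deg k + charge x.1) = i - deg k by ring.
  rewrite /A (co_gr (deg k + charge x.1)) ?mulr0 ?scale0r //; first exact: (gr0 grP).
  rewrite /zero_mode; case: insubP => [z _ zx|_].
    rewrite -zx; apply: fd_gr_act (edeg k).
    exact: (udegree_gen _ (fun x : modeZ N => charge (val x).1)).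
  by rewrite scale0r; apply: (gr0 (fd_grP M0)).
have [act [vm _ act_gr act_mode]] := iterated_twist charK (power_module F d) xi_lin
  xi_act xi_anti xi_sq (power_grP F deg) (fun a i n u f => @power_gr_act _ _ _ _ deg a i n u f)
  xi_gr zero_modes_uniq.
(* The twists alter only the modes with [0 <= n < N]; the creation modes act as on [F] and still
   generate everything from the vacua of the [d] copies. *)
have span_single (P : {ffun 'I_d -> F} -> Prop) :
    (forall c x y, P x -> P y -> P (c *: x + y)) ->
    (forall t n f, P f -> P (act n (X t) f)) ->
    (forall j, P (single j (vac F))) -> P 0 -> forall f, P f.
  move=> Plin Pact Pvac P0 f; rewrite [f]single_sum; apply: big_ind => //.
    by move=> x y hx hy; rewrite -[x]scale1r; apply: Plin.
  move=> j _; move: (f j); apply: (@ff_strong _ _ F) => [c u v hu hv|//|t n v hv].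
    by rewrite single_lin; apply: Plin.
  rewrite -power_act_single; have := Pact t (- n.+1%:Z) _ hv.
  by rewrite act_mode zero_modesP /= addr0.
have fin : exists r : seq {ffun 'I_d -> F}, forall P : {ffun 'I_d -> F} -> Prop,
    (forall (c : K) x y, P x -> P y -> P (c *: x + y)) ->
    (forall n u x, P x -> P (act n u x)) ->
    (forall x, x \in r -> P x) -> forall x, P x.
  exists (0 :: [seq single j (vac F) | j <- enum 'I_d]) => P Plin Pact Pr.
  apply: span_single => [//|t n x|j|]; first exact: Pact.
    by apply: Pr; rewrite in_cons; apply/orP; right; apply/mapP; exists j; rewrite ?mem_enum.
  by apply: Pr; apply: mem_head.
pose M := FgModule vm (power_grP F deg) act_gr fin.
pose f (m : M0) : Umod M := [ffun j => co j m *: vac F].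
have act_vac x n m : 0 <= n -> act n (X x) (f m) =
    (if (x, n) \in zero_modes then twist_sign K N x *: xi (x, n) (f m) else 0).
  move=> n0; rewrite act_mode; have -> : power_act n (X x) (f m) = 0; last by rewrite add0r.
  apply/ffunP => j; rewrite !ffunE (actZr (va_self_module F)).
  by case: n n0 => // n _; rewrite va_create0 scaler0.
have fD x y : f (x + y) = f x + f y.
  by apply/ffunP => j; rewrite !ffunE coD scalerDl.
have fc c m : f (Zconst N c *: m) = Uconst N c *: f m.
  by rewrite [RHS]Umod_const; apply/ffunP => j; rewrite !ffunE (coZ j c) scalerA.
have fg (x : modeZ N) m : f (Zgen K x *: m) = Ugen K N (val x) *: f m.
  have /andP[x0 xN] := valP x.
  rewrite [RHS]Umod_gen /mode_act [RHS]act_vac // zero_modesP /= x0 xN.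
  apply/ffunP => i; rewrite !ffunE scaler_sumr.
  have zx : zero_mode (val x) = Zgen K x by rewrite /zero_mode valK.
  have -> : Zgen K x *: m = \sum_j co j m *: (zero_mode (val x) *: (e j : M0) : Mk) :> Mk.
    rewrite -zx {1}[m]coE (big_morph _ (scalerDr (zero_mode (val x))) (scaler0 _ _)).
    by apply: eq_bigr => j _; rewrite ZcZ.
  rewrite coS scaler_suml; apply: eq_bigr => j _.
  rewrite ffunE sigmaZ sigma_vac !scalerA /A -surjective_pairing.
  by rewrite mulVKf ?twist_sign_neq0 // mulrC.
have fp (x : mode) m : N%:Z <= x.2 -> Ugen K N x *: f m = 0.
  move=> xN; rewrite [LHS]Umod_gen /mode_act [LHS]act_vac; last by apply: le_trans xN.
  by rewrite zero_modesP /= ltNge xN andbF.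
pose theta : induced M0 -> Umod M := ind_ext f.
have thD : forall t t', theta (t + t') = theta t + theta t'.
  by move=> *; apply: ind_extD.
have thZ : forall u t, theta (u *: t) = u *: theta t.
  by move=> *; apply: ind_extZ.
have thT : forall u m, theta (itensor u m) = u *: f m.
  by move=> *; apply: ind_ext_tensor.
have th0 : theta 0 = 0 by apply: ind_ext0.
have vac0 : (vac F == 0) = false by apply/eqP; apply: ff_nonzero.
have f_inj m : f m = 0 -> m = 0.
  move=> fm; rewrite [m]coE big1 // => j _; have /ffunP/(_ j) := fm.
  rewrite !ffunE => /eqP; rewrite scaler_eq0 vac0 orbF.
  by move=> /eqP ->; rewrite scale0r.
(* Only singular vectors need testing; they have the form [itensor 1 m], on which [theta] is [f],
   injective because the vacuum is nonzero. *)
have th_inj : injective theta.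
  apply: (smooth_inj charK _ thD thZ); first exact: induced_smooth.
  move=> t /(singular_pure charK)[m ->].
  by rewrite thT scale1r => /f_inj ->; apply: (addIr (itensor 1 0)); rewrite -itensorDr !add0r.
have th_surj (y : M) : exists t, theta t = y.
  apply: (span_single (fun y => exists t, theta t = y)).
  - move=> c _ _ [t <-] [t' <-]; exists (Uconst N c *: t + t').
    by rewrite thD thZ [_ *: _]Umod_const.
  - move=> t n _ [u <-]; exists (Ugen K N (t, n) *: u).
    by rewrite thZ [_ *: _]Umod_gen.
  - move=> j; exists (itensor 1 (e j)); rewrite thT scale1r; apply/ffunP => i.
    (* [coK] at Kronecker coefficients computes the coordinates of [e j]. *)
    rewrite !ffunE; have := coK (fun l => (l == j)%:R) i.
    rewrite (bigD1 j) //= eqxx scale1r big1 ?addr0 => [->|k /negbTE ->]; last by rewrite scale0r.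
    by case: eqP; rewrite ?scale1r ?scale0r.
  - by exists 0.
have th_gr i t : induced_gr i t -> fg_gr i (theta t : M).
  elim/induced_gr_ind: {i t}_ / => [i|i t t' h h'|a i u m du dm].
  - by rewrite th0; apply: (gr0 (power_grP F deg).1).
  - by rewrite thD; apply: (grD (power_grP F deg).1).
  rewrite thT -(subrK a i); apply: Umod_gr => // j; rewrite ffunE.
  have [->|ne] := eqVneq (deg j) (i - a).
    by rewrite subrr; apply: grZ; apply: ff_gr_vac.
  by rewrite (co_gr _ _ _ dm) // scale0r; apply: (gr0 grP).
exists M, theta; split=> //.
- exact: inj_surj_bijective.
- by move=> c t; rewrite thZ [LHS]Umod_const.
- by move=> x t; rewrite thZ [LHS]Umod_gen.
split=> [i t|m]; last by rewrite thT scale1r => /f_inj.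
split; first exact: th_gr.
apply: (gr_reflect thD _ th_inj th_gr (fg_grP M).1); last exact: induced_decomposes.
- exact: th0.
- exact: induced_gr0.
Qed.

End Fock.
(** * Transfer of abelianness along an equivalence *)

Section IsoLemmas.
Variable C : category.

Lemma naturally_isomorphic_sym (D : category) (F G : functor C D) :
  naturally_isomorphic F G -> naturally_isomorphic G F.
Proof.
move=> [eta [iso nat]]; have [inv hinv] : exists inv : forall A, Hom (G A) (F A),
    forall A, inv A \c eta A = idm _ /\ eta A \c inv A = idm _.
  by exists (fun A => sval (cid (iso A))) => A; apply: (svalP (cid (iso A))).
exists inv; split=> [A|A B f].
  by have [h h'] := hinv A; exists (eta A).
have [hA hA'] := hinv A; have [hB hB'] := hinv B.
by rewrite -[LHS]compm1 -hA' compmA -(compmA _ (fmap G f)) -nat compmA hB comp1m.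
Qed.

Lemma zero_object_iso (Z Z' : C) (i : Hom Z Z') : is_iso i -> is_zero_object Z ->
  is_zero_object Z'.
Proof.
move=> [j [ji ij]] zZ A; have [[f [_ uf]] [g [_ ug]]] := zZ A; split.
  exists (i \c f); split=> // f' _; rewrite -[f']comp1m -ij -compmA; congr (_ \c _).
  exact: uf.
exists (g \c j); split=> // g' _; rewrite -[g']compm1 -ij compmA; congr (_ \c _).
exact: ug.
Qed.

Lemma zero_objects_iso (Z Z' : C) : is_zero_object Z -> is_zero_object Z' ->
  exists i : Hom Z Z', is_iso i.
Proof.
move=> zZ zZ'; have [_ [i _]] := zZ Z'; have [_ [j _]] := zZ' Z.
have [[x [_ u]] _] := zZ Z; have [[y [_ u']] _] := zZ' Z'.
by exists i, j; split; [exact: etrans (esym (u _ I)) (u _ I) | exact: etrans (esym (u' _ I)) (u' _ I)].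
Qed.

Lemma zero_morphism_compl (A B D : C) (f : Hom A B) (g : Hom B D) :
  is_zero_morphism f -> is_zero_morphism (g \c f).
Proof. by move=> [Z [u [v [zZ ->]]]]; exists Z, u, (g \c v); rewrite compmA. Qed.

Lemma zero_morphism_compr (A B D : C) (f : Hom A B) (g : Hom B D) :
  is_zero_morphism g -> is_zero_morphism (g \c f).
Proof. by move=> [Z [u [v [zZ ->]]]]; exists Z, (u \c f), v; rewrite compmA. Qed.

End IsoLemmas.

Definition op_cat (C : category) : category :=
  {| Ob := C; Hom := fun A B => @Hom C B A; idm := @idm C;
     compm := fun A B D g f => f \c g;
     compm1 := fun A B f => comp1m f; comp1m := fun A B f => compm1 f;
     compmA := fun A B D E h g f => esym (compmA f g h) |}.

(** One axiom from each dual pair of [is_abelian], together with the self-dual one on zero objects.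
    Transferring this half for a category and for its opposite gives all of them. *)
Record half_abelian (C : category) : Prop := HalfAbelian {
  half_zero : exists Z : C, is_zero_object Z;
  half_prod : forall A B : C,
    exists (P : C) (p : Hom P A) (q : Hom P B), is_product p q;
  half_ker : forall (A B : C) (f : Hom A B),
    exists (K : C) (k : Hom K A), is_kernel f k;
  half_mono : forall (A B : C) (f : Hom A B), is_mono f ->
    exists (X : C) (g : Hom B X), is_kernel g f }.

Lemma op_zero_object (C : category) (Z : C) :
  @is_zero_object (op_cat C) Z <-> is_zero_object Z.
Proof. by split=> h A; have [h1 h2] := h A; split. Qed.

Lemma op_zero_morphism (C : category) (A B : C) (f : Hom A B) :
  @is_zero_morphism (op_cat C) B A f <-> is_zero_morphism f.
Proof.
by split=> -[Z [g [h [/op_zero_object zZ E]]]]; exists Z, h, g; split=> //;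
  apply/op_zero_object.
Qed.

Lemma op_kernel (C : category) (A B Q : C) (f : Hom A B) (q : Hom B Q) :
  @is_kernel (op_cat C) B A Q f q <-> is_cokernel f q.
Proof.
split=> -[z u]; split.
- exact/op_zero_morphism.
- by move=> X g /op_zero_morphism zg; apply: u.
- exact/op_zero_morphism.
- by move=> X g /op_zero_morphism zg; apply: u.
Qed.

Lemma abelian_half (C : category) : is_abelian C -> half_abelian C.
Proof. by case. Qed.

Lemma abelian_op_half (C : category) : is_abelian C -> half_abelian (op_cat C).
Proof.
move=> ab; split.
- by have [Z zZ] := ab_zero ab; exists Z; apply/op_zero_object.
- by move=> A B; have [P [i [j h]]] := ab_coprod ab A B; exists P, i, j.
- by move=> A B f; have [Q [q h]] := ab_coker ab f; exists Q, q; apply/op_kernel.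
- by move=> A B f h; have [X [g k]] := ab_epi ab h; exists X, g; apply/op_kernel.
Qed.

Lemma half_abelianP (C : category) : half_abelian C -> half_abelian (op_cat C) ->
  is_abelian C.
Proof.
move=> ab ab'; split.
- exact: half_zero ab.
- exact: half_prod ab.
- by move=> A B; have [P [i [j h]]] := half_prod ab' A B; exists P, i, j.
- exact: half_ker ab.
- by move=> A B f; have [Q [q /op_kernel h]] := @half_ker _ ab' B A f; exists Q, q.
- exact: half_mono ab.
- by move=> A B f h; have [X [g /op_kernel k]] := @half_mono _ ab' B A f h; exists X, g.
Qed.

Section Transfer.
Variables (C D : category) (F : functor C D).
Hypothesis full : forall A B (h : Hom (F A) (F B)), exists f : Hom A B, fmap F f = h.
Hypothesis faithful : forall A B (f g : Hom A B), fmap F f = fmap F g -> f = g.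
Hypothesis ess_surj : forall Y : D, exists (A : C) (i : Hom (F A) Y), is_iso i.

Lemma reflect_zero_object (Z : C) : is_zero_object (F Z) -> is_zero_object Z.
Proof.
move=> zZ A; have [[f [_ uf]] [g [_ ug]]] := zZ (F A).
have [f' Ef] := full f; have [g' Eg] := full g.
split; [exists f' | exists g']; split=> // h _; apply: faithful.
  by rewrite Ef; apply: uf.
by rewrite Eg; apply: ug.
Qed.

Hypothesis halfD : half_abelian D.

Lemma transfer_zero : exists Z : C, is_zero_object Z /\ is_zero_object (F Z).
Proof.
have [Z zZ] := half_zero halfD; have [A [i [j [ji ij]]]] := ess_surj Z.
have zFA : is_zero_object (F A) by apply: (@zero_object_iso _ Z _ j) => //; exists i.
by exists A; split=> //; apply: reflect_zero_object.
Qed.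

Lemma preserve_zero_object (Z : C) : is_zero_object Z -> is_zero_object (F Z).
Proof.
move=> zZ; have [Z' [zZ' zFZ']] := transfer_zero.
have [i [j [ji ij]]] := zero_objects_iso zZ' zZ.
apply: (@zero_object_iso _ (F Z') _ (fmap F i)) => //.
by exists (fmap F j); rewrite -!fmapM ji ij !fmap1.
Qed.

(** A zero morphism factors through some zero object of [D], perhaps not of the form [F Z]; the
    factorization is rerouted through an isomorphic [F Z'] before fullness lifts it. *)
Lemma zero_morphism_functor A B (f : Hom A B) :
  is_zero_morphism (fmap F f) <-> is_zero_morphism f.
Proof.
split=> [[Z [g [h [zZ E]]]]|[Z [g [h [zZ ->]]]]]; last first.
  exists (F Z), (fmap F g), (fmap F h); rewrite fmapM; split=> //.
  exact: preserve_zero_object.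
have [Z' [zZ' zFZ']] := transfer_zero.
have [i [j [ji ij]]] := zero_objects_iso zZ zFZ'.
have [g' Eg] := full (i \c g); have [h' Eh] := full (h \c j).
exists Z', g', h'; split=> //; apply: faithful.
by rewrite fmapM Eg Eh compmA -(compmA h) ji compm1.
Qed.

Lemma transfer_half : half_abelian C.
Proof.
split.
- by have [Z [zZ _]] := transfer_zero; exists Z.
- move=> A B; have [P [p [q h]]] := half_prod halfD (F A) (F B).
  have [P' [i [j [ji ij]]]] := ess_surj P.
  have [p' Ep] := full (p \c i); have [q' Eq] := full (q \c i).
  exists P', p', q' => X f g; have [u [[uf ug] uu]] := h _ (fmap F f) (fmap F g).
  have [u' Eu] := full (j \c u); exists u'; split.
    split; apply: faithful; rewrite fmapM ?Ep ?Eq Eu compmA -(compmA _ i j) ij compm1.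
      exact: uf.
    exact: ug.
  move=> v [vf vg]; apply: faithful; rewrite Eu (uu (i \c fmap F v)).
    by rewrite compmA ji comp1m.
  by rewrite !compmA -Ep -Eq -!fmapM vf vg.
- move=> A B f; have [k0 [k [zk h]]] := half_ker halfD (fmap F f).
  have [K' [i [j [ji ij]]]] := ess_surj k0.
  have [k' Ek] := full (k \c i).
  exists K', k'; split=> [|X g zg].
    apply/zero_morphism_functor; rewrite fmapM Ek compmA.
    exact: zero_morphism_compr.
  have [|u [ug uu]] := h _ (fmap F g).
    by rewrite -fmapM; apply/zero_morphism_functor.
  have [u' Eu] := full (j \c u); exists u'; split.
    by apply: faithful; rewrite fmapM Ek Eu compmA -(compmA k) ij compm1.
  move=> v vg; apply: faithful; rewrite Eu (uu (i \c fmap F v)).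
    by rewrite compmA ji comp1m.
  by rewrite compmA -Ek -fmapM vg.
move=> A B f mf; have mFf : is_mono (fmap F f).
  move=> Y g h E; have [X [i [j [ji ij]]]] := ess_surj Y.
  have [g' Eg] := full (g \c i); have [h' Eh] := full (h \c i).
  have /mf gh : f \c g' = f \c h' by apply: faithful; rewrite !fmapM Eg Eh !compmA E.
  by rewrite -[g]compm1 -[h]compm1 -ij !compmA -Eg -Eh gh.
have [Y [g [zg h]]] := half_mono halfD mFf.
have [X [i [j [ji ij]]]] := ess_surj Y; have [g' Eg] := full (j \c g).
exists X, g'; split=> [|W u zu].
  apply/zero_morphism_functor; rewrite fmapM Eg -compmA.
  exact: zero_morphism_compl.
have [|v [vu uv]] := h _ (fmap F u).
  move/zero_morphism_functor: zu; rewrite fmapM Eg => /(zero_morphism_compl i).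
  by rewrite !compmA ij comp1m.
have [v' Ev] := full v; exists v'; split; first by apply: faithful; rewrite fmapM Ev.
by move=> w wu; apply: faithful; rewrite Ev; apply: uv; rewrite -fmapM wu.
Qed.

End Transfer.

Lemma inverse_faithful (C D : category) (F : functor C D) (G : functor D C) :
  naturally_isomorphic (functor_comp G F) (functor_id C) ->
  forall A B (f g : Hom A B), fmap F f = fmap F g -> f = g.
Proof.
move=> [eta [iso nat]] A B f g E; have [j [ji ij]] := iso A.
have nf := nat A B f; have ng := nat A B g; rewrite /= E in nf; rewrite /= in ng.
by rewrite -[f]compm1 -[g]compm1 -ij !compmA -nf -ng.
Qed.

Lemma abelian_transfer (C D : category) (F : functor C D) (G : functor D C) :
  mutually_inverse F G -> is_abelian D -> is_abelian C.
Proof.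
move=> [GF FG] abD; have fthF := inverse_faithful GF; have fthG := inverse_faithful FG.
have fullF A B (h : Hom (F A) (F B)) : exists f : Hom A B, fmap F f = h.
  have [eta [iso nat]] := GF; have [j [ji ij]] := iso A; have [k [ki ik]] := iso B.
  (* The conjugate of [G h] by [eta]. By naturality [G F f] and [G h] agree, and [G] is faithful by
     the other natural isomorphism. *)
  exists (eta B \c fmap G h \c j); apply: fthG.
  have := nat _ _ (eta B \c fmap G h \c j); rewrite /= -(compmA _ j) ji compm1.
  by move/(congr1 (compm k)); rewrite !compmA ki !comp1m.
have essF (Y : D) : exists (A : C) (i : Hom (F A) Y), is_iso i.
  by have [eta [iso _]] := FG; exists (G Y), (eta Y); apply: iso.
apply: half_abelianP; first exact: (transfer_half fullF fthF essF (abelian_half abD)).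
pose Fop : functor (op_cat C) (op_cat D) :=
  @Functor (op_cat C) (op_cat D) F (fun A B f => fmap F (f : @Hom C B A))
    (fun A => fmap1 F A) (fun A B E g f => fmapM F f g).
apply: (@transfer_half _ _ Fop).
- by move=> A B h; apply: fullF.
- by move=> A B f g; apply: fthF.
- by move=> Y; have [A [i [j [ji ij]]]] := essF Y; exists A, j, i.
- exact: abelian_op_half.
Qed.
(** * Finite-dimensional graded modules form an abelian category *)

Section Submodule.
Variables (A : pzRingType) (M : lmodType A) (P : M -> Prop).
Hypothesis P0 : P 0.
Hypothesis Plin : forall a x y, P x -> P y -> P (a *: x + y).

Definition submodule : Type := let _ := P0 in let _ := Plin in {x : M | `[< P x >]}.

HB.instance Definition _ := Choice.on submodule.

Definition sub_val (x : submodule) : M := sval x.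

Lemma sub_valP x : P (sub_val x).
Proof. exact/asboolP/(svalP x). Qed.

Definition sub_mk (x : M) (h : P x) : submodule := exist _ x (asboolT h).

Lemma sub_val_inj : injective sub_val.
Proof. by move=> x y E; apply: val_inj. Qed.

Lemma sub_D x y : P (sub_val x + sub_val y).
Proof. by rewrite -[sub_val x]scale1r; apply: Plin; apply: sub_valP. Qed.
Lemma sub_Z a x : P (a *: sub_val x).
Proof. by rewrite -[_ *: _]addr0; apply: Plin => //; apply: sub_valP. Qed.
Lemma sub_N x : P (- sub_val x).
Proof. by rewrite -scaleN1r; apply: sub_Z. Qed.

Let add x y := sub_mk (sub_D x y).
Let opp x := sub_mk (sub_N x).
Let zero := sub_mk P0.
Let scale a x := sub_mk (sub_Z a x).

Let addA : associative add.
Proof. by move=> x y z; apply: sub_val_inj; apply: addrA. Qed.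
Let addC : commutative add.
Proof. by move=> x y; apply: sub_val_inj; apply: addrC. Qed.
Let add0 : left_id zero add.
Proof. by move=> x; apply: sub_val_inj; apply: add0r. Qed.
Let addN : left_inverse zero opp add.
Proof. by move=> x; apply: sub_val_inj; apply: addNr. Qed.

HB.instance Definition _ := GRing.isZmodule.Build submodule addA addC add0 addN.

Let scaleA a b x : scale a (scale b x) = scale (a * b) x.
Proof. by apply: sub_val_inj; apply: scalerA. Qed.
Let scale1 : left_id 1 scale.
Proof. by move=> x; apply: sub_val_inj; apply: scale1r. Qed.
Let scaleDr : right_distributive scale +%R.
Proof. by move=> a x y; apply: sub_val_inj; apply: scalerDr. Qed.
Let scaleDl x : {morph scale^~ x : a b / a + b}.
Proof. by move=> a b; apply: sub_val_inj; apply: scalerDl. Qed.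

HB.instance Definition _ := GRing.Zmodule_isLmodule.Build A submodule
  scaleA scale1 scaleDr scaleDl.

Lemma sub_valD x y : sub_val (x + y) = sub_val x + sub_val y. Proof. by []. Qed.
Lemma sub_val_sum (I : Type) (r : seq I) (f : I -> submodule) :
  sub_val (\sum_(i <- r) f i) = \sum_(i <- r) sub_val (f i).
Proof. by elim: r => [|i r IH]; rewrite ?big_nil // !big_cons sub_valD IH. Qed.

Variables (I : eqType) (gr : I -> M -> Prop).
Hypothesis grP : is_grading gr.
Hypothesis P_comp : forall m i, P m -> P (gr_comp grP m i).

Lemma sub_grading : is_grading (fun i (x : submodule) => gr i (sub_val x)).
Proof.
split.
- by move=> i; apply: (gr0 grP).
- by move=> i x y hx hy; apply: (grB grP).
- move=> m; have [_ [s [_ _ E]]] := gr_compP grP (sub_val m).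
  exists s, (fun i => sub_mk (P_comp i (sub_valP m))); split=> [i|].
    exact: gr_comp_gr.
  by apply: sub_val_inj; rewrite sub_val_sum.
move=> s f us fgr E i si; apply: sub_val_inj.
apply: (gr_direct grP us fgr) => //.
by rewrite -sub_val_sum E.
Qed.

End Submodule.

(** * Graded quotient modules *)

Section QuotientModule.
Variables (A : pzRingType) (M : lmodType A) (P : M -> Prop).
Hypothesis P0 : P 0.
Hypothesis Plin : forall a x y, P x -> P y -> P (a *: x + y).

Definition quot_rel : rel M := fun x y => `[< P (x - y) >].

Let PZ a x : P x -> P (a *: x).
Proof. by move=> h; rewrite -[_ *: _]addr0; apply: Plin. Qed.
Let PD x y : P x -> P y -> P (x + y).
Proof. by move=> h k; rewrite -[x]scale1r; apply: Plin. Qed.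

Lemma quot_rel_refl : reflexive quot_rel.
Proof. by move=> x; apply/asboolP; rewrite subrr. Qed.
Lemma quot_rel_sym : symmetric quot_rel.
Proof.
have sym x y : P (x - y) -> P (y - x).
  by move=> h; rewrite -opprB -scaleN1r; apply: PZ.
by move=> x y; apply/asboolP/asboolP; apply: sym.
Qed.
Lemma quot_rel_trans : transitive quot_rel.
Proof.
move=> y x z /asboolP h /asboolP k; apply/asboolP.
by rewrite -(subrK y x) -addrA; apply: PD.
Qed.

Canonical quot_equiv := EquivRel quot_rel quot_rel_refl quot_rel_sym quot_rel_trans.

Definition quotient_module : Type := {eq_quot quot_rel}%qT.

HB.instance Definition _ := Choice.on quotient_module.

Definition qpi (x : M) : quotient_module := (\pi_{eq_quot quot_rel} x)%qT.
Definition qrepr (x : quotient_module) : M := repr (x : {eq_quot quot_rel}%qT).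

Lemma qpiP x y : qpi x = qpi y <-> P (x - y).
Proof.
split; last by move=> h; apply/eqmodP/asboolP.
by move=> /eqmodP/asboolP.
Qed.

Lemma qreprK x : qpi (qrepr x) = x. Proof. exact: reprK. Qed.

Lemma qpi_surj (x : quotient_module) : exists y, x = qpi y.
Proof. by exists (qrepr x); rewrite qreprK. Qed.

Let add x y := qpi (qrepr x + qrepr y).
Let opp x := qpi (- qrepr x).
Let scale a x := qpi (a *: qrepr x).

Lemma qrepr_pi x : P (qrepr (qpi x) - x).
Proof. by apply/qpiP; rewrite qreprK. Qed.

Let add_pi x y : add (qpi x) (qpi y) = qpi (x + y).
Proof. by apply/qpiP; rewrite opprD addrACA; apply: PD; apply: qrepr_pi. Qed.
Let opp_pi x : opp (qpi x) = qpi (- x).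
Proof. by apply/qpiP; rewrite -opprD -[- (_ - _)]scaleN1r; apply: PZ; apply: qrepr_pi. Qed.
Let scale_pi a x : scale a (qpi x) = qpi (a *: x).
Proof. by apply/qpiP; rewrite -scalerBr; apply: PZ; apply: qrepr_pi. Qed.

Let addA : associative add.
Proof.
move=> x y z; have [{}x ->] := qpi_surj x; have [{}y ->] := qpi_surj y.
by have [{}z ->] := qpi_surj z; rewrite !add_pi addrA.
Qed.
Let addC : commutative add.
Proof. by move=> x y; rewrite /add addrC. Qed.
Let add0 : left_id (qpi 0) add.
Proof. by move=> x; have [{}x ->] := qpi_surj x; rewrite add_pi add0r. Qed.
Let addN : left_inverse (qpi 0) opp add.
Proof. by move=> x; have [{}x ->] := qpi_surj x; rewrite opp_pi add_pi addNr. Qed.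

HB.instance Definition _ := GRing.isZmodule.Build quotient_module addA addC add0 addN.

Let scaleA a b x : scale a (scale b x) = scale (a * b) x.
Proof. by have [{}x ->] := qpi_surj x; rewrite !scale_pi scalerA. Qed.
Let scale1 : left_id 1 scale.
Proof. by move=> x; have [{}x ->] := qpi_surj x; rewrite scale_pi scale1r. Qed.
Let scaleDr : right_distributive scale +%R.
Proof.
move=> a x y; have [{}x ->] := qpi_surj x; have [{}y ->] := qpi_surj y.
by rewrite [_ + _]add_pi !scale_pi [RHS]add_pi scalerDr.
Qed.
Let scaleDl x : {morph scale^~ x : a b / a + b}.
Proof.
by move=> a b; have [{}x ->] := qpi_surj x; rewrite !scale_pi [RHS]add_pi scalerDl.
Qed.

HB.instance Definition _ := GRing.Zmodule_isLmodule.Build A quotient_module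
  scaleA scale1 scaleDr scaleDl.

Lemma qpiD x y : qpi (x + y) = qpi x + qpi y. Proof. by rewrite [RHS]add_pi. Qed.
Lemma qpiZ a x : qpi (a *: x) = a *: qpi x. Proof. by rewrite [RHS]scale_pi. Qed.
Lemma qpi0 : qpi 0 = 0. Proof. by []. Qed.
Lemma qpi_eq0 x : qpi x = 0 <-> P x.
Proof. by rewrite -qpi0 qpiP subr0. Qed.
Lemma qpi_sum (I : Type) (r : seq I) (f : I -> M) :
  qpi (\sum_(i <- r) f i) = \sum_(i <- r) qpi (f i).
Proof. by elim: r => [|i r IH]; rewrite ?big_nil // !big_cons qpiD IH. Qed.

Variables (I : eqType) (gr : I -> M -> Prop).
Hypothesis grP : is_grading gr.
Hypothesis P_comp : forall m i, P m -> P (gr_comp grP m i).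

Definition quot_gr (i : I) (x : quotient_module) : Prop := exists2 m, gr i m & x = qpi m.

Lemma quot_grading : is_grading quot_gr.
Proof.
split.
- by move=> i; exists 0; [apply: (gr0 grP) | rewrite qpi0].
- move=> i _ _ [m hm ->] [n hn ->]; exists (m - n); first exact: (grB grP).
  by rewrite qpiD -scaleN1r qpiZ scaleN1r.
- move=> x; have [{}x ->] := qpi_surj x; have [_ [s [_ _ E]]] := gr_compP grP x.
  exists s, (fun i => qpi (gr_comp grP x i)); split; last by rewrite -qpi_sum -E.
  by move=> i; exists (gr_comp grP x i) => //; apply: gr_comp_gr.
move=> s f us fgr E i si.
have [g hg] : {g : I -> M & forall j, gr j (g j) /\ f j = qpi (g j)}.
  apply: (choice (P := fun j m => gr j m /\ f j = qpi m)) => j.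
  by have [m hm fm] := fgr j; exists m.
(* The sum of the homogeneous lifts lies in [P], and [P] is stable under taking components, so each
   lift lies in [P]. *)
have Pg : P (\sum_(j <- s) g j).
  by apply/qpi_eq0; rewrite qpi_sum -[RHS]E; apply: eq_bigr => j _; have [_ ->] := hg j.
have [_ ->] := hg i; apply/qpi_eq0.
have := P_comp i Pg; rewrite (gr_compE grP (f := fun j => if j \in s then g j else 0)) ?si //.
split=> [j|]; first by case: ifP => _; [case: (hg j) | apply: (gr0 grP)].
exists s; split=> //; first by move=> j /negbTE ->.
by apply: eq_big_seq => j ->.
Qed.

End QuotientModule.

(** * Kernels, cokernels and biproducts *)

Section FdAbelian.
Variables (K : fieldType) (N : nat).
Local Notation Zg := (Zg K N).
Local Notation fd := (fdModule K N).
Implicit Types A B M Q X : fd.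

Lemma fdhD A B (f : fdHom A B) x y : f (x + y) = f x + f y.
Proof. by have := fdh_linear f 1 x y; rewrite !scale1r. Qed.
Lemma fdh0 A B (f : fdHom A B) : f 0 = 0.
Proof. by apply: (addIr (f 0)); rewrite -fdhD !add0r. Qed.
Lemma fdhZ A B (f : fdHom A B) a x : f (a *: x) = a *: f x.
Proof. by rewrite -[a *: x]addr0 fdh_linear fdh0 addr0. Qed.
Lemma fdhB A B (f : fdHom A B) x y : f (x - y) = f x - f y.
Proof. by rewrite fdhD -scaleN1r fdhZ scaleN1r. Qed.

Lemma fdh_comp A B (f : fdHom A B) m i :
  gr_comp (fd_grP B) (f m) i = f (gr_comp (fd_grP A) m i).
Proof.
apply: (@gr_comp_map _ _ _ _ _ _ f id id) => //.
- exact: fdhD.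
- exact: fdh0.
- exact: fdh_gr.
Qed.

Lemma fdh_gr_reflect A B (f : fdHom A B) : injective f ->
  forall i m, fd_gr i (f m) -> fd_gr i m.
Proof.
move=> fI; apply: (gr_reflect (fdhD f) (fdh0 f) fI (@fdh_gr _ _ _ _ f) (fd_grP B)).
  by move=> i; apply: (gr0 (fd_grP A)).
by move=> m; exists (gr_comp (fd_grP A) m); apply: gr_compP.
Qed.

Program Definition zero_hom A B : fdHom A B := @FdHom _ _ A B (fun=> 0) _ _.
Next Obligation. by move=> a x y; rewrite scaler0 addr0. Qed.
Next Obligation. by apply: (gr0 (fd_grP B)). Qed.

Lemma fd_kfinite (M : lmodType Zg) : (exists s : seq (zconst_scalars M), forall m, kspan s m) ->
  exists s : seq M, forall m, exists c : nat -> K,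
    m = \sum_(i < size s) Zconst N (c i) *: s`_i.
Proof. by move=> [s hs]; exists s => m; apply/(kspanE s m)/hs. Qed.

Definition zero_fd : fd.
Proof.
refine (@FdModule K N 'rV[Zg]_0 (fun _ _ => True) _ _ _).
- split=> // m; first by exists [::], (fun=> 0); rewrite big_nil thinmx0.
  by move=> f _ _ _ i _; rewrite thinmx0.
- by [].
- by exists [::] => m; exists (fun=> 0); rewrite big_ord0 thinmx0.
Defined.

Lemma zero_fdE (x : zero_fd) : x = 0.
Proof. exact: (@thinmx0 _ 1). Qed.

Lemma zero_fd_zero : @is_zero_object (fdCat K N) zero_fd.
Proof.
move=> A; split.
  by exists (zero_hom A zero_fd); split=> // f _; apply: fdHom_eq => x; rewrite [RHS]zero_fdE.
exists (zero_hom zero_fd A); split=> // f _; apply: fdHom_eq => x.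
by rewrite (zero_fdE x) [RHS](fdh0 f).
Qed.

Lemma fd_zero_morphismP A B (f : fdHom A B) :
  @is_zero_morphism (fdCat K N) A B f <-> forall x, f x = 0.
Proof.
split=> [[Z [g [h [zZ ->]]]] x|f0].
  have [[i [_ ui]] _] := zZ Z.
  (* The identity of a zero object equals its zero endomorphism, so the underlying module is
     trivial. *)
  have E : zero_hom Z Z = fdHom_id Z by rewrite -(ui (zero_hom Z Z)) // -(ui (fdHom_id Z)).
  have z0 (z : Z) : z = 0 by rewrite -[LHS]/(fdHom_id Z z) -E.
  by rewrite /= (z0 (_ x)) fdh0.
exists zero_fd, (zero_hom A zero_fd), (zero_hom zero_fd B); split; first exact: zero_fd_zero.
by apply: fdHom_eq => x; rewrite f0.
Qed.

Lemma fd_inj_kernel A B Q (k : fdHom Q A) (f : fdHom A B) : injective k ->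
  (forall a, f a = 0 <-> exists x, k x = a) -> @is_kernel (fdCat K N) A B Q f k.
Proof.
move=> kI ker; split.
  by apply/fd_zero_morphismP => x; apply/ker; exists x.
move=> X g /fd_zero_morphismP fg0.
have [h hh] : {h : X -> Q & forall x, k (h x) = g x}.
  by apply: (choice (P := fun x y => k y = g x)) => x; apply/ker; apply: fg0.
have hlin : linear h by move=> a x y; apply: kI; rewrite fdhD fdhZ !hh fdhD fdhZ.
have hgr i m : fd_gr i m -> fd_gr i (h m).
  by move=> hm; apply: (fdh_gr_reflect kI); rewrite hh; apply: fdh_gr.
exists (FdHom hlin hgr); split; first by apply: fdHom_eq => x; apply: hh.
move=> h' E; apply: fdHom_eq => x; apply: kI; rewrite /= hh.
by rewrite -E.
Qed.

Lemma fd_surj_cokernel A B Q (f : fdHom A B) (q : fdHom B Q) :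
  (forall y, exists x, q x = y) ->
  (forall b, q b = 0 <-> exists a, f a = b) -> @is_cokernel (fdCat K N) A B Q f q.
Proof.
move=> qS coker; split.
  by apply/fd_zero_morphismP => x; apply/coker; exists x.
move=> X g /fd_zero_morphismP gf0.
have g0 b : q b = 0 -> g b = 0 by move=> /coker[a <-]; apply: gf0.
have geq b b' : q b = q b' -> g b = g b'.
  by move=> E; apply/eqP; rewrite -subr_eq0 -fdhB g0 // fdhB E subrr.
(* [r] is only a set-theoretic section; [geq] makes [h] independent of the choice, hence linear. *)
have [r rK] := choice qS.
pose h y := g (r y); have hq b : h (q b) = g b by apply: geq; rewrite rK.
have hlin : linear h by move=> a x y; rewrite /h -fdhZ -fdhD; apply: geq; rewrite fdhD fdhZ !rK.
have hgr i y : fd_gr i y -> fd_gr i (h y).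
  (* [r y] need not be homogeneous, but its [i]-th component is also a preimage of [y] and has
     degree [i]. *)
  move=> hy; have E : q (gr_comp (fd_grP B) (r y) i) = y.
    by rewrite -fdh_comp rK gr_comp_hom.
  by rewrite -E hq; apply: fdh_gr; apply: gr_comp_gr.
exists (FdHom hlin hgr); split; first by apply: fdHom_eq => x; apply: hq.
move=> h' E; apply: fdHom_eq => y; rewrite -(rK y) /= hq.
by rewrite -E.
Qed.

Section SubQuotient.
Variables (M : fd) (P : M -> Prop).
Hypothesis P0 : P 0.
Hypothesis Plin : forall a x y, P x -> P y -> P (a *: x + y).
Hypothesis P_comp : forall m i, P m -> P (gr_comp (fd_grP M) m i).

Lemma fd_kspan_ex : exists s : seq (zconst_scalars M), forall m, kspan s m.
Proof. by have [s hs] := fd_finite M; exists s => m; apply/kspanE/hs. Qed.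

Definition sub_fd : fd.
Proof.
refine (@FdModule K N (submodule P0 Plin) _ (sub_grading P0 Plin P_comp) _ _).
  by move=> a i u m da hm; apply: fd_gr_act.
apply: fd_kfinite; have [s hs] := fd_kspan_ex.
have [||t [tP spanP]] := @kspan_subspace _ _ s P P0.
- by move=> a y z; apply: (@Plin (Zconst N a)).
- by move=> x _.
have tl : exists t' : seq (submodule P0 Plin), t = map (@sub_val _ _ _ P0 Plin) t'.
  elim: t tP {spanP} => [|x t IH] tP; first by exists [::].
  have [|t' ->] := IH; first by move=> y yt; apply: tP; rewrite inE yt orbT.
  by exists (sub_mk P0 Plin (tP x (mem_head _ _)) :: t').
have [t' Et] := tl; exists t' => m; have [c Ec] := iffLR (kspanE _ _) (spanP _ (sub_valP m)).
apply/kspanE; exists c; apply: sub_val_inj; rewrite Ec Et size_map.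
rewrite -(big_mkord xpredT (fun i => c i *: (t'`_i : zconst_scalars (submodule P0 Plin)))).
rewrite sub_val_sum big_mkord; apply: eq_bigr => i _.
by rewrite (nth_map 0).
Defined.

Definition sub_fd_incl : fdHom sub_fd M.
Proof. by exists (@sub_val _ _ _ P0 Plin). Defined.

Definition quot_fd : fd.
Proof.
refine (@FdModule K N (quotient_module P0 Plin) _ (quot_grading P0 Plin P_comp) _ _).
  move=> a i u _ da [m hm ->]; exists (u *: m); first exact: fd_gr_act.
  by rewrite qpiZ.
apply: fd_kfinite; have [s hs] := fd_kspan_ex.
exists (map (qpi P0 Plin) s) => x; have [m ->] := qpi_surj x.
have [c Ec] := iffLR (kspanE _ _) (hs m); apply/kspanE; exists c; rewrite size_map Ec.
rewrite -(big_mkord xpredT (fun i => c i *: s`_i)) qpi_sum big_mkord; apply: eq_bigr => i _.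
by rewrite (nth_map 0) //; apply: qpiZ.
Defined.

Definition quot_fd_proj : fdHom M quot_fd.
Proof.
exists (qpi P0 Plin); first by move=> a x y; rewrite qpiD qpiZ.
by move=> i m hm; exists m.
Defined.

End SubQuotient.

Section KerIm.
Variables (A B : fd) (f : fdHom A B).

Let ker (a : A) : Prop := f a = 0.
Let im (b : B) : Prop := exists a, f a = b.

Let ker0 : ker 0. Proof. exact: fdh0. Qed.
Let kerlin a x y : ker x -> ker y -> ker (a *: x + y).
Proof. by rewrite /ker fdhD fdhZ => -> ->; rewrite scaler0 addr0. Qed.
Let ker_comp m i : ker m -> ker (gr_comp (fd_grP A) m i).
Proof.
rewrite /ker -fdh_comp => ->.
by rewrite gr_comp_hom //; apply: (gr0 (fd_grP B)).
Qed.
Let im0 : im 0. Proof. by exists 0; apply: fdh0. Qed.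
Let imlin a x y : im x -> im y -> im (a *: x + y).
Proof. by move=> [u <-] [v <-]; exists (a *: u + v); rewrite fdhD fdhZ. Qed.
Let im_comp m i : im m -> im (gr_comp (fd_grP B) m i).
Proof. by move=> [a <-]; rewrite fdh_comp; exists (gr_comp (fd_grP A) a i). Qed.

Lemma fd_kernel_ex : exists (Q : fd) (k : fdHom Q A), injective k /\
  forall a, f a = 0 <-> exists x, k x = a.
Proof.
exists (sub_fd ker0 kerlin ker_comp), (sub_fd_incl _ _ _); split; first exact: sub_val_inj.
move=> a; split=> [fa|[x <-]]; last exact: (sub_valP x).
by exists (sub_mk ker0 kerlin fa).
Qed.

Lemma fd_cokernel_ex : exists (Q : fd) (q : fdHom B Q), (forall y, exists x, q x = y) /\
  forall b, q b = 0 <-> exists a, f a = b.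
Proof.
exists (quot_fd im0 imlin im_comp), (quot_fd_proj _ _ _); split.
  by move=> y; have [x ->] := qpi_surj y; exists x.
by move=> b; apply: qpi_eq0.
Qed.

Lemma fd_mono_inj : @is_mono (fdCat K N) A B f -> injective f.
Proof.
have [Q [k [kI ker_k]]] := fd_kernel_ex; move=> /(_ Q k (zero_hom Q A)) mono x y E.
have k0 : k = zero_hom Q A.
  by apply: mono; apply: fdHom_eq => z; rewrite /= fdh0; apply/ker_k; exists z.
apply/eqP; rewrite -subr_eq0; apply/eqP.
have /ker_k[z <-] : f (x - y) = 0 by rewrite fdhB E subrr.
by rewrite k0.
Qed.

Lemma fd_epi_surj : @is_epi (fdCat K N) A B f -> forall b, exists a, f a = b.
Proof.
have [Q [q [qS coker_q]]] := fd_cokernel_ex; move=> /(_ Q q (zero_hom B Q)) epi b.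
apply/coker_q; have -> : q = zero_hom B Q by
  apply: epi; apply: fdHom_eq => z /=; apply/coker_q; exists z.
by [].
Qed.

End KerIm.

Section Product.
Variables A B : fd.

Definition prod_gr (i : int) (x : A * B) : Prop := fd_gr i x.1 /\ fd_gr i x.2.

Lemma prod_grading : is_grading prod_gr.
Proof.
have gA := fd_grP A; have gB := fd_grP B.
have p0 i : prod_gr i 0 by split; apply: gr0.
split=> //.
- by move=> i x y [h1 h2] [k1 k2]; split; apply: grB.
- move=> [x y]; suff [c [cgr [s [_ _ E]]]] : exists c, decomposes prod_gr c (x, y).
    by exists s, c.
  have -> : (x, y) = (x, 0) + (0, y) :> A * B by apply: injective_projections; rewrite /= ?addr0 ?add0r.
  have dA : decomposes prod_gr (fun i => (gr_comp gA x i, 0)) (x, 0).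
    apply: (@decomposes_map _ _ _ _ _ _ (fun x : A => (x, 0) : A * B) id id _ _ _ _ _ _ _
      (gr_compP gA x)) => //.
    + by move=> u v; apply: injective_projections; rewrite /= ?addr0.
    + by move=> i m hm; split=> //; apply: gr0.
  have dB : decomposes prod_gr (fun i => (0, gr_comp gB y i)) (0, y).
    apply: (@decomposes_map _ _ _ _ _ _ (fun y : B => (0, y) : A * B) id id _ _ _ _ _ _ _
      (gr_compP gB y)) => //.
    + by move=> u v; apply: injective_projections; rewrite /= ?addr0.
    + by move=> i m hm; split=> //; apply: gr0.
  eexists; apply: (decomposesD _ dA dB).
  by move=> i u v [h1 h2] [k1 k2]; split; apply: grD.
move=> s f us fgr E i si.
have fst_sum : (\sum_(i <- s) f i).1 = \sum_(i <- s) (f i).1.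
  exact: (big_morph fst (fun _ _ => erefl) erefl).
have snd_sum : (\sum_(i <- s) f i).2 = \sum_(i <- s) (f i).2.
  exact: (big_morph snd (fun _ _ => erefl) erefl).
apply: injective_projections.
- apply: (gr_direct gA (f := fun i => (f i).1) us) => // [j|]; first by case: (fgr j).
  by rewrite -fst_sum E.
- apply: (gr_direct gB (f := fun i => (f i).2) us) => // [j|]; first by case: (fgr j).
  by rewrite -snd_sum E.
Qed.

Definition prod_fd : fd.
Proof.
refine (@FdModule K N (A * B)%type prod_gr prod_grading _ _).
  by move=> a i u m da [h1 h2]; split; apply: fd_gr_act.
apply: fd_kfinite; have [s hs] := fd_kspan_ex A; have [t ht] := fd_kspan_ex B.
pose inA (x : A) : zconst_scalars (A * B)%type := (x, 0).
pose inB (y : B) : zconst_scalars (A * B)%type := (0, y).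
exists (map inA s ++ map inB t) => -[x y].
have -> : (x, y) = inA x + inB y :> zconst_scalars (A * B)%type.
  by apply: injective_projections; rewrite /= ?addr0 ?add0r.
apply: kspanD.
  apply: (@kspan_min _ _ s (fun x => kspan (map inA s ++ map inB t) (inA x))) (hs x).
  - exact: kspan0.
  - move=> a u v hu hv; have -> : inA (a *: u + v) = a *: inA u + inA v.
      by apply: injective_projections; rewrite /= ?scaler0 ?addr0.
    exact: kspan_lin.
  by move=> u us; apply: kspan_mem; rewrite mem_cat map_f.
apply: (@kspan_min _ _ t (fun y => kspan (map inA s ++ map inB t) (inB y))) (ht y).
- exact: kspan0.
- move=> a u v hu hv; have -> : inB (a *: u + v) = a *: inB u + inB v.
    by apply: injective_projections; rewrite /= ?scaler0 ?addr0.
  exact: kspan_lin.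
by move=> u us; apply: kspan_mem; rewrite mem_cat map_f ?orbT.
Defined.

Definition prod_fst : fdHom prod_fd A.
Proof. by exists fst => // i m []. Defined.
Definition prod_snd : fdHom prod_fd B.
Proof. by exists snd => // i m []. Defined.
Definition prod_inl : fdHom A prod_fd.
Proof.
exists (fun x => (x, 0)).
  by move=> a x y; apply: injective_projections; rewrite /= ?scaler0 ?addr0.
by move=> i m hm; split=> //; apply: (gr0 (fd_grP B)).
Defined.
Definition prod_inr : fdHom B prod_fd.
Proof.
exists (fun x => (0, x)).
  by move=> a x y; apply: injective_projections; rewrite /= ?scaler0 ?addr0.
by move=> i m hm; split=> //; apply: (gr0 (fd_grP A)).
Defined.

Lemma prod_fd_product : @is_product (fdCat K N) A B prod_fd prod_fst prod_snd.
Proof.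
move=> X f g.
have hlin : linear (fun x => (f x, g x) : prod_fd).
  by move=> a x y; apply: injective_projections; rewrite /= ?fdh_linear.
have hgr i m : fd_gr i m -> @fd_gr _ _ prod_fd i (f m, g m).
  by move=> hm; split; apply: fdh_gr.
exists (FdHom hlin hgr); split; first by split; apply: fdHom_eq.
move=> h [hf hg]; apply: fdHom_eq => x; rewrite [RHS]surjective_pairing.
by apply: injective_projections; rewrite /= -?hf -?hg.
Qed.

Lemma prod_fd_coproduct : @is_coproduct (fdCat K N) A B prod_fd prod_inl prod_inr.
Proof.
move=> X f g.
have hlin : linear (fun x : prod_fd => f x.1 + g x.2).
  by move=> a x y; rewrite !fdh_linear scalerDr addrACA.
have hgr i m : @fd_gr _ _ prod_fd i m -> fd_gr i (f m.1 + g m.2).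
  by move=> [h1 h2]; apply: (grD (fd_grP X)); apply: fdh_gr.
exists (FdHom hlin hgr); split.
  by split; apply: fdHom_eq => x; rewrite /= fdh0 ?addr0 ?add0r.
move=> h [hf hg]; apply: fdHom_eq => -[x y]; rewrite /= -hf -hg /= -fdhD.
by congr (h _); apply: injective_projections; rewrite /= ?addr0 ?add0r.
Qed.

End Product.

Theorem fdCat_abelian : is_abelian (fdCat K N).
Proof.
split.
- by exists zero_fd; apply: zero_fd_zero.
- by move=> A B; exists (prod_fd A B), (prod_fst A B), (prod_snd A B); apply: prod_fd_product.
- by move=> A B; exists (prod_fd A B), (prod_inl A B), (prod_inr A B); apply: prod_fd_coproduct.
- move=> A B f; have [Q [k [kI kk]]] := fd_kernel_ex f.
  by exists Q, k; apply: fd_inj_kernel.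
- move=> A B f; have [Q [q [qS qq]]] := fd_cokernel_ex f.
  by exists Q, q; apply: fd_surj_cokernel.
- move=> A B f /fd_mono_inj fI; have [Q [q [qS qq]]] := fd_cokernel_ex f.
  by exists Q, q; apply: fd_inj_kernel.
move=> A B f /fd_epi_surj fS; have [Q [k [kI kk]]] := fd_kernel_ex f.
by exists Q, k; apply: fd_surj_cokernel.
Qed.

End FdAbelian.
(** * The two functors *)

Section OmegaFunctor.
Variables (K : fieldType) (N : nat) (F : freeFieldAlgebra K N).
Hypothesis charK : [pchar K] =i pred0.
Implicit Types M : fgModule F.
Local Notation Zg := (Zg K N).
Local Notation Ug := (Ug K N).

Lemma Zg_incl_bracket (x y : modeZ N) :
  Ugen K N (val x) * Ugen K N (val y) + Ugen K N (val y) * Ugen K N (val x) =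
  uconst _ (0 : K).
Proof. by rewrite Ugen_bracket bracket_zero // (valP x). Qed.

Definition Zg_incl : {rmorphism Zg -> Ug} := umap_rmorphism Zg_incl_bracket.

Lemma Zg_incl_const c : Zg_incl (Zconst N c) = Uconst N c.
Proof. exact: (umap_pi Zg_incl_bracket (UConst _ c)). Qed.

Lemma Zg_incl_gen x : Zg_incl (Zgen K x) = Ugen K N (val x).
Proof. exact: (umap_pi Zg_incl_bracket (UGen _ x)). Qed.

Lemma Zg_incl_degree a u : Zdegree a u -> Udegree a (Zg_incl u).
Proof.
elim=> [b|c|x|b x y _ hx _ hy|b b' x y _ hx _ hy].
- by rewrite [Zg_incl 0]rmorph0; apply: udegree0.
- by rewrite [Zg_incl _]Zg_incl_const; apply: udegree_const.
- by rewrite [Zg_incl _]Zg_incl_gen; apply: (udegree_gen _ (fun x : mode => charge x.1)).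
- by rewrite [Zg_incl _]rmorphD; apply: udegreeD.
- by rewrite [Zg_incl _]rmorphM; apply: udegreeM.
Qed.

Definition Zmod M : lmodType Zg := restrict_scalars Zg_incl (Umod M).

Lemma Zmod_scale M u (m : Zmod M) : u *: m = Zg_incl u *: (m : Umod M) :> M.
Proof. by []. Qed.

Lemma Zmod_gen M x (m : M) : Zgen K x *: (m : Zmod M) = mode_act (val x) m :> M.
Proof. by rewrite Zmod_scale Zg_incl_gen Umod_gen. Qed.

Lemma Zmod_const M c (m : M) : Zconst N c *: (m : Zmod M) = c *: m :> M.
Proof. by rewrite Zmod_scale Zg_incl_const Umod_const. Qed.

Lemma mode_act0 M x : mode_act x (0 : M) = 0.
Proof. exact: (act0r (fg_module M)). Qed.

Lemma mode_actD M x (m n : M) : mode_act x (m + n) = mode_act x m + mode_act x n.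
Proof. exact: (actDr (fg_module M)). Qed.

Lemma mode_actZ M x c (m : M) : mode_act x (c *: m) = c *: mode_act x m.
Proof. exact: (actZr (fg_module M)). Qed.

Lemma Omega0 M : Omega (0 : M).
Proof. by move=> x _; apply: mode_act0. Qed.

Lemma Omega_linK M c (m n : M) : Omega m -> Omega n -> Omega (c *: m + n).
Proof. by move=> hm hn x hx; rewrite mode_actD mode_actZ hm // hn // scaler0 addr0. Qed.

Lemma Omega_zero_mode M (y : mode) (m : M) : 0 <= y.2 < N%:Z -> Omega m ->
  Omega (mode_act y m).
Proof.
move=> hy hm x hx; have := mode_act_bracket x y m.
by rewrite (hm x hx) mode_act0 addr0 bracketC bracket_zero // scale0r.
Qed.

Lemma Omega_lin M (u : Zg) (m n : Zmod M) : Omega (m : M) -> Omega (n : M) ->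
  Omega (u *: m + n : Zmod M).
Proof.
have D (x y : M) : Omega x -> Omega y -> Omega (x + y).
  by move=> hx hy; rewrite -[x]scale1r; apply: Omega_linK.
have Z c (x : M) : Omega x -> Omega (c *: x).
  by move=> hx; rewrite -[_ *: _]addr0; apply: Omega_linK => //; apply: Omega0.
move=> hm hn; apply: (D) => //.
elim/env_ind: u m {n hn} hm => [c|x|x IH|x y hx hy|x y hx hy] m hm.
- by rewrite [_ *: _]Zmod_const; apply: (Z).
- by rewrite [_ *: _]Zmod_gen; apply: Omega_zero_mode => //; apply: (valP x).
- by rewrite scaleNr; have := Z (-1) _ (IH m hm); rewrite scaleN1r.
- by rewrite scalerDl; apply: (D); [apply: hx | apply: hy].
- by rewrite -scalerA; apply/hx/hy.
Qed.

Lemma Omega_comp M (m : M) i : Omega m -> Omega (gr_comp (fg_grP M).1 m i).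
Proof.
move=> hm x hx; have := @gr_comp_map _ _ _ _ _ _ (mode_act x) (fun i => i + charge x.1)
  (fun i => i - charge x.1) (@mode_actD M x) (mode_act0 M x) (addrK _) (subrK _) _
  (fg_grP M).1 (fg_grP M).1 m (i + charge x.1).
rewrite addrK => <- => [|j n hn]; last by apply: fg_gr_act => //; apply: ff_grX.
by rewrite hm // gr_comp_hom //; apply: (gr0 (fg_grP M).1).
Qed.

Lemma Zmod_grP M : @is_grading _ (Zmod M) (@fg_gr K N F M).
Proof. exact: (fg_grP M).1. Qed.

Lemma Zmod_Omega_comp M (m : Zmod M) i : Omega (m : M) ->
  Omega (gr_comp (Zmod_grP M) m i : M).
Proof.
move=> /(@Omega_comp M m i); congr Omega.
exact: (esym (gr_compE (Zmod_grP M) (gr_compP (fg_grP M).1 m) i)).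
Qed.

Definition Omega_space M : lmodType Zg :=
  submodule (M := Zmod M) (P := @Omega K N F M) (Omega0 M) (@Omega_lin M).

Definition Omega_val M (w : Omega_space M) : M := sub_val w.

(** One pass per zero mode suffices: adjoining the images under [x] gives stability under [x]
    because [x] squares to 0, and preserves stability under the earlier modes because they
    anticommute with [x]. *)
Lemma close_zero_modes M (l : seq mode) (s : seq M) : {subset l <= zero_modes N} ->
  (forall m, m \in s -> Omega m) ->
  exists t, [/\ {subset s <= t}, forall m, m \in t -> Omega m &
    forall x m, x \in l -> kspan t m -> kspan t (mode_act x m)].
Proof.
move=> sub sO; elim: l sub => [|x l IH] sub; first by exists s; split.
have [|t [st tO tl]] := IH; first by move=> y yl; apply: sub; rewrite inE yl orbT.
have zx y : y \in x :: l -> 0 <= y.2 < N%:Z by move=> /sub; rewrite zero_modesP.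
exists (t ++ map (mode_act x) t); split.
- by move=> m /st mt; rewrite mem_cat mt.
- move=> m; rewrite mem_cat => /orP[/tO//|/mapP[n nt ->]].
  by apply: Omega_zero_mode; [apply: zx; apply: mem_head | apply: tO].
have left m : kspan t m -> kspan (t ++ map (mode_act x) t) m.
  by apply: kspan_subset => n nt; rewrite mem_cat nt.
have right m : kspan t m -> kspan (t ++ map (mode_act x) t) (mode_act x m).
  apply: (@kspan_min _ _ t (fun m => kspan _ (mode_act x m))); first by rewrite mode_act0; apply: kspan0.
    by move=> c p q hp hq; rewrite mode_actD mode_actZ; apply: kspan_lin.
  by move=> n nt; apply: kspan_mem; rewrite mem_cat map_f ?orbT.
move=> y m yxl; apply: (@kspan_min _ _ _ (fun m => kspan _ (mode_act y m))); first by rewrite mode_act0; apply: kspan0.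
  by move=> c p q hp hq; rewrite mode_actD mode_actZ; apply: kspan_lin.
move=> n; rewrite mem_cat => /orP[nt|/mapP[{}n nt ->]].
  move: yxl; rewrite inE => /predU1P[->|yl]; first exact/right/kspan_mem.
  by apply/left/tl/kspan_mem.
have E : mode_act y (mode_act x n) = - mode_act x (mode_act y n).
  by apply/eqP; rewrite -addr_eq0 mode_act_bracket bracket_zero ?scale0r // zx.
move: yxl; rewrite inE => /predU1P[yx|yl].
  have := Umod_gen x (mode_act x n).
  rewrite -(Umod_gen x n) scalerA U_sq // scale0r yx => <-.
  exact: kspan0.
by rewrite E -scaleN1r; apply/kspanZ/right/tl/kspan_mem.
Qed.

(** The generators involve finitely many singular vectors. With [W] the span of these, closed under
    zero modes, [neg_span W] is a submodule containing the generators, hence everything, and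
    [singular_neg_span] puts Omega inside [W]. *)
Lemma Omega_kfinite M : exists t : seq M,
  (forall m, m \in t -> Omega m) /\ forall m, Omega m -> kspan t m.
Proof.
have [g hg] := fg_finite M.
have mono (W W' : Umod M -> Prop) m : (forall x, W x -> W' x) -> neg_span W m -> neg_span W' m.
  move=> sub; elim=> {m} [m /sub h|x y _ hx _ hy|c x _ hx|x m hx _ hm].
  - exact: neg_span_base.
  - exact: neg_spanD.
  - exact: neg_span_const.
  - exact: neg_span_gen.
have one (m : M) : exists t : seq M, (forall n, n \in t -> Omega n) /\
    neg_span (kspan t : Umod M -> Prop) m.
  elim: (smooth_neg_span charK (@Umod_smooth _ _ _ M) m) =>
    {m} [m sm|x y _ [t [tO ht]] _ [t' [tO' ht']]|c x _ [t [tO ht]]|x m hx _ [t [tO ht]]].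
  - exists [:: m : M]; split; last by apply/neg_span_base/kspan_mem/mem_head.
    by move=> n; rewrite inE => /eqP ->; apply/Umod_singular.
  - exists (t ++ t'); split; first by move=> n; rewrite mem_cat => /orP[/tO|/tO'].
    apply: neg_spanD; [apply: mono ht | apply: mono ht'] => n;
      by apply: kspan_subset => z zt; rewrite mem_cat zt ?orbT.
  - by exists t; split=> //; apply: neg_span_const.
  - by exists t; split=> //; apply: neg_span_gen.
have [s [sO hs]] : exists s : seq M, (forall n, n \in s -> Omega n) /\
    forall m, m \in g -> neg_span (kspan s : Umod M -> Prop) m.
  elim: g {hg} => [|m g [s [sO hs]]]; first by exists [::].
  have [t [tO ht]] := one m; exists (t ++ s); split.
    by move=> n; rewrite mem_cat => /orP[/tO|/sO].
  move=> n; rewrite inE => /predU1P[->|/hs hn].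
    by apply: mono ht => x; apply: kspan_subset => z zt; rewrite mem_cat zt.
  by apply: mono hn => x; apply: kspan_subset => z zt; rewrite mem_cat zt orbT.
have [t [st tO tz]] := close_zero_modes (fun _ h => h) sO.
exists t; split=> // m mO.
have W0 : (kspan t : Umod M -> Prop) 0 := kspan0 t.
have WD (x y : Umod M) : kspan t (x : M) -> kspan t (y : M) -> kspan t (x + y : M).
  exact: kspanD.
have Wc c (x : Umod M) : kspan t (x : M) -> kspan t (Uconst N c *: x : Umod M).
  by move=> h; rewrite [_ *: _]Umod_const; apply: kspanZ.
have Wsing (x : Umod M) : kspan t (x : M) -> singular x.
  move=> h; apply/Umod_singular; move: h; apply: kspan_min => //; first exact: Omega0.
  exact: Omega_linK.
have Wz (x : mode) (n : Umod M) : 0 <= x.2 < N%:Z -> kspan t (n : M) ->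
    kspan t (Ugen K N x *: n : Umod M).
  by move=> hx hn; rewrite [_ *: _]Umod_gen; apply: tz; rewrite ?zero_modesP.
apply: (singular_neg_span charK W0 WD Wc Wsing); last exact/Umod_singular.
apply: hg.
- move=> c x y hx hy; rewrite -(Umod_const c x).
  by apply: neg_spanD => //; apply: neg_span_const.
- move=> n u x hx; apply: (act_closed (fg_module M)) (hx) => [c y z hy hz|s' k y hy].
    rewrite -(Umod_const c y).
    by apply: neg_spanD => //; apply: neg_span_const.
  have -> : fg_act k (ffX F s') y = Ugen K N (s', k) *: (y : Umod M) by rewrite Umod_gen.
  exact: neg_span_Ugen.
- move=> x /hs; apply: mono => n; exact: kspan_subset.
Qed.

Definition Omega_module M : fdModule K N.
Proof.
refine (@FdModule K N (Omega_space M) (fun i w => fg_gr i (Omega_val w))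
  (@sub_grading _ (Zmod M) _ (Omega0 M) (@Omega_lin M) _ _ (Zmod_grP M)
    (@Zmod_Omega_comp M)) _ _).
  by move=> a i u w du hw; apply: Umod_gr => //; apply: Zg_incl_degree.
apply: fd_kfinite; have [t [tO ht]] := Omega_kfinite M.
have [t' Et] : exists t' : seq (Omega_space M), t = map (@Omega_val M) t'.
  elim: t tO {ht} => [|x t IH] tO; first by exists [::].
  have [|t' ->] := IH; first by move=> y yt; apply: tO; rewrite inE yt orbT.
  by exists (sub_mk (M := Zmod M) (Omega0 M) (@Omega_lin M) (tO x (mem_head _ _)) :: t').
exists t' => w; have wO : Omega (Omega_val w) := sub_valP w.
have [c Ec] := iffLR (kspanE _ _) (ht _ wO).
apply/kspanE; exists c; apply: sub_val_inj; rewrite [LHS]Ec Et size_map.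
rewrite -(big_mkord xpredT (fun i => c i *: (t'`_i : zconst_scalars (Omega_space M)))).
rewrite sub_val_sum big_mkord; apply: eq_bigr => i _.
by rewrite (nth_map 0) // [RHS]Zmod_const.
Defined.

Lemma fgh_D M M' (f : fgHom M M') x y : f (x + y) = f x + f y.
Proof. by have := fgh_linear f 1 x y; rewrite !scale1r. Qed.
Lemma fgh_0 M M' (f : fgHom M M') : f 0 = 0.
Proof. by apply: (addIr (f 0)); rewrite -fgh_D !add0r. Qed.
Lemma fgh_Z M M' (f : fgHom M M') c x : f (c *: x) = c *: f x.
Proof. by rewrite -[c *: x]addr0 fgh_linear fgh_0 addr0. Qed.

Lemma fgh_Umod M M' (f : fgHom M M') u (m : Umod M) :
  f (u *: m : Umod M) = u *: (f m : Umod M').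
Proof.
apply: (@Ug_scale_comm _ _ (Umod M) (Umod M') f).
- exact: fgh_D.
- by move=> c n; rewrite !Umod_const fgh_Z.
- by move=> x n; rewrite !Umod_gen /mode_act fgh_act.
Qed.

Lemma fgh_Omega M M' (f : fgHom M M') m : Omega m -> Omega (f m).
Proof. by move=> hm x hx; rewrite /mode_act -fgh_act [fg_act _ _ _](hm x hx) fgh_0. Qed.

Definition Omega_hom M M' (f : fgHom M M') : fdHom (Omega_module M) (Omega_module M').
Proof.
exists (fun w : Omega_space M =>
  sub_mk (M := Zmod M') (Omega0 M') (@Omega_lin M') (fgh_Omega f (sub_valP w)) : Omega_space M').
- move=> u x y; apply: sub_val_inj; apply: etrans (fgh_D f _ _) _.
  by rewrite sub_valD; congr (_ + _); apply: fgh_Umod.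
- by move=> i w hw; apply: fgh_gr.
Defined.

Definition Omega_functor : functor (fgCat F) (fdCat K N).
Proof.
refine (@Functor (fgCat F) (fdCat K N) Omega_module (fun M M' f => Omega_hom f) _ _).
- by move=> M; apply: fdHom_eq => w; apply: sub_val_inj.
- by move=> M1 M2 M3 g f; apply: fdHom_eq => w; apply: sub_val_inj.
Defined.

Lemma Omega_functorP : is_Omega_functor Omega_functor.
Proof.
exists (fun M => @Omega_val M); split.
- by move=> M w w' E; apply: sub_val_inj.
- move=> M m; split=> [hm|[w <-]]; last exact: (sub_valP w).
  by exists (sub_mk (M := Zmod M) (Omega0 M) (@Omega_lin M) hm).
- by [].
- by move=> M c w; apply: Zmod_const.
split=> //; move=> M x w; exact: Zmod_gen.
Qed.

End OmegaFunctor.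

(** * The induction functor, unit and counit *)

Section IndFunctor.
Variables (K : fieldType) (N : nat) (F : freeFieldAlgebra K N).
Hypothesis charK : [pchar K] =i pred0.
Implicit Types M : fgModule F.

Definition Fock (M0 : fdModule K N) : fgModule F := sval (cid (fock_module F charK M0)).

Definition theta (M0 : fdModule K N) : induced M0 -> Fock M0 :=
  sval (cid (svalP (cid (fock_module F charK M0)))).

Lemma thetaP (M0 : fdModule K N) :
  [/\ bijective (@theta M0),
      forall t t', theta (t + t') = theta t + theta t' :> Fock M0,
      forall c t, theta (Uconst N c *: t) = c *: theta t :> Fock M0,
      forall x t, theta (Ugen K N x *: t) = mode_act x (theta t : Fock M0) &
      (forall i t, induced_gr i t <-> fg_gr i (theta t : Fock M0)) /\
      forall m : M0, theta (itensor 1 m) = 0 -> m = 0].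
Proof. exact: svalP (cid (svalP (cid (fock_module F charK M0)))). Qed.

Lemma fock_unit_eq0 (M0 : fdModule K N) (m : M0) : theta (itensor 1 m) = 0 -> m = 0.
Proof. by case: (thetaP M0) => _ _ _ _ [_]; apply. Qed.
Lemma theta_bij (M0 : fdModule K N) : bijective (@theta M0). Proof. by case: (thetaP M0). Qed.
Lemma thetaD (M0 : fdModule K N) (t t' : induced M0) : theta (t + t') = theta t + theta t'.
Proof. by case: (thetaP M0). Qed.
Lemma theta_const (M0 : fdModule K N) c (t : induced M0) : theta (Uconst N c *: t) = c *: theta t.
Proof. by case: (thetaP M0). Qed.
Lemma theta_gen (M0 : fdModule K N) x (t : induced M0) : theta (Ugen K N x *: t) = mode_act x (theta t).
Proof. by case: (thetaP M0). Qed.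
Lemma theta_gr (M0 : fdModule K N) i (t : induced M0) : induced_gr i t <-> fg_gr i (theta t).
Proof. by case: (thetaP M0) => _ _ _ _ []. Qed.
Lemma theta0 (M0 : fdModule K N) : theta (0 : induced M0) = 0.
Proof. by apply: (addIr (theta 0)); rewrite -thetaD !add0r. Qed.

Lemma theta_Umod (M0 : fdModule K N) u (t : induced M0) :
  theta (u *: t) = u *: (theta t : Umod (Fock M0)) :> Fock M0.
Proof.
apply: (@Ug_scale_comm _ _ _ (Umod (Fock M0)) (@theta M0)).
- exact: thetaD.
- by move=> c n; rewrite Umod_const theta_const.
- by move=> x n; rewrite Umod_gen theta_gen.
Qed.

Definition theta_inv (M0 : fdModule K N) (y : Fock M0) : induced M0 :=
  sval (cid (let: Bijective g _ gK := theta_bij M0 in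
             ex_intro (fun t => theta t = y) (g y) (gK y))).

Lemma theta_invK (M0 : fdModule K N) : cancel (@theta_inv M0) (@theta M0).
Proof. by move=> y; rewrite /theta_inv; case: cid. Qed.

Lemma thetaK (M0 : fdModule K N) : cancel (@theta M0) (@theta_inv M0).
Proof. by move=> t; apply: (bij_inj (theta_bij M0)); rewrite theta_invK. Qed.

Section Extend.
Variables (M0 : fdModule K N) (M : fgModule F) (f : M0 -> M).
Hypothesis fD : forall x y, f (x + y) = f x + f y.
Hypothesis f_const : forall c m, f (Zconst N c *: m) = c *: f m.
Hypothesis f_gen : forall (x : modeZ N) m, f (Zgen K x *: m) = mode_act (val x) (f m).
Hypothesis f_Omega : forall m, Omega (f m).
Hypothesis f_gr : forall i m, fd_gr i m -> fg_gr i (f m).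

Let fc c m : f (Zconst N c *: m) = Uconst N c *: (f m : Umod M) :> Umod M.
Proof. by rewrite Umod_const f_const. Qed.
Let fg (x : modeZ N) m : f (Zgen K x *: m) = Ugen K N (val x) *: (f m : Umod M) :> Umod M.
Proof. by rewrite Umod_gen f_gen. Qed.
Let fp (x : mode) m : N%:Z <= x.2 -> Ugen K N x *: (f m : Umod M) = 0.
Proof. by move=> hx; rewrite Umod_gen f_Omega. Qed.

Definition fock_ext_fun (y : Fock M0) : M := ind_ext (V := Umod M) f (theta_inv y).

Lemma fock_ext_theta t : fock_ext_fun (theta t) = ind_ext (V := Umod M) f t.
Proof. by rewrite /fock_ext_fun thetaK. Qed.

Lemma fock_ext_tensor u m :
  fock_ext_fun (theta (itensor u m)) = u *: (f m : Umod M) :> Umod M.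
Proof. by rewrite fock_ext_theta; apply: ind_ext_tensor. Qed.

Lemma fock_ext_linear : linear fock_ext_fun.
Proof.
move=> c x y; rewrite -(theta_invK x) -(theta_invK y) -theta_const -thetaD !fock_ext_theta.
rewrite (ind_extD (V := Umod M) fD fc fg fp) (ind_extZ (V := Umod M) fD fc fg fp).
by rewrite [_ *: _]Umod_const.
Qed.

(** [ind_ext] gives linearity over the enveloping algebra only; [act_morph] upgrades it to the
    action of all of [F]. *)
Lemma fock_ext_act n u y : fock_ext_fun (fg_act n u y) = fg_act n u (fock_ext_fun y).
Proof.
apply: (act_morph (fg_module (Fock M0)) (fg_module M) fock_ext_linear) => s k x.
rewrite -(theta_invK x) -[fg_act k _ _](theta_gen (s, k)) !fock_ext_theta.
by rewrite (ind_extZ (V := Umod M) fD fc fg fp) [_ *: _]Umod_gen.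
Qed.

Lemma fock_ext_gr i y : fg_gr i y -> fg_gr i (fock_ext_fun y).
Proof.
rewrite -(theta_invK y) => /theta_gr; move: (theta_inv y) => t {y}.
elim/induced_gr_ind: {i t}_ / => [i|i t t' h h'|a i u m du dm].
- by rewrite fock_ext_theta (ind_ext0 (V := Umod M) fD fc fg fp); apply: (gr0 (fg_grP M).1).
- rewrite thetaD -[_ + _](scale1r) scalerDr scale1r.
  have := fock_ext_linear 1 (theta t) (theta t'); rewrite !scale1r => ->.
  exact: (grD (fg_grP M).1).
by rewrite fock_ext_tensor -(subrK a i); apply: Umod_gr => //; apply: f_gr.
Qed.

Definition fock_ext : fgHom (Fock M0) M :=
  FgHom fock_ext_linear fock_ext_act fock_ext_gr.

End Extend.

Definition fock_unit (M0 : fdModule K N) (m : M0) : Fock M0 := theta (itensor 1 m).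

Lemma fock_unitD (M0 : fdModule K N) (x y : M0) : fock_unit (x + y) = fock_unit x + fock_unit y.
Proof. by rewrite /fock_unit itensorDr thetaD. Qed.
Lemma fock_unit_const (M0 : fdModule K N) c (m : M0) : fock_unit (Zconst N c *: m) = c *: fock_unit m.
Proof. by rewrite /fock_unit itensor_const theta_const. Qed.
Lemma fock_unit_gen (M0 : fdModule K N) (x : modeZ N) (m : M0) :
  fock_unit (Zgen K x *: m) = mode_act (val x) (fock_unit m).
Proof. by rewrite /fock_unit itensor_gen theta_gen. Qed.
Lemma fock_unit_Omega (M0 : fdModule K N) (m : M0) : Omega (fock_unit m).
Proof. by move=> x hx; rewrite -theta_gen itensor_pos // theta0. Qed.
Lemma fock_unit_gr (M0 : fdModule K N) i (m : M0) : fd_gr i m -> fg_gr i (fock_unit m).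
Proof.
move=> hm; apply/theta_gr/(induced_gr_tensor (a := 0)); last by rewrite subr0.
exact: udegree_const.
Qed.

Lemma theta_tensor (M0 : fdModule K N) u (m : M0) :
  theta (itensor u m) = u *: (fock_unit m : Umod (Fock M0)) :> Fock M0.
Proof. by rewrite itensor_scale1 theta_Umod. Qed.

Lemma fock_hom_ext (M0 : fdModule K N) M (f g : fgHom (Fock M0) M) :
  (forall m, f (fock_unit m) = g (fock_unit m)) -> f = g.
Proof.
move=> fg; apply: fgHom_eq => y; rewrite -(theta_invK y).
apply: (induced_ext (f := f \o @theta M0) (g := g \o @theta M0)).
- by move=> s t; rewrite /= thetaD fgh_D.
- by move=> s t; rewrite /= thetaD fgh_D.
by move=> u m; rewrite /= theta_tensor !fgh_Umod fg.
Qed.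

Section FockMap.
Variables (M0 M0' : fdModule K N) (f : fdHom M0 M0').

Lemma fock_mapD x y : fock_unit (f (x + y)) = fock_unit (f x) + fock_unit (f y).
Proof. by rewrite fdhD fock_unitD. Qed.
Lemma fock_map_const c m : fock_unit (f (Zconst N c *: m)) = c *: fock_unit (f m).
Proof. by rewrite fdhZ fock_unit_const. Qed.
Lemma fock_map_gen (x : modeZ N) m :
  fock_unit (f (Zgen K x *: m)) = mode_act (val x) (fock_unit (f m)).
Proof. by rewrite fdhZ fock_unit_gen. Qed.

Definition fock_map : fgHom (Fock M0) (Fock M0') :=
  fock_ext fock_mapD fock_map_const fock_map_gen (fun m => @fock_unit_Omega M0' (f m))
    (fun i m h => fock_unit_gr (fdh_gr f h)).

Lemma fock_map_tensor u m : fock_map (theta (itensor u m)) = theta (itensor u (f m)).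
Proof.
rewrite [RHS]theta_tensor; apply: (fock_ext_tensor fock_mapD fock_map_const fock_map_gen).
by move=> n; apply: fock_unit_Omega.
Qed.

Lemma fock_map_unit m : fock_map (fock_unit m) = fock_unit (f m).
Proof. exact: fock_map_tensor. Qed.

End FockMap.

Definition Ind_functor : functor (fdCat K N) (fgCat F).
Proof.
refine (@Functor (fdCat K N) (fgCat F) Fock (fun A B f => fock_map f) _ _).
- by move=> A; apply: fock_hom_ext => m; apply: etrans (fock_map_unit _ m) _.
- move=> A B E g f; apply: fock_hom_ext => m; apply: etrans (fock_map_unit _ m) _.
  exact: esym (etrans (congr1 (fock_map g) (fock_map_unit f m)) (fock_map_unit g (fdh f m))).
Defined.

Lemma Ind_functorP : is_Ind_functor Ind_functor.
Proof.
exists (fun A => @theta A); split.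
- exact: theta_bij.
- exact: thetaD.
- exact: theta_const.
- exact: theta_gen.
split; first exact: theta_gr.
by move=> M0 M0' f u m; apply: fock_map_tensor.
Qed.

Lemma fg_bij_iso M M' (f : fgHom M M') : bijective f -> @is_iso (fgCat F) M M' f.
Proof.
move=> [g fK gK]; have fI := can_inj fK.
have glin : linear g by move=> c x y; apply: fI; rewrite fgh_linear !gK.
have gact n u y : g (fg_act n u y) = fg_act n u (g y) by apply: fI; rewrite fgh_act !gK.
have ggr i y : fg_gr i y -> fg_gr i (g y).
  move=> hy; apply: (gr_reflect (fgh_D f) (fgh_0 f) fI (@fgh_gr _ _ _ _ _ f) (fg_grP M').1).
  - by move=> j; apply: (gr0 (fg_grP M).1).
  - by move=> m; exists (gr_comp (fg_grP M).1 m); apply: gr_compP.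
  by rewrite gK.
by exists (FgHom glin gact ggr); split; apply: fgHom_eq => x; [apply: fK | apply: gK].
Qed.

Lemma fd_bij_iso (A B : fdModule K N) (f : fdHom A B) : bijective f ->
  @is_iso (fdCat K N) A B f.
Proof.
move=> [g fK gK]; have fI := can_inj fK.
have glin : linear g by move=> c x y; apply: fI; rewrite fdh_linear !gK.
have ggr i y : fd_gr i y -> fd_gr i (g y).
  by move=> hy; apply: (fdh_gr_reflect fI); rewrite gK.
by exists (FdHom glin ggr); split; apply: fdHom_eq => x; [apply: fK | apply: gK].
Qed.

Local Notation W := (Omega_functor F charK).

Section Counit.
Variable M : fgModule F.
Local Notation OM := (Omega_module charK M).

Lemma Omega_valD (x y : OM) : Omega_val (x + y) = Omega_val x + Omega_val y :> M.
Proof. by []. Qed.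
Lemma Omega_val_const c (m : OM) : Omega_val (Zconst N c *: m) = c *: Omega_val m :> M.
Proof. exact: Zmod_const. Qed.
Lemma Omega_val_gen (x : modeZ N) (m : OM) :
  Omega_val (Zgen K x *: m) = mode_act (val x) (Omega_val m) :> M.
Proof. exact: Zmod_gen. Qed.
Lemma Omega_valP (m : OM) : Omega (Omega_val m : M).
Proof. exact: (sub_valP m). Qed.

Definition counit : fgHom (Fock OM) M :=
  fock_ext Omega_valD Omega_val_const Omega_val_gen Omega_valP (fun i m h => h).

Lemma counit_unit m : counit (fock_unit m) = Omega_val m.
Proof.
apply: etrans (scale1r (Omega_val m : Umod M)).
exact: (fock_ext_tensor Omega_valD Omega_val_const Omega_val_gen Omega_valP).
Qed.

Lemma Fock_singular (M0 : fdModule K N) (y : Fock M0) : Omega y -> exists m, y = fock_unit m.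
Proof.
move=> hy; have st : singular (theta_inv y).
  move=> x hx; apply: (bij_inj (theta_bij M0)).
  by rewrite theta_gen theta_invK hy // theta0.
have [m E] := singular_pure charK st.
by exists m; rewrite /fock_unit -E theta_invK.
Qed.

Lemma counit_bij : bijective counit.
Proof.
apply: inj_surj_bijective.
  apply: (smooth_inj charK (@Umod_smooth _ _ _ (Fock OM)) (M' := Umod M)).
  - exact: fgh_D.
  - exact: fgh_Umod.
  move=> y /Umod_singular/Fock_singular[m ->]; rewrite counit_unit => m0.
  have -> : m = 0 by apply: sub_val_inj.
  apply: (addIr (fock_unit (0 : OM))); rewrite -[LHS]fock_unitD add0r.
  by rewrite [RHS]add0r.
move=> m; elim: (smooth_neg_span charK (@Umod_smooth _ _ _ M) m) =>
  {m} [m /Umod_singular sm|_ _ _ [x <-] _ [y <-]|c _ _ [x <-]|x _ _ _ [y <-]].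
- exists (fock_unit (sub_mk (M := Zmod M) (Omega0 M) (@Omega_lin _ _ _ M) sm : OM)).
  exact: counit_unit.
- by exists (x + y); rewrite fgh_D.
- by exists (Uconst N c *: (x : Umod (Fock OM))); rewrite fgh_Umod.
- by exists (Ugen K N x *: (y : Umod (Fock OM))); rewrite fgh_Umod.
Qed.

End Counit.

Section Unit.
Variable M0 : fdModule K N.
Local Notation OF := (Omega_module charK (Fock M0)).

Definition unit_fun (m : M0) : OF :=
  sub_mk (M := Zmod (Fock M0)) (Omega0 _) (@Omega_lin _ _ _ _) (fock_unit_Omega m).

Definition unit_hom : fdHom M0 OF.
Proof.
exists unit_fun => [|i m]; last exact: fock_unit_gr.
have unitD x y : unit_fun (x + y) = unit_fun x + unit_fun y.
  by apply: sub_val_inj; apply: fock_unitD.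
move=> u x y; rewrite unitD; congr (_ + _).
apply: (Zg_scale_comm (f := unit_fun)) => //.
- by move=> c m; apply: sub_val_inj; rewrite [RHS]Zmod_const; apply: fock_unit_const.
- by move=> z m; apply: sub_val_inj; rewrite [RHS]Zmod_gen; apply: fock_unit_gen.
Defined.

Lemma unit_bij : bijective unit_hom.
Proof.
apply: inj_surj_bijective => [x y E|w].
  apply/eqP; rewrite -subr_eq0; apply/eqP; apply: fock_unit_eq0.
  have /(congr1 (@Omega_val _ _ _ _)) : unit_hom (x - y) = 0 by rewrite fdhB E subrr.
  by [].
have [m E] := Fock_singular (Omega_valP w).
by exists m; apply: sub_val_inj; apply: (esym E).
Qed.

End Unit.

Theorem Omega_Ind_inverse : mutually_inverse W Ind_functor.
Proof.
split.
  exists counit; split=> [M|M M' f]; first exact/fg_bij_iso/counit_bij.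
  apply: fock_hom_ext => m.
  have h1 : counit M' (fock_map (Omega_hom charK f) (fock_unit m)) = f (Omega_val m).
    by rewrite fock_map_unit counit_unit.
  exact: etrans h1 (esym (congr1 (fgh f) (counit_unit m))).
apply: naturally_isomorphic_sym; exists unit_hom; split=> [A|A B f].
  exact/fd_bij_iso/unit_bij.
apply: fdHom_eq => m; apply: sub_val_inj.
exact: (esym (fock_map_unit f m)).
Qed.

End IndFunctor.

Theorem corollary6p20 (R : realType) (N : nat) (hN : (1 <= N)%N)
    (F : freeFieldAlgebra R[i] N) :
  is_abelian (fgCat F) /\ is_abelian (fdCat R[i] N) /\
  exists (W : functor (fgCat F) (fdCat R[i] N))
         (T : functor (fdCat R[i] N) (fgCat F)),
    is_Omega_functor W /\ is_Ind_functor T /\ mutually_inverse W T.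
Proof.
have charK : [pchar R[i]] =i pred0 := Num.Theory.pchar_num _.
have inv := Omega_Ind_inverse F charK; have abD := fdCat_abelian R[i] N.
split; first exact: abelian_transfer inv abD.
split=> //; exists (Omega_functor F charK), (Ind_functor F charK).
by split; [exact: Omega_functorP | split; [exact: Ind_functorP | exact: inv]].
Qed.
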